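(* Consider the nonlocal lattice equation $$u_n'(t)=D[u_{n+1}(t)+u_{n-1}(t)-2u_n(t)]-u_n(t)+\sum_{k\in\mathbb{Z}}\beta(n-k)g(u_k(t-h)),\quad n\in\mathbb{Z},$$ with $D>0$, $h>0$, $\beta(k)\ge0$, $\sum_{k\in\mathbb{Z}}\beta(k)=1$, such that $\gamma^\#>0$ and $B(\gamma^\#-)=+\infty$. Assume $g$ satisfies (H) except that $g$ is only required to be nondecreasing (not necessarily strictly increasing). Let $c\neq0$ and suppose $w_j(t)=\phi(j+ct)$ and $v_j(t)=\psi(j+ct)$ are two traveling fronts of this equation with the same velocity $c$. Then there exists $s_0\in\mathbb{R}$ such that $\phi(s)=\psi(s+s_0)$ for all $s\in\mathbb{R}$.
   Context: Hypothesis (H) (with weakened monotonicity): $g:\mathbb{R}_+\to\mathbb{R}_+$ is continuous and nondecreasing; $g(x)=x$ has exactly two nonnegative solutions $0$ and $\kappa>0$; $g$ is differentiable at $0,\kappa$ with $g'(0)>1$, $g'(\kappa)<1$; $g$ is $C^1$ near $\kappa$; and there exist $C>0$, $\theta\in(0,1]$, $\delta>0$ with $|g(u)/u-g'(0)|\le Cu^\theta$ for $u\in(0,\delta]$. $B(z)=\sum_{k\in\mathbb{Z}}\beta(k)e^{-zk}$, and $\gamma^\#\in[0,+\infty]$ is such that $B(z)<\infty$ for $z\in[0,\gamma^\#)$ and $B(z)=\infty$ for $z>\gamma^\#$ (i.e. $\gamma^\#=-\limsup_{k\to+\infty}k^{-1}\ln\beta(-k)$, with $\ln 0=-\infty$).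 A traveling front with velocity $c$ is $u_j(t)=\varphi(j+ct)$ where $\varphi:\mathbb{R}\to(0,\infty)$ is bounded, differentiable, with $\varphi(-\infty)=0$, $\varphi(+\infty)=\kappa$, satisfying $c\varphi'(t)=D[\varphi(t+1)+\varphi(t-1)-2\varphi(t)]-\varphi(t)+\sum_{k\in\mathbb{Z}}\beta(k)g(\varphi(t-k-ch))$ for all $t\in\mathbb{R}$. Fronts are not assumed monotone. *)

(* Defs.v *)
From Stdlib Require Import Reals Lra ZArith.
Open Scope R_scope.

(* Sum over Z of f equals l, via symmetric partial sums
   f 0 + sum_{n=1}^N (f n + f (-n)).  All sums used below have nonnegative
   terms, so this coincides with (unconditional) summation over Z. *)
Definition Zsum_to (f : Z -> R) (l : R) : Prop :=
  infinite_sum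
    (fun n : nat => match n with
                    | O => f 0%Z
                    | S _ => f (Z.of_nat n) + f (- Z.of_nat n)%Z
                    end) l.

Definition Bval (beta : Z -> R) (z l : R) : Prop :=
  Zsum_to (fun k => beta k * exp (- (z * IZR k))) l.

Definition B_finite (beta : Z -> R) (z : R) : Prop := exists l, Bval beta z l.

(* gamma^# > 0 and B(gamma^# -) = +infinity.  Either gamma^# is a finite
   positive real, or gamma^# = +infinity. *)
Definition gamma_cond (beta : Z -> R) : Prop :=
  (exists gam : R, 0 < gam /\
     (forall z, 0 <= z < gam -> B_finite beta z) /\
     (forall z, gam < z -> ~ B_finite beta z) /\
     (forall M, exists del, 0 < del /\
        forall z l, gam - del < z < gam -> Bval beta z l -> M < l))
  \/
  ((forall z, 0 <= z -> B_finite beta z) /\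
   (forall M, exists Z0, forall z l, Z0 < z -> Bval beta z l -> M < l)).

Definition hyp_H_weak (g : R -> R) (kappa : R) : Prop :=
  0 < kappa /\
  (forall x, 0 <= x -> 0 <= g x) /\
  (forall x, 0 <= x -> forall eps, 0 < eps -> exists del, 0 < del /\
     forall y, 0 <= y -> Rabs (y - x) < del -> Rabs (g y - g x) < eps) /\
  (forall x y, 0 <= x -> x <= y -> g x <= g y) /\
  (forall x, 0 <= x -> (g x = x <-> (x = 0 \/ x = kappa))) /\
  (exists g0, 1 < g0 /\
     (forall eps, 0 < eps -> exists del, 0 < del /\
        forall u, 0 < u < del -> Rabs ((g u - g 0) / u - g0) < eps) /\
     (exists C theta del, 0 < C /\ 0 < theta <= 1 /\ 0 < del /\
        forall u, 0 < u <= del -> Rabs (g u / u - g0) <= C * Rpower u theta)) /\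
  (exists (dg : R -> R) (eps : R), 0 < eps /\
     (forall x, Rabs (x - kappa) < eps -> derivable_pt_lim g x (dg x)) /\
     (forall x, Rabs (x - kappa) < eps -> continuity_pt dg x) /\
     dg kappa < 1).

(* phi is a traveling front profile with velocity c:
   u_j(t) = phi(j + c t), phi : R -> (0,inf) bounded, differentiable,
   phi(-inf) = 0, phi(+inf) = kappa, and
   c phi'(t) = D[phi(t+1)+phi(t-1)-2phi(t)] - phi(t)
               + sum_k beta(k) g(phi(t - k - c h)). *)
Definition traveling_front (D h : R) (beta : Z -> R) (g : R -> R)
    (kappa c : R) (phi : R -> R) : Prop :=
  (forall t, 0 < phi t) /\
  (exists M, forall t, Rabs (phi t) <= M) /\
  (forall eps, 0 < eps -> exists T, forall t, t < T -> Rabs (phi t) < eps) /\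
  (forall eps, 0 < eps -> exists T, forall t, T < t -> Rabs (phi t - kappa) < eps) /\
  (exists dphi : R -> R,
     (forall t, derivable_pt_lim phi t (dphi t)) /\
     (forall t,
        Zsum_to (fun k => beta k * g (phi (t - IZR k - c * h)))
          (c * dphi t - D * (phi (t + 1) + phi (t - 1) - 2 * phi t) + phi t))).

(* Main.v *)
Require Import Defs.
From Stdlib Require Import Reals Lra Lia ZArith Classical.
From Coquelicot Require Import Coquelicot.
Open Scope R_scope.

(** Each front decays at [-oo] with an exact exponential rate [lam > 0], the supremum of all [z] with
    [phi = O(e^(z t))].  Below a positive value of the characteristic function the rate can be improved
    (integrate the equation over a half line), and a negative value is excluded by the
    barriers [A e^(z' t) + nu e^(z t)]; hence [lam] is a zero of the characteristic function, and
    [gamma_cond] serves only to make it an interior point of the domain of [B].  Then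
    [p = phi e^(- lam t)] solves [c p' = sum_j a_j (p(t - r_j) - p(t)) + f] with [f] exponentially
    smaller, and the flux [A = c p + sum_j a_j int_(t - r_j)^t p] converges, since [A' = f].  At a
    near-extremum of [p] over a slowly varying weight the Harnack inequality makes [p] almost constant
    on long intervals, so the flux determines the extremal value, as in Feller's proof of the renewal
    theorem.  When the flux has total mass zero (double root) its primitive is used instead.  Thus
    [phi] is asymptotic to [x e^(lam t)] or to [x |t| e^(lam t)] with [x > 0], also for fronts that are
    not pulled.  Two fronts are then compared by sliding: [psi(. + s) <= phi] for [s] very negative, and
    at the largest such [s0] either the fronts touch, hence coincide, or their ratio at [-oo] is 1;
    exchanging the roles of the two fronts settles the second case. *)

(** * Calculus and series *)

(** Two obstacles shape the argument. Fronts need not be monotone and [g] need not lie below its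
    tangent at 0, so neither a Tauberian theorem for monotone functions nor the inequality
    [g u <= g0 * u] is at hand; the limit of [p] comes from a Harnack inequality, and the Hoelder
    condition enters as [|g u - g0 u| = O(u^(1 + th))], which makes the error term smaller by an
    exponential factor. Moreover [g] may be locally constant, so the convolution term cannot
    propagate a strict inequality. Propagation rests on the nearest-neighbour coupling [D > 0],
    which acts both forwards and backwards and thus covers both signs of [c]. Near [kappa] a slope
    below 1 gives a maximum principle, which replaces asymptotics at [+oo]. For a front,
    [c + sum_j a_j r_j] is minus the derivative of the characteristic function at [lam], and
    [sum_j a_j r_j^2] is its second derivative, which is positive; hence a single passage to the
    primitive is enough when the root is double. *)

Lemma is_derive_nonneg_le (f df : R -> R) (a b : R) :
  a <= b ->
  (forall x, a <= x <= b -> is_derive f x (df x)) ->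
  (forall x, a <= x <= b -> 0 <= df x) ->
  f a <= f b.
Proof.
  intros Hab Hd Hp.
  destruct (Req_dec a b) as [->|Hne]; [lra|].
  destruct (MVT_cor2 f df a b) as [x [Hx1 Hx2]]; [lra| |].
  - intros x Hx. apply is_derive_Reals. apply Hd; lra.
  - assert (0 <= df x) by (apply Hp; lra). nra.
Qed.

(** Entry to the maximum principles below: a violation at one point [t1] is turned into a global
    maximum, where the equation can be evaluated. *)
Lemma continuous_max_attained (f : R -> R) (C T : R) (t1 : R) :
  (forall t, continuous f t) ->
  (forall t, T < Rabs t -> f t <= C) -> C < f t1 ->
  exists t0, C < f t0 /\ forall t, f t <= f t0.
Proof.
  intros Hc Hout H1.
  assert (HT : Rabs t1 <= T).
  { destruct (Rle_lt_dec (Rabs t1) T) as [H|H]; [exact H|]. specialize (Hout _ H). lra. }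
  assert (HT0 : 0 <= T) by (pose proof (Rabs_pos t1); lra).
  destruct (continuity_ab_maj f (-T) T) as [t0 [Ht0 _]]; [lra| |].
  - intros t _. apply continuity_pt_filterlim. apply Hc.
  - assert (Hb := Rabs_le_between t1 T). assert (f t1 <= f t0) by (apply Ht0; tauto).
    exists t0; split; [lra|].
    intros t. destruct (Rle_lt_dec (Rabs t) T) as [H2|H2].
    + apply Ht0. apply Rabs_le_between; exact H2.
    + specialize (Hout _ H2); lra.
Qed.

(** Tannery's theorem along an arbitrary filter: tails beyond [N] are at most those of [M], and
    finite sums converge termwise. Punctured neighbourhoods yield derivatives of series, ordinary
    ones yield continuity. *)
Lemma series_dominated {I : Type} (F : (I -> Prop) -> Prop) {FF : Filter F}
  (x : I -> nat -> R) (y M : nat -> R) :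
  ex_series M ->
  (forall j, filterlim (fun s => x s j) F (locally (y j))) ->
  F (fun s => forall j, Rabs (x s j) <= M j) ->
  (forall j, Rabs (y j) <= M j) ->
  filterlim (fun s => Series (x s)) F (locally (Series y)).
Proof.
  intros HM Hx Hb Hy.
  assert (HMn : forall n, ex_series (fun k => M (n + k)%nat)) by (intros n; apply (ex_series_incr_n M n); exact HM).
  assert (Hexy : ex_series y).
  { apply ex_series_Rabs. apply (ex_series_le (fun j => Rabs (y j)) M); [|exact HM].
    intros n. unfold norm; simpl; unfold abs; simpl. rewrite Rabs_Rabsolu. apply Hy. }
  apply filterlim_locally. intros eps.
  assert (He4 : 0 < eps / 4) by (pose proof (cond_pos eps); lra).
  assert (Hlim : is_lim_seq (fun n => sum_n M n) (Series M)) by (apply Series_correct in HM; exact HM).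
  apply is_lim_seq_spec in Hlim.
  destruct (Hlim (mkposreal _ He4)) as [N HN]. simpl in HN.
  assert (Htail : Series (fun k => M (S N + k)%nat) < eps / 4).
  { pose proof (Series_incr_n M (S N) ltac:(lia) HM) as H. simpl pred in H.
    specialize (HN N (le_n N)). unfold Rminus in HN.
    rewrite <- sum_n_Reals in H. rewrite H in HN.
    apply Rabs_def2 in HN. lra. }
  assert (Hfin : filterlim (fun s => sum_n (x s) N) F (locally (sum_n y N))).
  { clear -Hx FF. induction N as [|N IH].
    - rewrite sum_O. eapply filterlim_ext; [|apply (Hx O)]. intros s; simpl. rewrite sum_O; reflexivity.
    - rewrite sum_Sn. eapply filterlim_ext; [intros s; symmetry; apply sum_Sn|].
      eapply filterlim_comp_2; [exact IH|apply (Hx (S N))|].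
      apply (filterlim_plus (sum_n y N) (y (S N))). }
  assert (Hfin' := proj1 (filterlim_locally _ _) Hfin (mkposreal _ He4)).
  generalize (filter_and _ _ Hb Hfin'). apply filter_imp. intros s [Hs1 Hs2].
  assert (Hexx : ex_series (x s)).
  { apply ex_series_Rabs. apply (ex_series_le (fun j => Rabs (x s j)) M); [|exact HM].
    intros n. unfold norm; simpl; unfold abs; simpl. rewrite Rabs_Rabsolu. apply Hs1. }
  assert (Hgen : forall z : nat -> R, ex_series z -> (forall j, Rabs (z j) <= M j) ->
     Rabs (Series z - sum_n z N) <= Series (fun k => M (S N + k)%nat)).
  { intros z Hz Hzb.
    rewrite (Series_incr_n z (S N)) by (lia || exact Hz). simpl pred. rewrite <- sum_n_Reals.
    replace (sum_n z N + Series (fun k => z (S N + k)%nat) - sum_n z N)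
      with (Series (fun k => z (S N + k)%nat)) by ring.
    assert (Hae : ex_series (fun k => Rabs (z (S N + k)%nat))).
    { apply (ex_series_le (fun k => Rabs (z (S N + k)%nat)) (fun k => M (S N + k)%nat)); [|apply HMn].
      intros n. unfold norm; simpl; unfold abs; simpl. rewrite Rabs_Rabsolu. apply Hzb. }
    eapply Rle_trans; [apply Series_Rabs; exact Hae|].
    apply Series_le; [|apply HMn]. intros n; split; [apply Rabs_pos|apply Hzb]. }
  pose proof (Hgen _ Hexx Hs1) as G1. pose proof (Hgen _ Hexy Hy) as G2.
  unfold ball in *; simpl in *; unfold AbsRing_ball, abs, minus, plus, opp in *; simpl in *.
  apply Rabs_le_between in G1. apply Rabs_le_between in G2. apply Rabs_def2 in Hs2.
  apply Rabs_def1; lra.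
Qed.

(** * Harnack inequality for advance-delay inequalities *)

Lemma derivative_bound_lipschitz (f df : R -> R) (a b K : R) :
  (forall x, Rmin a b <= x <= Rmax a b -> is_derive f x (df x)) ->
  (forall x, Rmin a b <= x <= Rmax a b -> Rabs (df x) <= K) ->
  Rabs (f b - f a) <= K * Rabs (b - a).
Proof.
  intros Hd Hb.
  destruct (MVT_gen f a b df) as [x [Hx1 Hx2]].
  - intros x Hx. apply Hd; lra.
  - intros x Hx. apply continuity_pt_filterlim. apply (ex_derive_continuous f x).
    exists (df x). apply Hd; lra.
  - rewrite Hx2, Rabs_mult. apply Rmult_le_compat_r; [apply Rabs_pos|]. apply Hb; lra.
Qed.

(** By the mean value inequality the difference quotients of [F j] are bounded by [M j], so
    dominated convergence applies along the punctured neighbourhood of 0. *)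
Lemma is_derive_Series (F f : nat -> R -> R) (M : nat -> R) (t0 : R) :
  (forall j t, Rabs (t - t0) <= 1 -> is_derive (F j) t (f j t)) ->
  (forall j t, Rabs (t - t0) <= 1 -> Rabs (f j t) <= M j) ->
  ex_series M ->
  (forall t, ex_series (fun j => F j t)) ->
  is_derive (fun t => Series (fun j => F j t)) t0 (Series (fun j => f j t0)).
Proof.
  intros Hd Hb HM Hex.
  apply is_derive_Reals. intros eps Heps.
  assert (H := series_dominated (locally' 0)
    (fun h j => (F j (t0 + h) - F j t0) / h) (fun j => f j t0) M HM).
  assert (Hlim : filterlim (fun h => Series (fun j => (F j (t0 + h) - F j t0) / h))
    (locally' 0) (locally (Series (fun j => f j t0)))).
  { apply H; clear H.
    - intros j. assert (Hj := Hd j t0). apply is_derive_Reals in Hj; [|rewrite Rminus_diag, Rabs_R0; lra].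
      apply filterlim_locally. intros e. destruct (Hj e (cond_pos e)) as [d Hd'].
      exists d. intros h Hh Hh0. unfold ball in *; simpl in *; unfold AbsRing_ball, abs, minus, plus, opp in *; simpl in *.
      apply Hd'; [exact Hh0|]. replace h with (h + - 0) by ring. exact Hh.
    - exists (mkposreal 1 Rlt_0_1). intros h Hh Hh0 j.
      unfold ball in *; simpl in *; unfold AbsRing_ball, abs, minus, plus, opp in *; simpl in *.
      replace (h + - 0) with h in Hh by ring.
      assert (Hl : Rabs (F j (t0 + h) - F j t0) <= M j * Rabs (t0 + h - t0)).
      { assert (Hseg : forall x, Rmin t0 (t0 + h) <= x <= Rmax t0 (t0 + h) -> Rabs (x - t0) <= 1).
        { intros x Hx. apply Rabs_def2 in Hh. unfold Rmin, Rmax in Hx. apply Rabs_le.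
          destruct (Rle_dec t0 (t0 + h)); lra. }
        apply derivative_bound_lipschitz with (df := f j); auto. }
      replace (t0 + h - t0) with h in Hl by ring.
      unfold Rdiv. rewrite Rabs_mult, Rabs_inv.
      assert (0 < Rabs h) by (apply Rabs_pos_lt; exact Hh0).
      apply (Rmult_le_reg_r (Rabs h)); [assumption|]. field_simplify; lra.
    - intros j. apply Hb. rewrite Rminus_diag, Rabs_R0; lra. }
  destruct (proj1 (filterlim_locally _ _) Hlim (mkposreal eps Heps)) as [d Hd'].
  exists d. intros h Hh0 Hh.
  assert (Hb' := Hd' h). unfold ball in *; simpl in *; unfold AbsRing_ball, abs, minus, plus, opp in *; simpl in *.
  replace (h + - 0) with h in Hb' by ring. specialize (Hb' Hh Hh0).
  replace ((Series (fun j => F j (t0 + h)) - Series (fun j => F j t0)) / h)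
    with (Series (fun j => (F j (t0 + h) - F j t0) / h)); [exact Hb'|].
  rewrite <- Series_minus by apply Hex. unfold Rdiv. apply Series_scal_r.
Qed.

(** Gronwall read backwards: [exp (k t) v] plus a linear term is nondecreasing, so a value of [v] is
    controlled by every later value. *)
Lemma harnack_back (k H C t1 t2 : R) (v dv : R -> R) :
  0 <= k -> 0 <= H -> t2 <= t1 -> 0 <= v t1 ->
  t1 - t2 <= C ->
  (forall t, t2 <= t <= t1 -> is_derive v t (dv t)) ->
  (forall t, t2 <= t <= t1 -> - k * v t - H <= dv t) ->
  v t2 <= exp (k * C) * (v t1 + C * H).
Proof.
  intros Hk HH Ht Hv0 HC Hd Hv.
  set (E := exp (k * (t1 - t2))).
  assert (Hm : exp (k * (t2 - t2)) * v t2 + E * H * t2 <= exp (k * (t1 - t2)) * v t1 + E * H * t1).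
  { apply is_derive_nonneg_le with (f := fun t => exp (k * (t - t2)) * v t + E * H * t)
      (df := fun t => exp (k * (t - t2)) * (dv t + k * v t) + E * H); [exact Ht| |].
    - intros t Htt. specialize (Hd t Htt). auto_derive.
      + exists (dv t); exact Hd.
      + replace (Derive (fun x => v x) t) with (dv t) by (symmetry; apply is_derive_unique; exact Hd). unfold Rminus; ring.
    - intros t Htt. specialize (Hv t Htt).
      assert (exp (k * (t - t2)) <= E).
      { unfold E. destruct (Req_dec (k * (t - t2)) (k * (t1 - t2))) as [e|e]; [rewrite e; lra|].
        left; apply exp_increasing. nra. }
      assert (0 < exp (k * (t - t2))) by apply exp_pos.
      nra. }
  replace (k * (t2 - t2)) with 0 in Hm by ring. rewrite exp_0 in Hm.
  fold E in Hm.
  assert (HE : E <= exp (k * C)).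
  { unfold E. destruct (Req_dec (k * (t1 - t2)) (k * C)) as [e|e]; [rewrite e; lra|].
    left; apply exp_increasing. nra. }
  assert (0 < E) by apply exp_pos.
  assert (v t2 <= E * (v t1 + (t1 - t2) * H)) by lra.
  assert (v t1 + (t1 - t2) * H <= v t1 + C * H) by nra.
  assert (0 <= v t1 + (t1 - t2) * H) by nra.
  nra.
Qed.

(** Put [v = u + eta >= 0]. Without the advanced term, [v] cannot fall faster than exponentially, so
    later values bound earlier ones ([Hback]). The advanced term gives the converse ([Hstep]): if
    [v] were large on all of [[t1 + 1/2, t1 + 1]], it would force so steep a rise on
    [[t1 - 1/2, t1]] that [v] would have been negative before. *)
Lemma harnack_pos (c a s : R) (N : nat) :
  0 < c -> 0 < a -> 0 <= s ->
  exists C, 0 < C /\ forall (u du : R -> R) (eta : R), 0 < eta ->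
    (forall t, is_derive u t (du t)) ->
    (forall t, Rabs t <= INR N + 2 -> a * u (t + 1) - s * u t - eta <= c * du t) ->
    (forall t, Rabs t <= INR N + 3 -> - eta <= u t) ->
    u 0 <= eta ->
    forall t, Rabs t <= INR N -> u t <= C * eta.
Proof.
  intros Hc Ha Hs.
  set (W := 2 * (INR N + 2)). pose proof (pos_INR N) as HN.
  set (k := s / c). assert (Hk : 0 <= k) by (apply Rdiv_le_0_compat; lra).
  set (E := exp (k * W)). assert (HE : 1 <= E).
  { unfold E. rewrite <- exp_0. destruct (Req_dec 0 (k * W)) as [e|e]; [rewrite <- e; lra|].
    left; apply exp_increasing. assert (0 <= k * W) by (unfold W; nra). lra. }
  set (H1 := (a + 1) / c). assert (HH1 : 0 < H1) by (apply Rdiv_lt_0_compat; lra).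
  set (C1 := E * (1 + W * H1)).
  assert (HC1 : 1 <= C1) by (unfold C1, W; assert (0 <= 2 * (INR N + 2) * H1) by nra; nra).
  (* Chosen so that [a * C2 = 4 c + s C1 + a + 1]: a value of [v (t + 1)] above [C2 (v t1 + eta)]
     then forces a slope of at least [4 (v t1 + eta)] at [t]. *)
  set (C2 := (4 * c + s * C1 + a + 1) / a).
  assert (HC2 : 0 < C2) by (apply Rdiv_lt_0_compat; nra).
  set (C3 := C1 * (C2 + 1)).
  assert (HC3 : 0 < C3) by (unfold C3; nra).
  exists (C1 * ((C3 + 1) ^ (2 * N) * 3)).
  assert (Hpw : 0 < (C3 + 1) ^ (2 * N)) by (apply pow_lt; lra).
  split; [apply Rmult_lt_0_compat; lra|].
  intros u du eta Heta Hd Hu Hlow H0.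
  set (v := fun t => u t + eta).
  assert (Hdv : forall t, is_derive v t (du t)).
  { intros t. unfold v. auto_derive; [exists (du t); apply Hd|]. replace (Derive (fun x => u x) t) with (du t) by (symmetry; apply is_derive_unique; apply Hd); ring. }
  assert (Hv0 : forall t, Rabs t <= INR N + 3 -> 0 <= v t) by (intros t Ht; unfold v; specialize (Hlow t Ht); lra).
  assert (Hvd : forall t, Rabs t <= INR N + 2 -> a * v (t + 1) - s * v t - (a + 1) * eta <= c * du t).
  { intros t Ht. specialize (Hu t Ht). unfold v. nra. }
  assert (Hback : forall t1 t2, Rabs t1 <= INR N + 2 -> Rabs t2 <= INR N + 2 -> t2 <= t1 ->
     v t2 <= C1 * (v t1 + eta)).
  { intros t1 t2 Ht1 Ht2 Ht. apply Rabs_le_between in Ht1. apply Rabs_le_between in Ht2.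
    assert (0 <= v t1) by (apply Hv0; apply Rabs_le; lra).
    assert (Hb : v t2 <= exp (k * W) * (v t1 + W * (H1 * eta))).
    { apply harnack_back with (dv := du); try assumption; try (unfold W; nra).
      - intros t _; apply Hdv.
      - intros t Htt. assert (Hx := Hvd t ltac:(apply Rabs_le; lra)).
        assert (0 <= v (t + 1)) by (apply Hv0; apply Rabs_le; lra).
        assert (- s * v t - (a + 1) * eta <= c * du t) by nra.
        apply (Rmult_le_reg_l c); [exact Hc|]. unfold k, H1. 
        replace (c * (- (s / c) * v t - (a + 1) / c * eta)) with (- s * v t - (a + 1) * eta) by (field; lra).
        lra. }
    fold E in Hb. unfold C1. assert (0 <= W * H1) by (unfold W; nra).
    assert (v t1 + W * (H1 * eta) <= (1 + W * H1) * (v t1 + eta)) by nra.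
    rewrite Rmult_assoc. eapply Rle_trans; [exact Hb|]. apply Rmult_le_compat_l; lra. }
  assert (Hstep : forall t1, 0 <= t1 <= INR N -> v (t1 + / 2) <= C3 * (v t1 + eta)).
  { intros t1 Ht1.
    assert (0 <= v t1) by (apply Hv0; apply Rabs_le; lra).
    destruct (classic (exists x, t1 + /2 <= x <= t1 + 1 /\ v x <= C2 * (v t1 + eta))) as [[x [Hx1 Hx2]]|Hno].
    - assert (Hb := Hback x (t1 + /2)). unfold C3.
      assert (v (t1 + /2) <= C1 * (v x + eta)) by (apply Hb; try apply Rabs_le; lra). nra.
    (* Slope [4 (v t1 + eta)] over a length of one half gives
       [v (t1 - 1/2) <= - v t1 - 2 eta < 0]. *)
    - exfalso.
      assert (Hm : v (t1 - /2) - 4 * (v t1 + eta) * (t1 - /2) <= v t1 - 4 * (v t1 + eta) * t1).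
      { apply is_derive_nonneg_le with (f := fun t => v t - 4 * (v t1 + eta) * t) (df := fun t => du t - 4 * (v t1 + eta)); [lra| |].
        - intros t _. auto_derive; [exists (du t); apply Hdv|]. replace (Derive (fun x => v x) t) with (du t) by (symmetry; apply is_derive_unique; apply Hdv); ring.
        - intros t Ht. assert (Hx := Hvd t ltac:(apply Rabs_le; lra)).
          assert (Hb : v t <= C1 * (v t1 + eta)) by (apply Hback; try apply Rabs_le; lra).
          assert (Hbig : C2 * (v t1 + eta) < v (t + 1)).
          { apply Rnot_le_lt. intros Hc'. apply Hno. exists (t + 1). split; [lra|exact Hc']. }
          assert (a * C2 = 4 * c + s * C1 + a + 1) by (unfold C2; field; lra).
          assert (s * v t <= s * (C1 * (v t1 + eta))) by (apply Rmult_le_compat_l; lra).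
          assert (a * (C2 * (v t1 + eta)) < a * v (t + 1)) by (apply Rmult_lt_compat_l; lra).
          assert (c * (4 * (v t1 + eta)) <= c * du t).
          { replace (a * (C2 * (v t1 + eta))) with (a * C2 * (v t1 + eta)) in * by ring. 
            replace (a * C2) with (4 * c + s * C1 + a + 1) in * by lra. nra. }
          apply (Rmult_le_reg_l c) in H5; lra. }
      assert (0 <= v (t1 - /2)) by (apply Hv0; apply Rabs_le; lra). nra. }
  (* Half steps lead from 0 to [N]; [Hback] then covers the whole of [[-N, N]] from its right
     end. *)
  assert (Hn : forall n, (n <= 2 * N)%nat -> v (INR n / 2) + eta <= (C3 + 1) ^ n * (3 * eta)).
  { induction n as [|n IH]; intros Hn.
    - simpl. unfold Rdiv. rewrite Rmult_0_l. unfold v. lra.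
    - specialize (IH ltac:(lia)).
      assert (INR n <= 2 * INR N) by (replace 2 with (INR 2) by reflexivity; rewrite <- mult_INR; apply le_INR; lia).
      pose proof (pos_INR n).
      assert (Hx := Hstep (INR n / 2) ltac:(lra)).
      rewrite S_INR. replace ((INR n + 1) / 2) with (INR n / 2 + /2) by field.
      simpl. assert (0 <= v (INR n / 2)) by (apply Hv0; apply Rabs_le; lra). nra. }
  assert (HvN : v (INR N) + eta <= (C3 + 1) ^ (2 * N) * (3 * eta)).
  { specialize (Hn (2 * N)%nat ltac:(lia)). rewrite mult_INR in Hn.
    replace (INR 2 * INR N / 2) with (INR N) in Hn by (simpl; field). exact Hn. }
  intros t Ht. apply Rabs_le_between in Ht.
  assert (Hb : v t <= C1 * (v (INR N) + eta)) by (apply Hback; try apply Rabs_le; lra).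
  assert (Hp1 : 1 <= (C3 + 1) ^ (2 * N)) by (apply pow_R1_Rle; lra).
  assert (v t <= C1 * ((C3 + 1) ^ (2 * N) * (3 * eta))).
  { eapply Rle_trans; [exact Hb|]. apply Rmult_le_compat_l; lra. }
  unfold v in *. lra.
Qed.

(** The reflection [t -> - t] changes the sign of [c] and exchanges advance and delay, which is why
    both inequalities are assumed. The case [eta = 0] is what the strong comparison principle
    uses. *)
Lemma harnack (c a s : R) (N : nat) :
  c <> 0 -> 0 < a -> 0 <= s ->
  exists C, 0 < C /\ forall (u du : R -> R) (eta : R), 0 <= eta ->
    (forall t, is_derive u t (du t)) ->
    (forall t, Rabs t <= INR N + 2 -> a * u (t + 1) - s * u t - eta <= c * du t) ->
    (forall t, Rabs t <= INR N + 2 -> a * u (t - 1) - s * u t - eta <= c * du t) ->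
    (forall t, Rabs t <= INR N + 3 -> - eta <= u t) ->
    u 0 <= eta ->
    forall t, Rabs t <= INR N -> u t <= C * eta.
Proof.
  intros Hc Ha Hs.
  assert (Hpos : exists C, 0 < C /\ forall (u du : R -> R) (eta : R), 0 < eta ->
    (forall t, is_derive u t (du t)) ->
    (forall t, Rabs t <= INR N + 2 -> a * u (t + 1) - s * u t - eta <= c * du t) ->
    (forall t, Rabs t <= INR N + 2 -> a * u (t - 1) - s * u t - eta <= c * du t) ->
    (forall t, Rabs t <= INR N + 3 -> - eta <= u t) ->
    u 0 <= eta ->
    forall t, Rabs t <= INR N -> u t <= C * eta).
  { destruct (Rle_lt_dec c 0) as [Hc0|Hc0].
    - destruct (harnack_pos (- c) a s N) as [C [HC H]]; [lra|exact Ha|exact Hs|].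
      exists C; split; [exact HC|]. intros u du eta Heta Hd H1 H2 Hl H0 t Ht.
      replace t with (- - t) by ring.
      apply (H (fun t => u (- t)) (fun t => - du (- t))); try assumption.
      + intros x. auto_derive; [exists (du (- x)); apply Hd|].
        replace (Derive (fun x => u x) (- x)) with (du (- x)) by (symmetry; apply is_derive_unique; apply Hd); ring.
      + intros x Hx. assert (Hx' : Rabs (- x) <= INR N + 2) by (rewrite Rabs_Ropp; exact Hx).
        specialize (H2 _ Hx'). replace (- (x + 1)) with (- x - 1) by ring. lra.
      + intros x Hx. apply Hl. rewrite Rabs_Ropp; exact Hx.
      + rewrite Ropp_0; exact H0.
      + rewrite Rabs_Ropp; exact Ht.
    - destruct (harnack_pos c a s N) as [C [HC H]]; [exact Hc0|exact Ha|exact Hs|].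
      exists C; split; [exact HC|]. intros u du eta Heta Hd H1 H2 Hl H0 t Ht.
      apply (H u du); assumption. }
  destruct Hpos as [C [HC H]]. exists C; split; [exact HC|].
  intros u du eta Heta Hd H1 H2 Hl H0 t Ht.
  apply Rle_plus_epsilon. intros e He.
  (* The lemma for positive defects is applied with [eta + e / C], which costs exactly [e] in the
     bound. *)
  set (e' := e / C). assert (He' : 0 < e') by (apply Rdiv_lt_0_compat; lra).
  replace (C * eta + e) with (C * (eta + e')) by (unfold e'; field; lra).
  apply (H u du); try assumption; try lra.
  - intros x Hx; specialize (H1 x Hx); lra.
  - intros x Hx; specialize (H2 x Hx); lra.
  - intros x Hx; specialize (Hl x Hx); lra.
Qed.

(** * Kernels and conserved fluxes *)

Lemma exp_le (x y : R) : x <= y -> exp x <= exp y.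
Proof.
  intros H. destruct (Req_dec x y) as [->|Hne]; [lra|]. left; apply exp_increasing; lra.
Qed.

Lemma ex_series_le_R (x y : nat -> R) :
  (forall j, Rabs (x j) <= y j) -> ex_series y -> ex_series x.
Proof.
  intros H Hy. apply (ex_series_le x y); [|exact Hy].
  intros n. unfold norm; simpl; unfold abs; simpl. apply H.
Qed.

Lemma Series_abs_le (x y : nat -> R) :
  (forall j, Rabs (x j) <= y j) -> ex_series y -> Rabs (Series x) <= Series y.
Proof.
  intros H Hy.
  eapply Rle_trans; [apply Series_Rabs|].
  - apply (ex_series_le_R _ y); [|exact Hy]. intros j; rewrite Rabs_Rabsolu; apply H.
  - apply Series_le; [|exact Hy]. intros j; split; [apply Rabs_pos|apply H].
Qed.

Lemma Series_nonneg (x : nat -> R) : (forall j, 0 <= x j) -> ex_series x -> 0 <= Series x.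
Proof.
  intros H Hx. replace 0 with (Series (fun _ => 0)).
  - apply Series_le; [|exact Hx]. intros j; specialize (H j); lra.
  - rewrite (Series_ext _ (fun j => 0 * 0)); [|intros; ring]. rewrite Series_scal_l; ring.
Qed.

Lemma Series_ge_term (x : nat -> R) (i : nat) :
  (forall j, 0 <= x j) -> ex_series x -> x i <= Series x.
Proof.
  intros H Hx. rewrite (Series_incr_n x (S i)); [|lia|exact Hx]. simpl pred.
  assert (0 <= Series (fun k => x (S i + k)%nat)).
  { apply Series_nonneg; [intros; apply H|]. apply (ex_series_incr_n x (S i)); exact Hx. }
  assert (x i <= sum_f_R0 x i).
  { destruct i; simpl; [lra|]. assert (0 <= sum_f_R0 x i) by (apply cond_pos_sum; exact H). lra. }
  lra.
Qed.

Lemma abs_le_exp (x e : R) : 0 < e -> Rabs x <= / e * exp (e * Rabs x).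
Proof.
  intros He. pose proof (exp_ineq1_le (e * Rabs x)) as H.
  apply (Rmult_le_reg_l e); [exact He|]. rewrite <- Rmult_assoc, Rinv_r by lra. lra.
Qed.

Lemma exp_abs_plus (e x y : R) : 0 <= e -> exp (e * Rabs (x + y)) <= exp (e * Rabs x) * exp (e * Rabs y).
Proof.
  intros He. rewrite <- exp_plus. apply exp_le. pose proof (Rabs_triang x y). nra.
Qed.

(** Exponential moments of order [e0]: sums against [a] tolerate arguments of size [exp (e0 |r|)].
    Later estimates work with fractions of [e0], and the remainder pays for powers of [|r|] and for
    the growth of solutions. *)
Record kernel (a r : nat -> R) (e0 : R) : Prop := {
  kernel_pos : 0 < e0;
  kernel_nonneg : forall j, 0 <= a j;
  kernel_summable : ex_series (fun j => a j * exp (e0 * Rabs (r j)))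
}.
Arguments kernel_pos {a r e0} _.
Arguments kernel_nonneg {a r e0} _.
Arguments kernel_summable {a r e0} _.

Lemma kernel_le (a r : nat -> R) (e0 e : R) : 0 < e <= e0 -> kernel a r e0 -> kernel a r e.
Proof.
  intros He [H1 H2 H3]. split; [lra|exact H2|].
  apply (ex_series_le_R _ (fun j => a j * exp (e0 * Rabs (r j)))); [|exact H3].
  intros j. rewrite Rabs_mult, (Rabs_pos_eq (a j)) by apply H2.
  rewrite Rabs_pos_eq by (left; apply exp_pos).
  apply Rmult_le_compat_l; [apply H2|]. apply exp_le. pose proof (Rabs_pos (r j)). nra.
Qed.

(** Each factor [|r|] costs an arbitrarily small part of the exponent, since
    [|r| <= exp (d |r|) / d]; the midpoint of [e] and [e0] leaves room for the next factor. *)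
Lemma kernel_moment (a r : nat -> R) (e0 e : R) (k : nat) :
  0 <= e < e0 -> kernel a r e0 ->
  ex_series (fun j => a j * (Rabs (r j) ^ k * exp (e * Rabs (r j)))).
Proof.
  intros He HK. revert e He. induction k as [|k IH]; intros e He.
  - destruct HK as [H1 H2 H3].
    apply (ex_series_le_R _ (fun j => a j * exp (e0 * Rabs (r j)))); [|exact H3].
    intros j. simpl. rewrite Rmult_1_l. rewrite Rabs_mult, (Rabs_pos_eq (a j)) by apply H2.
    rewrite Rabs_pos_eq by (left; apply exp_pos).
    apply Rmult_le_compat_l; [apply H2|]. apply exp_le. pose proof (Rabs_pos (r j)). nra.
  - set (e' := (e + e0) / 2). assert (He' : 0 <= e' < e0) by (unfold e'; lra).
    specialize (IH e' He').
    apply (ex_series_le_R _ (fun j => / (e' - e) * (a j * (Rabs (r j) ^ k * exp (e' * Rabs (r j)))))).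
    + intros j. pose proof (kernel_nonneg HK j) as Ha. pose proof (Rabs_pos (r j)) as Hr.
      assert (Hp : 0 <= Rabs (r j) ^ k) by (apply pow_le; exact Hr).
      pose proof (exp_pos (e * Rabs (r j))) as Hx.
      rewrite Rabs_pos_eq.
      * assert (Hd : 0 < e' - e) by (unfold e'; lra). pose proof (abs_le_exp (r j) (e' - e) Hd) as Hl.
        simpl. replace (exp (e' * Rabs (r j))) with (exp ((e' - e) * Rabs (r j)) * exp (e * Rabs (r j)))
          by (rewrite <- exp_plus; f_equal; ring).
        assert (0 <= a j * (Rabs (r j) ^ k * exp (e * Rabs (r j)))) by (repeat apply Rmult_le_pos; lra).
        replace (a j * (Rabs (r j) * Rabs (r j) ^ k * exp (e * Rabs (r j))))
          with (Rabs (r j) * (a j * (Rabs (r j) ^ k * exp (e * Rabs (r j))))) by ring.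
        replace (/ (e' - e) * (a j * (Rabs (r j) ^ k * (exp ((e' - e) * Rabs (r j)) * exp (e * Rabs (r j))))))
          with (/ (e' - e) * exp ((e' - e) * Rabs (r j)) * (a j * (Rabs (r j) ^ k * exp (e * Rabs (r j))))) by ring.
        apply Rmult_le_compat_r; assumption.
      * repeat apply Rmult_le_pos; try assumption; try lra.
    + apply (ex_series_scal_l (/ (e' - e))) in IH. exact IH.
Qed.

Lemma kernel_ex_series (a r x : nat -> R) (e0 G : R) :
  kernel a r e0 -> (forall j, Rabs (x j) <= G * exp (e0 * Rabs (r j))) ->
  ex_series (fun j => a j * x j).
Proof.
  intros [H1 H2 H3] Hx.
  apply (ex_series_le_R _ (fun j => G * (a j * exp (e0 * Rabs (r j))))).
  - intros j. rewrite Rabs_mult, (Rabs_pos_eq (a j)) by apply H2.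
    specialize (Hx j). specialize (H2 j). nra.
  - apply (ex_series_scal_l G) in H3. exact H3.
Qed.

Lemma kernel_Series_le (a r x : nat -> R) (e0 G : R) :
  kernel a r e0 -> (forall j, Rabs (x j) <= G * exp (e0 * Rabs (r j))) ->
  Rabs (Series (fun j => a j * x j)) <= G * Series (fun j => a j * exp (e0 * Rabs (r j))).
Proof.
  intros [H1 H2 H3] Hx. rewrite <- Series_scal_l. apply Series_abs_le.
  - intros j. rewrite Rabs_mult, (Rabs_pos_eq (a j)) by apply H2.
    specialize (Hx j). specialize (H2 j). nra.
  - apply (ex_series_scal_l G) in H3. exact H3.
Qed.

Lemma kernel_ex_series_a (a r : nat -> R) (e0 : R) : kernel a r e0 -> ex_series a.
Proof.
  intros HK. pose proof (kernel_moment a r e0 0 0 ltac:(pose proof (kernel_pos HK); lra) HK) as H.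
  eapply ex_series_ext; [|exact H]. intros j; simpl. rewrite Rmult_0_l, exp_0; ring.
Qed.

Lemma kernel_ex_series_ar (a r : nat -> R) (e0 : R) : kernel a r e0 -> ex_series (fun j => a j * r j).
Proof.
  intros HK. pose proof (kernel_moment a r e0 0 1 ltac:(pose proof (kernel_pos HK); lra) HK) as H.
  eapply ex_series_le_R; [|exact H]. intros j; simpl.
  rewrite Rmult_0_l, exp_0, !Rmult_1_r, Rabs_mult, (Rabs_pos_eq (a j)) by apply (kernel_nonneg HK). lra.
Qed.

(* A primitive of the delay equation [c p' = sum_j a_j (p(t - r_j) - p(t)) + f]:
   along its solutions the derivative of [flux c a r p P] is [f] whenever [P' = p]. *)
Definition flux (c : R) (a r : nat -> R) (p P : R -> R) (t : R) : R :=
  c * p t + Series (fun j => a j * (P t - P (t - r j))).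

Lemma primitive_increment (p P : R -> R) (G e t x : R) :
  0 <= e -> 0 <= G -> (forall t, is_derive P t (p t)) -> (forall t, Rabs (p t) <= G * exp (e * Rabs t)) ->
  Rabs (P t - P (t - x)) <= G * exp (e * Rabs t) * (Rabs x * exp (e * Rabs x)).
Proof.
  intros He HG0 HP Hp.
  eapply Rle_trans.
  - apply derivative_bound_lipschitz with (df := p) (K := G * exp (e * Rabs t) * exp (e * Rabs x)); [intros; apply HP|].
    intros y Hy. eapply Rle_trans; [apply Hp|]. rewrite Rmult_assoc, <- exp_plus.
    apply Rmult_le_compat_l; [exact HG0|]. apply exp_le.
    assert (Rabs y <= Rabs t + Rabs x).
    { apply Rabs_le. unfold Rmin, Rmax in Hy. unfold Rabs. destruct (Rle_dec (t - x) t), (Rcase_abs t), (Rcase_abs x); lra. }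
    nra.
  - replace (t - (t - x)) with x by ring. right; ring.
Qed.

Lemma ex_series_flux (a r : nat -> R) (e0 e G : R) (p P : R -> R) (t : R) :
  kernel a r e0 -> 0 <= e < e0 ->
  (forall t, is_derive P t (p t)) -> (forall t, Rabs (p t) <= G * exp (e * Rabs t)) ->
  ex_series (fun j => a j * (P t - P (t - r j))).
Proof.
  intros HK He HP Hp.
  assert (HG0 : 0 <= G).
  { specialize (Hp 0). pose proof (Rabs_pos (p 0)). pose proof (exp_pos (e * Rabs 0)). nra. }
  pose proof (kernel_moment a r e0 e 1 He HK) as HM.
  apply (ex_series_scal_l (G * exp (e * Rabs t))) in HM.
  eapply ex_series_le_R; [|exact HM]. intros j; simpl. unfold scal; simpl; unfold mult; simpl.
  rewrite Rabs_mult, (Rabs_pos_eq (a j)) by apply (kernel_nonneg HK).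
  pose proof (primitive_increment p P G e t (r j) ltac:(lra) HG0 HP Hp) as H.
  pose proof (kernel_nonneg HK j). rewrite Rmult_1_r. nra.
Qed.

Lemma is_derive_flux (c : R) (a r : nat -> R) (e0 e G : R) (p dp P : R -> R) (t : R) :
  kernel a r e0 -> 0 <= e < e0 ->
  (forall t, is_derive P t (p t)) -> (forall t, is_derive p t (dp t)) ->
  (forall t, Rabs (p t) <= G * exp (e * Rabs t)) ->
  is_derive (flux c a r p P) t (c * dp t + Series (fun j => a j * (p t - p (t - r j)))).
Proof.
  intros HK He HP Hdp Hp. unfold flux.
  assert (HG0 : 0 <= G).
  { specialize (Hp 0). pose proof (Rabs_pos (p 0)). pose proof (exp_pos (e * Rabs 0)). nra. }
  apply (is_derive_plus (fun t => c * p t) (fun t => Series (fun j => a j * (P t - P (t - r j))))).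
  - apply (is_derive_scal p t c (dp t)). apply Hdp.
  - apply (is_derive_Series (fun j t => a j * (P t - P (t - r j))) (fun j t => a j * (p t - p (t - r j)))
      (fun j => 2 * G * exp (e * (Rabs t + 1)) * (a j * exp (e0 * Rabs (r j))))).
    + intros j x _. apply (is_derive_scal (fun x => P x - P (x - r j)) x (a j)).
      apply (is_derive_minus P (fun x => P (x - r j))); [apply HP|].
      replace (p (x - r j)) with (1 * p (x - r j)) by ring.
      apply (is_derive_comp P (fun x => x - r j)); [apply HP|]. auto_derive; [exact I|ring].
    + intros j x Hx. rewrite Rabs_mult, (Rabs_pos_eq (a j)) by apply (kernel_nonneg HK).
      assert (Hx' : Rabs x <= Rabs t + 1).
      { replace x with (t + (x - t)) by ring. eapply Rle_trans; [apply Rabs_triang|]. lra. }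
      assert (Hxr : Rabs (x - r j) <= Rabs t + 1 + Rabs (r j)).
      { unfold Rminus. eapply Rle_trans; [apply Rabs_triang|]. rewrite Rabs_Ropp. lra. }
      assert (H1 : Rabs (p x - p (x - r j)) <= 2 * G * exp (e * (Rabs t + 1)) * exp (e0 * Rabs (r j))).
      { pose proof (Rabs_pos (r j)) as Hr0.
        assert (B1 : Rabs (p x) <= G * (exp (e * (Rabs t + 1)) * exp (e0 * Rabs (r j)))).
        { eapply Rle_trans; [apply Hp|]. apply Rmult_le_compat_l; [exact HG0|].
          rewrite <- exp_plus. apply exp_le. nra. }
        assert (B2 : Rabs (p (x - r j)) <= G * (exp (e * (Rabs t + 1)) * exp (e0 * Rabs (r j)))).
        { eapply Rle_trans; [apply Hp|]. apply Rmult_le_compat_l; [exact HG0|].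
          rewrite <- exp_plus. apply exp_le. nra. }
        unfold Rminus at 1. eapply Rle_trans; [apply Rabs_triang|]. rewrite Rabs_Ropp. lra. }
      pose proof (kernel_nonneg HK j). nra.
    + pose proof (kernel_summable HK) as HM.
      apply (ex_series_scal_l (2 * G * exp (e * (Rabs t + 1)))) in HM. exact HM.
    + intros x. eapply ex_series_flux; eassumption.
Qed.

(* [At] behaves on slowly varying [p] like the multiplication by its total mass [m]. *)
Definition mass_functional (p At : R -> R) (m e : R) : Prop :=
  exists C, 0 < C /\ forall t0 y k,
    (forall s, Rabs (p (t0 + s) - y) <= k * exp (e * Rabs s)) -> Rabs (At t0 - m * y) <= C * k.

(** For constant [p = y] one has [P t - P (t - r) = r y], so the flux is [(c + sum_j a_j r_j) y];
    the deviation of [p] from [y] enters through the first moment of the kernel. *)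
Lemma flux_mass (c : R) (a r : nat -> R) (e0 e G : R) (p P : R -> R) :
  kernel a r e0 -> 0 <= e < e0 ->
  (forall t, is_derive P t (p t)) -> (forall t, Rabs (p t) <= G * exp (e * Rabs t)) ->
  mass_functional p (flux c a r p P) (c + Series (fun j => a j * r j)) e.
Proof.
  intros HK He HP Hp.
  set (C := Rabs c + Series (fun j => a j * (Rabs (r j) ^ 1 * exp (e * Rabs (r j)))) + 1).
  pose proof (kernel_moment a r e0 e 1 He HK) as HM.
  assert (HS : 0 <= Series (fun j => a j * (Rabs (r j) ^ 1 * exp (e * Rabs (r j))))).
  { apply Series_nonneg; [|exact HM]. intros j. pose proof (kernel_nonneg HK j).
    pose proof (Rabs_pos (r j)). pose proof (exp_pos (e * Rabs (r j))). simpl.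
    repeat apply Rmult_le_pos; lra. }
  exists C. split; [pose proof (Rabs_pos c); unfold C; lra|].
  intros t0 y k H.
  assert (Hk : 0 <= k).
  { specialize (H 0). pose proof (Rabs_pos (p (t0 + 0) - y)). pose proof (exp_pos (e * Rabs 0)). nra. }
  unfold flux.
  replace (c * p t0 + Series (fun j => a j * (P t0 - P (t0 - r j))) - (c + Series (fun j => a j * r j)) * y)
    with (c * (p t0 - y) + Series (fun j => a j * (P t0 - P (t0 - r j) - r j * y))).
  2:{ rewrite (Series_ext (fun j => a j * (P t0 - P (t0 - r j) - r j * y))
        (fun j => a j * (P t0 - P (t0 - r j)) - y * (a j * r j))) by (intros; ring).
      rewrite Series_minus.
      - rewrite Series_scal_l. ring.
      - eapply ex_series_flux; eassumption.
      - pose proof (kernel_ex_series_ar a r e0 HK) as H1. apply (ex_series_scal_l y) in H1. exact H1. }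
  eapply Rle_trans; [apply Rabs_triang|]. rewrite Rabs_mult.
  assert (H0 : Rabs (p t0 - y) <= k).
  { specialize (H 0). rewrite Rplus_0_r, Rabs_R0, Rmult_0_r, exp_0 in H. lra. }
  assert (Hs : Rabs (Series (fun j => a j * (P t0 - P (t0 - r j) - r j * y)))
      <= Series (fun j => k * (a j * (Rabs (r j) ^ 1 * exp (e * Rabs (r j)))))).
  { apply Series_abs_le.
    - intros j. rewrite Rabs_mult, (Rabs_pos_eq (a j)) by apply (kernel_nonneg HK).
      replace (P t0 - P (t0 - r j) - r j * y) with ((P t0 - y * t0) - (P (t0 - r j) - y * (t0 - r j))) by ring.
      assert (Hi : Rabs ((fun x => P x - y * x) t0 - (fun x => P x - y * x) (t0 - r j))
         <= k * exp (e * Rabs (r j)) * Rabs (t0 - (t0 - r j))).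
      { apply (derivative_bound_lipschitz (fun x => P x - y * x) (fun x => p x - y) (t0 - r j) t0).
        - intros x _. apply (is_derive_minus P (fun x => y * x)); [apply HP|].
          auto_derive; [exact I|ring].
        - intros x Hx. replace x with (t0 + (x - t0)) by ring. eapply Rle_trans; [apply H|].
          apply Rmult_le_compat_l; [exact Hk|]. apply exp_le. apply Rmult_le_compat_l; [lra|].
          unfold Rmin, Rmax in Hx. unfold Rabs. destruct (Rle_dec (t0 - r j) t0), (Rcase_abs (x - t0)), (Rcase_abs (r j)); lra. }
      replace (t0 - (t0 - r j)) with (r j) in Hi by ring. pose proof (kernel_nonneg HK j).
      simpl. simpl in Hi. nra.
    - apply (ex_series_scal_l k) in HM. exact HM. }
  rewrite Series_scal_l in Hs.
  assert (Rabs c * Rabs (p t0 - y) <= Rabs c * k) by (apply Rmult_le_compat_l; [apply Rabs_pos|exact H0]).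
  unfold C. nra.
Qed.

(** Taylor expansion of [Q] to second order at [t0]. The terms containing [P t0] add up to
    [(c + sum_j a_j r_j) P t0 = 0], so the flux of the primitive depends on [p] again, through the
    second moment. *)
Lemma flux_mass2 (c : R) (a r : nat -> R) (e0 e G : R) (p P Q : R -> R) :
  kernel a r e0 -> 0 <= e < e0 ->
  (forall t, is_derive P t (p t)) -> (forall t, is_derive Q t (P t)) ->
  (forall t, Rabs (P t) <= G * exp (e * Rabs t)) ->
  c + Series (fun j => a j * r j) = 0 ->
  mass_functional p (flux c a r P Q) (- / 2 * Series (fun j => a j * (r j) ^ 2)) e.
Proof.
  intros HK He HP HQ HGP Hc.
  pose proof (kernel_moment a r e0 e 2 He HK) as HM.
  pose proof (kernel_moment a r e0 0 2 ltac:(lra) HK) as HM0.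
  assert (HM2 : ex_series (fun j => a j * r j ^ 2)).
  { eapply ex_series_ext; [|exact HM0]. intros j; simpl. rewrite Rmult_0_l, exp_0.
    rewrite !Rmult_1_r. rewrite <- Rabs_mult, Rabs_pos_eq by nra. reflexivity. }
  set (C := Series (fun j => a j * (Rabs (r j) ^ 2 * exp (e * Rabs (r j)))) + 1).
  assert (HS : 0 <= Series (fun j => a j * (Rabs (r j) ^ 2 * exp (e * Rabs (r j))))).
  { apply Series_nonneg; [|exact HM]. intros j. pose proof (kernel_nonneg HK j).
    pose proof (Rabs_pos (r j)). pose proof (exp_pos (e * Rabs (r j))). simpl.
    repeat apply Rmult_le_pos; lra. }
  exists C. split; [unfold C; lra|].
  intros t0 y k H.
  assert (Hk : 0 <= k).
  { specialize (H 0). pose proof (Rabs_pos (p (t0 + 0) - y)). pose proof (exp_pos (e * Rabs 0)). nra. }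
  unfold flux.
  replace (c * P t0 + Series (fun j => a j * (Q t0 - Q (t0 - r j))) - - / 2 * Series (fun j => a j * r j ^ 2) * y)
    with (Series (fun j => a j * (Q t0 - Q (t0 - r j) - P t0 * r j + y / 2 * r j ^ 2))).
  2:{ rewrite (Series_ext (fun j => a j * (Q t0 - Q (t0 - r j) - P t0 * r j + y / 2 * r j ^ 2))
        (fun j => a j * (Q t0 - Q (t0 - r j)) + (y / 2 * (a j * r j ^ 2) - P t0 * (a j * r j)))) by (intros; ring).
      pose proof (kernel_ex_series_ar a r e0 HK) as H1.
      assert (E1 : ex_series (fun j => y / 2 * (a j * r j ^ 2))) by (apply (ex_series_scal_l (y / 2)) in HM2; exact HM2).
      assert (E2 : ex_series (fun j => P t0 * (a j * r j))) by (apply (ex_series_scal_l (P t0)) in H1; exact H1).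
      rewrite Series_plus, Series_minus, !Series_scal_l; try assumption.
      - replace c with (- Series (fun j => a j * r j)) by lra. field.
      - eapply ex_series_flux; eassumption.
      - apply (ex_series_minus _ _ E1 E2). }
  assert (Hs : Rabs (Series (fun j => a j * (Q t0 - Q (t0 - r j) - P t0 * r j + y / 2 * r j ^ 2)))
      <= Series (fun j => k * (a j * (Rabs (r j) ^ 2 * exp (e * Rabs (r j)))))).
  { apply Series_abs_le.
    - intros j. rewrite Rabs_mult, (Rabs_pos_eq (a j)) by apply (kernel_nonneg HK).
      assert (Hseg : forall x, Rmin (t0 - r j) t0 <= x <= Rmax (t0 - r j) t0 -> Rabs (x - t0) <= Rabs (r j)).
      { intros x Hx. unfold Rmin, Rmax in Hx. unfold Rabs. destruct (Rle_dec (t0 - r j) t0), (Rcase_abs (x - t0)), (Rcase_abs (r j)); lra. }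
      assert (HPi : forall x, Rmin (t0 - r j) t0 <= x <= Rmax (t0 - r j) t0 ->
         Rabs (P x - P t0 - y * (x - t0)) <= k * exp (e * Rabs (r j)) * Rabs (r j)).
      { intros x Hx.
        assert (Hl := derivative_bound_lipschitz (fun x => P x - y * x) (fun x => p x - y) t0 x (k * exp (e * Rabs (r j)))).
        cbv beta in Hl. replace (P x - y * x - (P t0 - y * t0)) with (P x - P t0 - y * (x - t0)) in Hl by ring.
        eapply Rle_trans; [apply Hl|].
        - intros z _. apply (is_derive_minus P (fun x => y * x)); [apply HP|].
          auto_derive; [exact I|ring].
        - intros z Hz. replace z with (t0 + (z - t0)) by ring. eapply Rle_trans; [apply H|].
          apply Rmult_le_compat_l; [exact Hk|]. apply exp_le. apply Rmult_le_compat_l; [lra|].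
          apply Hseg. unfold Rmin, Rmax in *. destruct (Rle_dec (t0 - r j) t0), (Rle_dec t0 x); lra.
        - apply Rmult_le_compat_l; [|apply Hseg; exact Hx].
          apply Rmult_le_pos; [exact Hk|left; apply exp_pos]. }
      assert (Hi : Rabs ((fun x => Q x - P t0 * x - y / 2 * (x - t0) ^ 2) t0 - (fun x => Q x - P t0 * x - y / 2 * (x - t0) ^ 2) (t0 - r j))
         <= k * exp (e * Rabs (r j)) * Rabs (r j) * Rabs (t0 - (t0 - r j))).
      { apply (derivative_bound_lipschitz (fun x => Q x - P t0 * x - y / 2 * (x - t0) ^ 2) (fun x => P x - P t0 - y * (x - t0)) (t0 - r j) t0).
        - intros x _. apply (is_derive_minus (fun x => Q x - P t0 * x) (fun x => y / 2 * (x - t0) ^ 2)).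
          + apply (is_derive_minus Q (fun x => P t0 * x)); [apply HQ|]. auto_derive; [exact I|ring].
          + auto_derive; [exact I|simpl; field].
        - exact HPi. }
      replace (t0 - (t0 - r j)) with (r j) in Hi by ring. pose proof (kernel_nonneg HK j).
      cbv beta in Hi.
      replace (Q t0 - P t0 * t0 - y / 2 * (t0 - t0) ^ 2 - (Q (t0 - r j) - P t0 * (t0 - r j) - y / 2 * (t0 - r j - t0) ^ 2))
        with (Q t0 - Q (t0 - r j) - P t0 * r j + y / 2 * r j ^ 2) in Hi by ring.
      replace (k * (a j * (Rabs (r j) ^ 2 * exp (e * Rabs (r j))))) with (a j * (k * exp (e * Rabs (r j)) * Rabs (r j) * Rabs (r j))) by ring.
      apply Rmult_le_compat_l; assumption.
    - apply (ex_series_scal_l k) in HM. exact HM. }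
  rewrite Series_scal_l in Hs.
  unfold C. nra.
Qed.

(** * Asymptotics of linear advance-delay equations *)

Lemma exp_abs_ge_1 (e x : R) : 0 <= e -> 1 <= exp (e * Rabs x).
Proof.
  intros He. rewrite <- exp_0. apply exp_le. apply Rmult_le_pos; [exact He|apply Rabs_pos].
Qed.

(** Converts a small logarithmic Lipschitz constant [e] into a small multiple of a fixed weight
    [exp (e1 x)], which is the form in which [concentration] accepts errors. *)
Lemma exp_sub1_le (e e1 x : R) : 0 < e -> 2 * e <= e1 -> 0 <= x ->
  exp (e * x) - 1 <= 2 * e / e1 * exp (e1 * x).
Proof.
  intros He He1 Hx.
  assert (H1 : exp (e * x) - 1 <= e * x * exp (e * x)).
  { pose proof (exp_ineq1_le (- (e * x))) as H. rewrite exp_Ropp in H.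
    pose proof (exp_pos (e * x)) as Hp.
    apply (Rmult_le_compat_l (exp (e * x))) in H; [|lra]. rewrite Rinv_r in H by lra. lra. }
  pose proof (abs_le_exp x (e1 / 2) ltac:(lra)) as H2. rewrite Rabs_pos_eq in H2 by exact Hx.
  assert (H3 : exp (e * x) <= exp (e1 / 2 * x)) by (apply exp_le; nra).
  assert (H4 : exp (e1 * x) = exp (e1 / 2 * x) * exp (e1 / 2 * x)) by (rewrite <- exp_plus; f_equal; field).
  pose proof (exp_pos (e * x)). pose proof (exp_pos (e1 / 2 * x)).
  eapply Rle_trans; [exact H1|].
  replace (2 * e / e1 * exp (e1 * x)) with (e * ((/ (e1 / 2) * exp (e1 / 2 * x)) * exp (e1 / 2 * x))).
  - rewrite Rmult_assoc. apply Rmult_le_compat_l; [lra|]. apply Rmult_le_compat; lra.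
  - rewrite H4. field. lra.
Qed.

Lemma exp_ge_eventually (e K : R) : 0 < e -> exists T, 0 <= T /\ forall x, T <= x -> K <= exp (e * x).
Proof.
  intros He. exists (Rmax 0 (K / e)). split; [apply Rmax_l|].
  intros x Hx. assert (K / e <= x) by (eapply Rle_trans; [apply Rmax_r|exact Hx]).
  pose proof (exp_ineq1_le (e * x)). apply (Rmult_le_compat_l e) in H; [|lra].
  replace (e * (K / e)) with K in H by (field; lra). lra.
Qed.

(** The equation after division by [exp (lam t)], in abstract form. The kernel [d] bounds the
    nonlinear remainder. Indices 0 and 1 single out the two neighbours, whose positive weights feed
    the Harnack inequality. [ds_growth] says that [p] grows less than any exponential, as it does
    when the exact rate has been divided out. *)
Record delay_solution (c : R) (a r d : nat -> R) (e0 eps : R) (p dp : R -> R) : Prop := {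
  ds_c : c <> 0;
  ds_a : kernel a r e0;
  ds_d : kernel d r e0;
  ds_eps : 0 < eps;
  ds_r0 : r 0%nat = -1;
  ds_r1 : r 1%nat = 1;
  ds_a0 : 0 < a 0%nat;
  ds_a1 : 0 < a 1%nat;
  ds_nonneg : forall t, 0 <= p t;
  ds_derive : forall t, is_derive p t (dp t);
  ds_eq : forall t, Rabs (c * dp t - Series (fun j => a j * (p (t - r j) - p t)))
            <= exp (eps * t) * Series (fun j => d j * p (t - r j));
  ds_growth : forall eta, 0 < eta -> exists G, forall t, p t <= G * exp (eta * Rabs t);
  ds_bounded : exists G, forall t, 0 <= t -> p t <= G
}.
Arguments ds_c {c a r d e0 eps p dp} _.
Arguments ds_a {c a r d e0 eps p dp} _.
Arguments ds_d {c a r d e0 eps p dp} _.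
Arguments ds_eps {c a r d e0 eps p dp} _.
Arguments ds_r0 {c a r d e0 eps p dp} _.
Arguments ds_r1 {c a r d e0 eps p dp} _.
Arguments ds_a0 {c a r d e0 eps p dp} _.
Arguments ds_a1 {c a r d e0 eps p dp} _.
Arguments ds_nonneg {c a r d e0 eps p dp} _.
Arguments ds_derive {c a r d e0 eps p dp} _.
Arguments ds_eq {c a r d e0 eps p dp} _.
Arguments ds_growth {c a r d e0 eps p dp} _.
Arguments ds_bounded {c a r d e0 eps p dp} _.

(** The function [u s = tau * (p (t0 + s) - x X)] is almost nonnegative and almost 0 at [s = 0],
    that is, [t0] is nearly a minimum ([tau = 1]) or maximum ([tau = -1]). Up to errors proportional
    to [eta] it satisfies the Harnack hypotheses, hence is small on [[-N, N]]; farther out the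
    growth bound is absorbed by the heavier weight. *)
Lemma concentration {c : R} {a r d : nat -> R} {e0 eps : R} {p dp : R -> R} :
  delay_solution c a r d e0 eps p dp ->
  forall C1 k, 0 < C1 -> 0 < k -> exists eta, 0 < eta /\
  forall t0 X x tau, t0 <= - / eta -> 0 < X -> 0 <= x <= C1 -> tau = 1 \/ tau = -1 ->
    (forall s, p (t0 + s) <= C1 * X * exp (e0 / 4 * Rabs s)) ->
    (forall s, - (eta * X * exp (e0 / 4 * Rabs s)) <= tau * (p (t0 + s) - x * X)) ->
    tau * (p t0 - x * X) <= eta * X ->
    forall s, Rabs (p (t0 + s) - x * X) <= k * X * exp (e0 / 2 * Rabs s).
Proof.
  intros [Hc HKa HKd Heps Hr0 Hr1 Ha0 Ha1 Hnn Hdp Heq Hgr Hbd] C1 k HC1 Hk.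
  assert (He0 := kernel_pos HKa).
  set (e1 := e0 / 4).
  assert (HKa1 : kernel a r e1) by (apply (kernel_le a r e0); [unfold e1; lra|exact HKa]).
  assert (HKd1 : kernel d r e1) by (apply (kernel_le d r e0); [unfold e1; lra|exact HKd]).
  assert (Han := kernel_nonneg HKa).
  set (S := Series a). assert (HS : 0 <= S) by (apply Series_nonneg; [exact Han|apply (kernel_ex_series_a a r e0 HKa)]).
  assert (HexSa := kernel_summable HKa1). assert (HexSd := kernel_summable HKd1).
  set (Sa := Series (fun j => a j * exp (e1 * Rabs (r j)))) in *.
  set (Sd := Series (fun j => d j * exp (e1 * Rabs (r j)))) in *.
  assert (HSa : 0 <= Sa).
  { apply Series_nonneg; [|exact HexSa]. intros j. apply Rmult_le_pos; [apply Han|left; apply exp_pos]. }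
  assert (HSd : 0 <= Sd).
  { apply Series_nonneg; [|exact HexSd]. intros j. apply Rmult_le_pos; [apply (kernel_nonneg HKd)|left; apply exp_pos]. }
  (* Beyond [Y] the factor gained by passing from weight [e0 / 4] to [e0 / 2] exceeds [2 C1 / k]. *)
  destruct (exp_ge_eventually e1 (2 * C1 / k)) as [Y [_ HY]]; [unfold e1; lra|].
  assert (HN : exists N, Y <= INR N).
  { destruct (Rle_lt_dec Y 0) as [H|H]; [exists 0%nat; simpl; lra|].
    destruct (archimed_cor1 (/ Y)) as [n [Hn1 Hn2]]; [apply Rinv_0_lt_compat; exact H|].
    exists n. assert (0 < INR n) by (apply lt_0_INR; exact Hn2).
    apply Rlt_le. apply Rinv_lt_cancel; [exact H0|exact Hn1]. }
  destruct HN as [N HN].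
  set (am := Rmin (a 0%nat) (a 1%nat)). assert (Ham : 0 < am) by (apply Rmin_glb_lt; assumption).
  destruct (harnack c am S N Hc Ham HS) as [CH [HCH Hharn]].
  set (E := exp (e1 * (INR N + 4))). pose proof (pos_INR N) as HN0.
  assert (HE : 1 <= E) by (unfold E; rewrite <- exp_0; apply exp_le; unfold e1; nra).
  set (F := exp (eps * (INR N + 4)) * (C1 * E * Sd)).
  assert (HF : 0 <= F).
  { unfold F. apply Rmult_le_pos; [left; apply exp_pos|]. apply Rmult_le_pos; [nra|exact HSd]. }
  set (K := E * Sa + E + F / eps).
  assert (HFe : 0 <= F / eps) by (apply Rdiv_le_0_compat; lra).
  assert (HK : 1 <= K) by (unfold K; nra).
  exists (k / (CH * K + E)).
  assert (HD : 0 < CH * K + E) by nra.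
  (* With this value the Harnack bound [CH X eta K] and the lower defect [E eta X] add up to exactly
     [k X]. *)
  set (eta := k / (CH * K + E)). assert (Heta : 0 < eta) by (apply Rdiv_lt_0_compat; lra).
  assert (Hkey : eta * (CH * K + E) = k) by (unfold eta; field; lra).
  clearbody eta.
  split; [exact Heta|].
  intros t0 X x tau Ht0 HX Hx Htau Hup Hlow Hat s.
  assert (HetaX : 0 < eta * X) by (apply Rmult_lt_0_compat; assumption).
  assert (HC1X : 0 < C1 * X) by (apply Rmult_lt_0_compat; assumption).
  assert (HxX : 0 <= x * X) by (apply Rmult_le_pos; lra).
  assert (HxX1 : x * X <= C1 * X) by (apply Rmult_le_compat_r; lra).
  set (u := fun s => tau * (p (t0 + s) - x * X)).
  assert (Htauabs : forall z, Rabs (tau * z) = Rabs z).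
  { intros z. rewrite Rabs_mult. destruct Htau; subst tau; [rewrite Rabs_R1|rewrite Rabs_left by lra]; ring. }
  assert (Habs : Rabs (p (t0 + s) - x * X) = Rabs (u s)) by (unfold u; rewrite Htauabs; reflexivity).
  (* The condition [t0 <= - 1 / eta] makes the remainder proportional to [eta] as well:
     [exp (- eps / eta) <= eta / eps]. *)
  assert (Het : exp (eps * t0) <= eta / eps).
  { apply Rle_trans with (exp (- (eps / eta))).
    - apply exp_le. apply (Rmult_le_compat_l eps) in Ht0; [|lra]. unfold Rdiv. lra.
    - rewrite exp_Ropp. pose proof (exp_ineq1_le (eps / eta)).
      assert (0 < eps / eta) by (apply Rdiv_lt_0_compat; lra).
      replace (eta / eps) with (/ (eps / eta)) by (field; lra).
      apply Rinv_le_contravar; lra. }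
  assert (Hdu : forall s, is_derive u s (tau * dp (t0 + s))).
  { intros z. unfold u. auto_derive; [exists (dp (t0 + z)); apply Hdp|].
    replace (Derive (fun x => p x) (t0 + z)) with (dp (t0 + z)) by (symmetry; apply is_derive_unique; apply Hdp). ring. }
  assert (Hexp : forall z j, exp (e1 * Rabs (z - r j)) <= exp (e1 * Rabs z) * exp (e1 * Rabs (r j))).
  { intros z j. unfold Rminus. rewrite <- (Rabs_Ropp (r j)). apply exp_abs_plus. unfold e1; lra. }
  assert (HEz : forall z, Rabs z <= INR N + 3 -> exp (e1 * Rabs z) <= E).
  { intros z Hz. unfold E. apply exp_le. apply Rmult_le_compat_l; [unfold e1; lra|lra]. }
  assert (Hub : forall z j, Rabs (u (z - r j)) <= (C1 * X + x * X + x * X) * exp (e1 * Rabs z) * exp (e1 * Rabs (r j))).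
  { intros z j. unfold u. rewrite Htauabs.
    specialize (Hup (z - r j)). fold e1 in Hup. specialize (Hexp z j). specialize (Hnn (t0 + (z - r j))).
    assert (1 <= exp (e1 * Rabs (z - r j))) by (apply exp_abs_ge_1; unfold e1; lra).
    rewrite Rmult_assoc. apply Rle_trans with ((C1 * X + x * X + x * X) * exp (e1 * Rabs (z - r j))).
    - assert (C1 * X <= C1 * X * exp (e1 * Rabs (z - r j))) by (rewrite <- (Rmult_1_r (C1 * X)) at 1; apply Rmult_le_compat_l; lra).
      assert (x * X <= x * X * exp (e1 * Rabs (z - r j))) by (rewrite <- (Rmult_1_r (x * X)) at 1; apply Rmult_le_compat_l; lra).
      apply Rabs_le. split; lra.
    - apply Rmult_le_compat_l; lra. }
  assert (Hineq : forall i z, Rabs z <= INR N + 2 ->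
     am <= a i -> am * u (z - r i) - S * u z - X * eta * K <= c * (tau * dp (t0 + z))).
  { intros i z Hz Hi.
    assert (Hex1 : ex_series (fun j => a j * u (z - r j))).
    { apply (kernel_ex_series a r _ e1 ((C1 * X + x * X + x * X) * exp (e1 * Rabs z)) HKa1). intros j. apply Hub. }
    assert (Hexa : ex_series a) by (apply (kernel_ex_series_a a r e0 HKa)).
    assert (Hser : tau * Series (fun j => a j * (p (t0 + z - r j) - p (t0 + z))) = Series (fun j => a j * u (z - r j)) - S * u z).
    { rewrite <- Series_scal_l. unfold S. rewrite <- Series_scal_r.
      rewrite <- Series_minus.
      - apply Series_ext. intros j. unfold u. replace (t0 + (z - r j)) with (t0 + z - r j) by ring. ring.
      - exact Hex1.
      - apply (ex_series_scal_r (u z)) in Hexa. exact Hexa. }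
    assert (Hw : ex_series (fun j => a j * (eta * X * exp (e1 * Rabs (z - r j))))).
    { apply (kernel_ex_series a r _ e1 (eta * X * exp (e1 * Rabs z)) HKa1). intros j.
      pose proof (exp_pos (e1 * Rabs (z - r j))).
      rewrite Rabs_pos_eq by (apply Rmult_le_pos; lra).
      specialize (Hexp z j). rewrite (Rmult_assoc (eta * X)). apply Rmult_le_compat_l; [lra|exact Hexp]. }
    assert (Hwle : Series (fun j => a j * (eta * X * exp (e1 * Rabs (z - r j)))) <= eta * X * E * Sa).
    { unfold Sa. rewrite <- Series_scal_l. apply Series_le.
      - intros j. pose proof (exp_pos (e1 * Rabs (z - r j))). specialize (Han j). split.
        + apply Rmult_le_pos; [exact Han|]. apply Rmult_le_pos; lra.
        + specialize (Hexp z j). specialize (HEz z ltac:(lra)). pose proof (exp_pos (e1 * Rabs (r j))).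
          assert (exp (e1 * Rabs (z - r j)) <= E * exp (e1 * Rabs (r j))) by (eapply Rle_trans; [exact Hexp|]; apply Rmult_le_compat_r; lra).
          replace (eta * X * E * (a j * exp (e1 * Rabs (r j)))) with (a j * (eta * X * (E * exp (e1 * Rabs (r j))))) by ring.
          apply Rmult_le_compat_l; [exact Han|]. apply Rmult_le_compat_l; lra.
      - apply (ex_series_scal_l (eta * X * E)) in HexSa. exact HexSa. }
    (* Adding the lower defect makes every term of the series nonnegative; only then does the single
       neighbour term lie below the sum. *)
    assert (Hge : am * u (z - r i) <= Series (fun j => a j * u (z - r j)) + Series (fun j => a j * (eta * X * exp (e1 * Rabs (z - r j))))).
    { rewrite <- Series_plus by assumption.
      assert (Hpos : forall j, 0 <= u (z - r j) + eta * X * exp (e1 * Rabs (z - r j))).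
      { intros j. specialize (Hlow (z - r j)). fold e1 in Hlow. unfold u. lra. }
      apply Rle_trans with (a i * u (z - r i) + a i * (eta * X * exp (e1 * Rabs (z - r i)))).
      - specialize (Hpos i). pose proof (exp_pos (e1 * Rabs (z - r i))). assert (0 <= eta * X * exp (e1 * Rabs (z - r i))) by (apply Rmult_le_pos; lra).
        rewrite <- Rmult_plus_distr_l.
        apply Rle_trans with (am * (u (z - r i) + eta * X * exp (e1 * Rabs (z - r i)))); [apply Rmult_le_compat_l; lra|].
        apply Rmult_le_compat_r; assumption.
      - apply (Series_ge_term (fun j => a j * u (z - r j) + a j * (eta * X * exp (e1 * Rabs (z - r j)))) i).
        + intros j. specialize (Hpos j). specialize (Han j). rewrite <- Rmult_plus_distr_l. apply Rmult_le_pos; assumption.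
        + apply (ex_series_plus _ _ Hex1 Hw). }
    specialize (Heq (t0 + z)).
    assert (HSdp : Series (fun j => d j * p (t0 + z - r j)) <= C1 * X * E * Sd).
    { unfold Sd. rewrite <- Series_scal_l. apply Series_le.
      - intros j. pose proof (kernel_nonneg HKd j) as Hdj. split; [apply Rmult_le_pos; [exact Hdj|apply Hnn]|].
        specialize (Hup (z - r j)). fold e1 in Hup. replace (t0 + z - r j) with (t0 + (z - r j)) by ring.
        specialize (Hexp z j). specialize (HEz z ltac:(lra)). pose proof (exp_pos (e1 * Rabs (r j))).
        assert (exp (e1 * Rabs (z - r j)) <= E * exp (e1 * Rabs (r j))) by (eapply Rle_trans; [exact Hexp|]; apply Rmult_le_compat_r; lra).
        replace (C1 * X * E * (d j * exp (e1 * Rabs (r j)))) with (d j * (C1 * X * (E * exp (e1 * Rabs (r j))))) by ring.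
        apply Rmult_le_compat_l; [exact Hdj|]. eapply Rle_trans; [exact Hup|]. apply Rmult_le_compat_l; lra.
      - apply (ex_series_scal_l (C1 * X * E)) in HexSd. exact HexSd. }
    assert (Hf : Rabs (c * dp (t0 + z) - Series (fun j => a j * (p (t0 + z - r j) - p (t0 + z)))) <= X * eta * (F / eps)).
    { eapply Rle_trans; [exact Heq|].
      replace (eps * (t0 + z)) with (eps * t0 + eps * z) by ring. rewrite exp_plus.
      assert (H1 : exp (eps * z) <= exp (eps * (INR N + 4))).
      { apply exp_le. apply Rmult_le_compat_l; [lra|]. apply Rabs_le_between in Hz. lra. }
      pose proof (exp_pos (eps * t0)). pose proof (exp_pos (eps * z)).
      assert (0 <= C1 * X * E * Sd) by (repeat apply Rmult_le_pos; lra).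
      apply Rle_trans with (eta / eps * exp (eps * (INR N + 4)) * (C1 * X * E * Sd)).
      - apply Rle_trans with (exp (eps * t0) * exp (eps * z) * (C1 * X * E * Sd)).
        + apply Rmult_le_compat_l; [apply Rmult_le_pos; lra|exact HSdp].
        + apply Rmult_le_compat_r; [assumption|]. apply Rmult_le_compat; lra.
      - right. unfold F. field. lra. }
    rewrite <- Htauabs in Hf. apply Rabs_le_between in Hf.
    rewrite Rmult_minus_distr_l, Hser in Hf.
    replace (X * eta * K) with (eta * X * E * Sa + eta * X * E + X * eta * (F / eps)) by (unfold K; ring).
    assert (0 <= eta * X * E) by (apply Rmult_le_pos; lra). lra. }
  assert (Hu : forall z, Rabs z <= INR N -> u z <= CH * (X * eta * K)).
  { apply (Hharn u (fun z => tau * dp (t0 + z))).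
    - repeat apply Rmult_le_pos; lra.
    - exact Hdu.
    - intros z Hz. replace (z + 1) with (z - r 0%nat) by (rewrite Hr0; ring). apply Hineq; [exact Hz|apply Rmin_l].
    - intros z Hz. replace (z - 1) with (z - r 1%nat) by (rewrite Hr1; ring). apply Hineq; [exact Hz|apply Rmin_r].
    - intros z Hz. specialize (Hlow z). fold e1 in Hlow. unfold u. specialize (HEz z Hz).
      assert (eta * X * exp (e1 * Rabs z) <= eta * X * E) by (apply Rmult_le_compat_l; lra).
      assert (eta * X * E <= X * eta * K).
      { replace (eta * X * E) with (X * eta * E) by ring. apply Rmult_le_compat_l; [lra|]. assert (0 <= E * Sa) by (apply Rmult_le_pos; lra). unfold K; lra. }
      lra.
    - unfold u. rewrite Rplus_0_r. eapply Rle_trans; [exact Hat|].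
      replace (X * eta * K) with (eta * X * K) by ring. rewrite <- (Rmult_1_r (eta * X)) at 1. apply Rmult_le_compat_l; lra. }
  rewrite Habs.
  destruct (Rle_lt_dec (Rabs s) (INR N)) as [Hs|Hs].
  - assert (1 <= exp (e0 / 2 * Rabs s)) by (apply exp_abs_ge_1; lra).
    apply Rle_trans with (k * X).
    + specialize (Hu s Hs). specialize (Hlow s). fold e1 in Hlow. specialize (HEz s ltac:(lra)).
      assert (eta * X * exp (e1 * Rabs s) <= eta * X * E) by (apply Rmult_le_compat_l; lra).
      assert (0 <= CH * (X * eta * K)) by (repeat apply Rmult_le_pos; lra).
      assert (0 <= eta * X * E) by (repeat apply Rmult_le_pos; lra).
      assert (k * X = CH * (X * eta * K) + eta * X * E) by (rewrite <- Hkey; ring).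
      apply Rabs_le. unfold u in *. split; lra.
    + rewrite <- (Rmult_1_r (k * X)) at 1. apply Rmult_le_compat_l; [apply Rmult_le_pos; lra|lra].
  - specialize (HY (Rabs s) ltac:(lra)).
    specialize (Hup s). fold e1 in Hup.
    assert (H1 : 1 <= exp (e1 * Rabs s)) by (apply exp_abs_ge_1; unfold e1; lra).
    unfold u. rewrite Htauabs.
    replace (e0 / 2 * Rabs s) with (e1 * Rabs s + e1 * Rabs s) by (unfold e1; field). rewrite exp_plus.
    assert (H2 : 2 * C1 <= k * exp (e1 * Rabs s)).
    { apply (Rmult_le_compat_l k) in HY; [|lra]. replace (k * (2 * C1 / k)) with (2 * C1) in HY by (field; lra). exact HY. }
    specialize (Hnn (t0 + s)).
    apply Rle_trans with (2 * C1 * X * exp (e1 * Rabs s)).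
    + assert (C1 * X <= C1 * X * exp (e1 * Rabs s)) by (rewrite <- (Rmult_1_r (C1 * X)) at 1; apply Rmult_le_compat_l; lra).
      apply Rabs_le. split; lra.
    + replace (k * X * (exp (e1 * Rabs s) * exp (e1 * Rabs s))) with (k * exp (e1 * Rabs s) * X * exp (e1 * Rabs s)) by ring.
      apply Rmult_le_compat_r; [lra|]. apply Rmult_le_compat_r; lra.
Qed.

(** For positive [w] this says that [ln w] is [e]-Lipschitz, in a form needing no logarithm. *)
Definition log_lipschitz (e : R) (w : R -> R) : Prop :=
  forall t s, w (t + s) <= w t * exp (e * Rabs s).

(* At a maximum point of [p / (w1 + nu w2)] the profile [p] is nearly constant,
   so that [At] is there comparable with [p]; then let [nu] tend to 0. *)
Lemma bound_from_functional {c : R} {a r d : nat -> R} {e0 eps : R} {p dp At : R -> R} {m : R} :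
  delay_solution c a r d e0 eps p dp -> m <> 0 -> mass_functional p At m (e0 / 2) ->
  exists e T0 K, 0 < e /\ 0 <= T0 /\ 0 < K /\
  forall C0 (w1 w2 : R -> R), 0 < C0 ->
    (forall t, 0 < w1 t) -> (forall t, 0 < w2 t) ->
    (forall t, continuous w1 t) -> (forall t, continuous w2 t) ->
    log_lipschitz e w1 -> log_lipschitz e w2 ->
    (forall q, 0 < q -> exists T, forall t, t < T -> p t <= q * w2 t) ->
    (forall t, t <= - T0 -> Rabs (At t) <= C0 * w1 t) ->
    (forall t, - T0 <= t -> p t <= C0 * w1 t) ->
    forall t, p t <= K * C0 * w1 t.
Proof.
  intros Hds Hm [C [HC HA]].
  assert (He0 := kernel_pos (ds_a Hds)).
  assert (Hmp : 0 < Rabs m) by (apply Rabs_pos_lt; exact Hm).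
  (* The concentration error [C k p(t0)] is then half of [|m| p(t0)], so the functional keeps at
     least the other half. *)
  set (k := Rabs m / (2 * C)). assert (Hk : 0 < k) by (apply Rdiv_lt_0_compat; lra).
  destruct (concentration Hds 2 k ltac:(lra) Hk) as [eta [Heta Hconc]].
  set (e1 := e0 / 4). assert (He1 : 0 < e1) by (unfold e1; lra).
  (* Small enough that a maximum of [p] over an [e]-log-Lipschitz weight is an [eta]-almost maximum
     in the sense of [concentration]. *)
  set (e := Rmin (e1 / 2) (eta * e1 / 2)).
  assert (He : 0 < e) by (apply Rmin_glb_lt; nra).
  assert (Hee1 : 2 * e <= e1) by (assert (e <= e1 / 2) by apply Rmin_l; lra).
  assert (Hee : 2 * e / e1 <= eta).
  { assert (H : e <= eta * e1 / 2) by apply Rmin_r.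
    apply (Rmult_le_reg_r e1); [exact He1|]. unfold Rdiv. rewrite Rmult_assoc, Rinv_l by lra. lra. }
  assert (H2m : 0 < 2 / Rabs m) by (apply Rdiv_lt_0_compat; lra).
  exists e, (/ eta), (1 + 2 / Rabs m). split; [exact He|]. split; [left; apply Rinv_0_lt_compat; exact Heta|]. split; [lra|].
  intros C0 w1 w2 HC0 Hw1 Hw2 Hcw1 Hcw2 Hl1 Hl2 Hsmall HAt Hright t.
  set (K := 1 + 2 / Rabs m).
  assert (Hnu : forall nu, 0 < nu -> p t <= K * C0 * (w1 t + nu * w2 t)).
  { intros nu Hnu.
    assert (HW : forall x, 0 < w1 x + nu * w2 x).
    { intros x. specialize (Hw1 x). specialize (Hw2 x). assert (0 < nu * w2 x) by (apply Rmult_lt_0_compat; lra). lra. }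
    set (W := fun x => w1 x + nu * w2 x) in *. change (forall x, 0 < W x) in HW. change (p t <= K * C0 * W t).
    apply Rnot_lt_le. intros Hlt.
    (* The term [nu * w2] exists to make [p / W] small at [-oo], so that its supremum is
       attained. *)
    destruct (Hsmall (C0 * nu)) as [T HT]; [apply Rmult_lt_0_compat; lra|].
    destruct (continuous_max_attained (fun x => p x / W x) C0 (Rmax (/ eta) (Rabs T)) t) as [t0 [Ht0 Hmax]].
    - intros x. apply (continuous_mult p (fun x => / W x)).
      + apply (ex_derive_continuous p x). exists (dp x). apply (ds_derive Hds).
      + apply (continuous_comp W Rinv).
        * apply (continuous_plus w1 (fun x => nu * w2 x)); [apply Hcw1|].
          apply (continuous_mult (fun _ => nu) w2); [apply continuous_const|apply Hcw2].
        * apply continuous_Rinv. specialize (HW x). lra.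
    - intros x Hx. specialize (HW x). apply (Rmult_le_reg_r (W x)); [exact HW|].
      replace (p x / W x * W x) with (p x) by (field; lra).
      assert (Hw1x := Hw1 x). assert (Hw2x := Hw2 x). 
      assert (0 < nu * w2 x) by (apply Rmult_lt_0_compat; lra).
      destruct (Rle_lt_dec (- / eta) x) as [H1|H1].
      + specialize (Hright x H1). unfold W. rewrite Rmult_plus_distr_l.
        assert (0 < C0 * (nu * w2 x)) by (apply Rmult_lt_0_compat; lra). lra.
      + assert (HxT : x < T).
        { assert (HTx : Rabs T < Rabs x) by (eapply Rle_lt_trans; [apply Rmax_r|exact Hx]).
          assert (0 < / eta) by (apply Rinv_0_lt_compat; exact Heta).
          rewrite (Rabs_left x) in HTx by lra. apply Rabs_def2 in HTx. lra. }
        specialize (HT x HxT). unfold W. rewrite Rmult_plus_distr_l.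
        assert (0 < C0 * w1 x) by (apply Rmult_lt_0_compat; lra). lra.
    - specialize (HW t). apply (Rmult_lt_reg_r (W t)); [exact HW|].
      replace (p t / W t * W t) with (p t) by (field; lra).
      apply Rle_lt_trans with (K * C0 * W t); [|exact Hlt]. apply Rmult_le_compat_r; [lra|].
      unfold K. assert (0 < 2 / Rabs m * C0) by (apply Rmult_lt_0_compat; lra). lra.
    - assert (Hbig : K * C0 < p t0 / W t0).
      { specialize (Hmax t). cbv beta in Hmax. assert (K * C0 < p t / W t).
        { apply (Rmult_lt_reg_r (W t)); [apply HW|]. replace (p t / W t * W t) with (p t) by (field; specialize (HW t); lra). exact Hlt. }
        lra. }
      assert (HW0 := HW t0).
      assert (Hpt0 : K * C0 * W t0 < p t0).
      { apply (Rmult_lt_compat_r (W t0)) in Hbig; [|exact HW0]. replace (p t0 / W t0 * W t0) with (p t0) in Hbig by (field; lra). exact Hbig. }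
      assert (Hp0 : 0 < p t0).
      { assert (0 < K * C0 * W t0); [|lra]. unfold K. repeat apply Rmult_lt_0_compat; lra. }
      assert (Ht0l : t0 < - / eta).
      { apply Rnot_le_lt. intros H. specialize (Hright t0 H).
        assert (p t0 <= C0 * W t0).
        { unfold W. rewrite Rmult_plus_distr_l. assert (0 < C0 * (nu * w2 t0)) by (repeat apply Rmult_lt_0_compat; try lra; apply Hw2). lra. }
        assert (C0 * W t0 < p t0); [|lra].
        apply (Rmult_lt_compat_r (W t0)) in Ht0; [|exact HW0]. replace (p t0 / W t0 * W t0) with (p t0) in Ht0 by (field; lra). exact Ht0. }
      assert (HLip : forall s, p (t0 + s) <= p t0 * exp (e * Rabs s)).
      { intros s. specialize (Hmax (t0 + s)). cbv beta in Hmax. assert (HWs := HW (t0 + s)).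
        assert (p (t0 + s) <= p t0 / W t0 * W (t0 + s)).
        { apply (Rmult_le_compat_r (W (t0 + s))) in Hmax; [|lra].
          replace (p (t0 + s) / W (t0 + s) * W (t0 + s)) with (p (t0 + s)) in Hmax by (field; lra). exact Hmax. }
        assert (HWl : W (t0 + s) <= W t0 * exp (e * Rabs s)).
        { unfold W. specialize (Hl1 t0 s). specialize (Hl2 t0 s).
          apply (Rmult_le_compat_l nu) in Hl2; [|lra]. lra. }
        assert (0 < p t0 / W t0) by (apply Rdiv_lt_0_compat; lra).
        apply (Rmult_le_compat_l (p t0 / W t0)) in HWl; [|lra].
        replace (p t0 / W t0 * (W t0 * exp (e * Rabs s))) with (p t0 * exp (e * Rabs s)) in HWl by (field; lra). lra. }
      (* The scale is [X = p t0] itself, with [x = 1] and [tau = -1]: the point [t0] is a maximum up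
         to the variation of the weight. *)
      assert (Hclose := Hconc t0 (p t0) 1 (-1) ltac:(lra) Hp0 ltac:(lra) ltac:(right; reflexivity)).
      assert (HAclose : Rabs (At t0 - m * (1 * p t0)) <= C * (k * p t0)).
      { apply HA. apply Hclose.
        - intros s. eapply Rle_trans; [apply HLip|].
          assert (exp (e * Rabs s) <= exp (e0 / 4 * Rabs s)).
          { apply exp_le. apply Rmult_le_compat_r; [apply Rabs_pos|]. unfold e1 in *; lra. }
          assert (0 < exp (e0 / 4 * Rabs s)) by apply exp_pos.
          apply Rle_trans with (p t0 * exp (e0 / 4 * Rabs s)); [apply Rmult_le_compat_l; lra|].
          apply Rmult_le_compat_r; lra.
        - intros s. specialize (HLip s).
          assert (Hs := exp_sub1_le e e1 (Rabs s) He Hee1 (Rabs_pos s)).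
          assert (0 < exp (e1 * Rabs s)) by apply exp_pos.
          assert (2 * e / e1 * exp (e1 * Rabs s) <= eta * exp (e1 * Rabs s)) by (apply Rmult_le_compat_r; lra).
          assert (p t0 * (exp (e * Rabs s) - 1) <= p t0 * (eta * exp (e1 * Rabs s))) by (apply Rmult_le_compat_l; lra).
          fold e1. lra.
        - assert (0 < eta * p t0) by (apply Rmult_lt_0_compat; lra). lra. }
      assert (HAb : Rabs (At t0) <= C0 * W t0).
      { eapply Rle_trans; [apply HAt; lra|]. apply Rmult_le_compat_l; [lra|]. unfold W.
        assert (0 < nu * w2 t0) by (apply Rmult_lt_0_compat; [lra|apply Hw2]). lra. }
      assert (Hck : C * (k * p t0) = Rabs m / 2 * p t0) by (unfold k; field; lra).
      rewrite Hck, Rmult_1_l in HAclose.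
      assert (Hmp0 : Rabs (m * p t0) = Rabs m * p t0) by (rewrite Rabs_mult, (Rabs_pos_eq (p t0)) by lra; reflexivity).
      assert (Rabs m * p t0 <= Rabs (At t0) + Rabs m / 2 * p t0).
      { rewrite <- Hmp0 at 1. replace (m * p t0) with (At t0 + - (At t0 - m * p t0)) by ring.
        eapply Rle_trans; [apply Rabs_triang|]. rewrite Rabs_Ropp. lra. }
      assert (Hfin : Rabs m / 2 * p t0 <= C0 * W t0) by lra.
      apply (Rmult_le_compat_l (2 / Rabs m)) in Hfin; [|lra].
      replace (2 / Rabs m * (Rabs m / 2 * p t0)) with (p t0) in Hfin by (field; lra).
      assert (0 < C0 * W t0) by (apply Rmult_lt_0_compat; lra).
      unfold K in Hpt0. lra. }
  apply Rle_plus_epsilon. intros q Hq.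
  assert (HK : 0 < K * C0) by (apply Rmult_lt_0_compat; unfold K; lra).
  assert (Hw2t := Hw2 t).
  (* At the fixed point [t], this [nu] makes the auxiliary term contribute exactly [q]. *)
  specialize (Hnu (q / (K * C0 * w2 t))).
  assert (0 < K * C0 * w2 t) by (apply Rmult_lt_0_compat; lra).
  specialize (Hnu ltac:(apply Rdiv_lt_0_compat; lra)).
  replace (K * C0 * (w1 t + q / (K * C0 * w2 t) * w2 t)) with (K * C0 * w1 t + q) in Hnu.
  - exact Hnu.
  - field. unfold K in *. repeat split; lra.
Qed.

(** The logarithmic Lipschitz constant tends to 0 at [-oo]. The second inequality is not the first
    one with [t] and [t + s] exchanged, since [t + s] may lie to the right of [- T]. *)
Definition slowly_varying (w : R -> R) : Prop :=
  forall eta, 0 < eta -> exists T, forall t, t <= - T -> forall s,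
    w (t + s) <= w t * exp (eta * Rabs s) /\ w t <= w (t + s) * exp (eta * Rabs s).

(* [y] is a limit inferior ([tau = 1]) or a limit superior ([tau = -1]) of [p / w] at [-oo]. *)
Lemma extremal_limit_value {c : R} {a r d : nat -> R} {e0 eps : R} (p dp At w : R -> R) (m K l tau y : R) :
  delay_solution c a r d e0 eps p dp -> mass_functional p At m (e0 / 2) ->
  (forall t, 0 < w t) -> slowly_varying w -> 0 < K -> (forall t, p t <= K * w t) ->
  (forall q, 0 < q -> exists T, forall t, t <= - T -> Rabs (At t - l * w t) <= q * w t) ->
  tau = 1 \/ tau = -1 -> 0 <= y <= K ->
  (forall q, 0 < q -> exists T, forall t, t <= - T -> - (q * w t) <= tau * (p t - y * w t)) ->
  (forall q T, 0 < q -> exists t, t <= - T /\ tau * (p t - y * w t) <= q * w t) ->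
  m * y = l.
Proof.
  intros Hds [C [HC HA]] Hw Hslow HK Hpw HAl Htau Hy Hlow Hat.
  assert (He0 := kernel_pos (ds_a Hds)).
  assert (Htauabs : forall z, Rabs (tau * z) = Rabs z).
  { intros z. rewrite Rabs_mult. destruct Htau; subst tau; [rewrite Rabs_R1|rewrite Rabs_left by lra]; ring. }
  assert (Hkey : forall k, 0 < k -> Rabs (m * y - l) <= (C + 1) * k).
  { intros k Hk.
    destruct (concentration Hds K k HK Hk) as [eta [Heta Hconc]].
    set (e1 := e0 / 4) in *. assert (He1 : 0 < e1) by (unfold e1; lra).
    (* Half of [eta] pays for the variation of [y w] around [t0], the other half for the defect in
       the one-sided bound. *)
    set (e2 := Rmin (e1 / 2) (eta * e1 / (4 * K))).
    assert (He2 : 0 < e2) by (apply Rmin_glb_lt; [lra|]; apply Rdiv_lt_0_compat; nra).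
    assert (He21 : 2 * e2 <= e1) by (assert (e2 <= e1 / 2) by apply Rmin_l; lra).
    assert (He2K : K * (2 * e2 / e1) <= eta / 2).
    { assert (H : e2 <= eta * e1 / (4 * K)) by apply Rmin_r.
      apply (Rmult_le_compat_l (2 * K / e1)) in H; [|left; apply Rdiv_lt_0_compat; lra].
      replace (2 * K / e1 * (eta * e1 / (4 * K))) with (eta / 2) in H by (field; lra).
      replace (K * (2 * e2 / e1)) with (2 * K / e1 * e2) by (field; lra). exact H. }
    destruct (Hlow (eta / 2) ltac:(lra)) as [T1 HT1].
    destruct (Hslow e2 He2) as [T2 HT2].
    destruct (exp_ge_eventually (e1 / 2) (2 * K / eta)) as [T3 [HT30 HT3]]; [lra|].
    destruct (HAl k Hk) as [T4 HT4].
    (* As [t0 <= - (T1 + T3)], every [s] with [t0 + s] beyond [- T1] satisfies [|s| >= T3]. The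
       one-sided bound serves for the other [s], while here the crude bound [2 K X exp (e2 |s|)] is
       already below the permitted error. *)
    destruct (Hat eta (Rmax (T1 + T3) (Rmax T2 (Rmax T4 (/ eta)))) Heta) as [t0 [Ht0 Hat0]].
    assert (Hb1 := Rmax_l (T1 + T3) (Rmax T2 (Rmax T4 (/ eta)))).
    assert (Hb2 := Rmax_r (T1 + T3) (Rmax T2 (Rmax T4 (/ eta)))).
    assert (Hb3 := Rmax_l T2 (Rmax T4 (/ eta))).
    assert (Hb4 := Rmax_r T2 (Rmax T4 (/ eta))).
    assert (Hb5 := Rmax_l T4 (/ eta)). assert (Hb6 := Rmax_r T4 (/ eta)).
    specialize (HT2 t0 ltac:(lra)). specialize (HT4 t0 ltac:(lra)).
    set (X := w t0) in *. assert (HX : 0 < X) by apply Hw.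
    assert (HKX : 0 < K * X) by (apply Rmult_lt_0_compat; lra).
    assert (HyX : 0 <= y * X) by (apply Rmult_le_pos; lra).
    assert (HyKX : y * X <= K * X) by (apply Rmult_le_compat_r; lra).
    assert (He21e : forall s, exp (e2 * Rabs s) <= exp (e1 * Rabs s)).
    { intros s. apply exp_le. apply Rmult_le_compat_r; [apply Rabs_pos|lra]. }
    assert (Hup : forall s, p (t0 + s) <= K * X * exp (e2 * Rabs s)).
    { intros s. eapply Rle_trans; [apply Hpw|]. rewrite Rmult_assoc. apply Rmult_le_compat_l; [lra|]. apply HT2. }
    assert (Hclose : forall s, Rabs (p (t0 + s) - y * X) <= k * X * exp (e0 / 2 * Rabs s)).
    { apply (Hconc t0 X y tau); try assumption; try lra.
      - intros s. eapply Rle_trans; [apply Hup|]. apply Rmult_le_compat_l; [lra|]. apply He21e.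
      - intros s. pose proof (exp_pos (e1 * Rabs s)) as Hep.
        destruct (Rle_lt_dec (t0 + s) (- T1)) as [Hs|Hs].
        + specialize (HT1 _ Hs).
          assert (Hwd : Rabs (w (t0 + s) - X) <= X * (2 * e2 / e1 * exp (e1 * Rabs s))).
          { apply Rle_trans with (X * (exp (e2 * Rabs s) - 1)).
            - destruct (HT2 s) as [G1 G2]. assert (1 <= exp (e2 * Rabs s)) by (apply exp_abs_ge_1; lra).
              assert (Hws := Hw (t0 + s)). apply Rabs_le. split; [|lra].
              destruct (Rle_lt_dec X (w (t0 + s))) as [G|G].
              + assert (0 <= X * (exp (e2 * Rabs s) - 1)) by (apply Rmult_le_pos; lra). lra.
              + assert (w (t0 + s) * (exp (e2 * Rabs s) - 1) <= X * (exp (e2 * Rabs s) - 1)) by (apply Rmult_le_compat_r; lra). lra.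
            - apply Rmult_le_compat_l; [lra|]. apply exp_sub1_le; [lra|lra|apply Rabs_pos]. }
          assert (H1 : tau * (p (t0 + s) - y * X) = tau * (p (t0 + s) - y * w (t0 + s)) + tau * (y * (w (t0 + s) - X))) by ring.
          rewrite H1.
          assert (H2 : Rabs (tau * (y * (w (t0 + s) - X))) <= K * (X * (2 * e2 / e1 * exp (e1 * Rabs s)))).
          { rewrite Htauabs, Rabs_mult, (Rabs_pos_eq y) by lra. apply Rmult_le_compat; [lra|apply Rabs_pos|lra|exact Hwd]. }
          assert (H3 : K * (X * (2 * e2 / e1 * exp (e1 * Rabs s))) <= eta / 2 * (X * exp (e1 * Rabs s))).
          { replace (K * (X * (2 * e2 / e1 * exp (e1 * Rabs s)))) with (K * (2 * e2 / e1) * (X * exp (e1 * Rabs s))) by ring.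
            apply Rmult_le_compat_r; [left; apply Rmult_lt_0_compat; lra|exact He2K]. }
          assert (H4 : eta / 2 * w (t0 + s) <= eta / 2 * (X * exp (e1 * Rabs s))).
          { apply Rmult_le_compat_l; [lra|]. eapply Rle_trans; [apply HT2|]. apply Rmult_le_compat_l; [lra|apply He21e]. }
          apply Rabs_le_between in H2. lra.
        + assert (Hs3 : T3 <= Rabs s) by (eapply Rle_trans; [|apply RRle_abs]; lra).
          specialize (HT3 _ Hs3).
          assert (H5 : exp (e1 * Rabs s) = exp (e1 / 2 * Rabs s) * exp (e1 / 2 * Rabs s)) by (rewrite <- exp_plus; f_equal; field).
          assert (H6 : exp (e2 * Rabs s) <= exp (e1 / 2 * Rabs s)) by (apply exp_le; apply Rmult_le_compat_r; [apply Rabs_pos|lra]).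
          assert (H7 : 2 * K <= eta * exp (e1 / 2 * Rabs s)).
          { apply (Rmult_le_compat_l eta) in HT3; [|lra]. replace (eta * (2 * K / eta)) with (2 * K) in HT3 by (field; lra). exact HT3. }
          assert (H8 : 1 <= exp (e2 * Rabs s)) by (apply exp_abs_ge_1; lra).
          assert (H9 : Rabs (p (t0 + s) - y * X) <= 2 * K * X * exp (e2 * Rabs s)).
          { specialize (Hup s). assert (Hn := ds_nonneg Hds (t0 + s)).
            assert (K * X <= K * X * exp (e2 * Rabs s)) by (rewrite <- (Rmult_1_r (K * X)) at 1; apply Rmult_le_compat_l; lra).
            apply Rabs_le; split; lra. }
          assert (H10 : 2 * K * X * exp (e2 * Rabs s) <= eta * X * exp (e1 * Rabs s)).
          { rewrite H5. replace (eta * X * (exp (e1 / 2 * Rabs s) * exp (e1 / 2 * Rabs s))) with (eta * exp (e1 / 2 * Rabs s) * X * exp (e1 / 2 * Rabs s)) by ring.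
            apply Rmult_le_compat; [repeat apply Rmult_le_pos; lra|left; apply exp_pos| |exact H6]. apply Rmult_le_compat_r; lra. }
          rewrite <- Htauabs in H9. apply Rabs_le_between in H9. lra. }
    assert (HAc := HA t0 (y * X) (k * X) Hclose).
    assert (Hfin : Rabs ((m * y - l) * X) <= (C + 1) * k * X).
    { replace ((m * y - l) * X) with ((At t0 - l * X) + - (At t0 - m * (y * X))) by ring.
      eapply Rle_trans; [apply Rabs_triang|]. rewrite Rabs_Ropp. lra. }
    rewrite Rabs_mult, (Rabs_pos_eq X) in Hfin by lra.
    apply (Rmult_le_reg_r X); assumption. }
  assert (Rabs (m * y - l) <= 0).
  { apply Rle_plus_epsilon. intros q Hq. rewrite Rplus_0_l.
    replace q with ((C + 1) * (q / (C + 1))) by (field; lra). apply Hkey. apply Rdiv_lt_0_compat; lra. }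
  pose proof (Rabs_pos (m * y - l)). assert (Hz : Rabs (m * y - l) = 0) by lra.
  apply Rabs_eq_0 in Hz. lra.
Qed.

(** The limits inferior and superior of [p / w] both solve [m * y = l], hence agree. The limit
    inferior is built as the supremum of eventual lower bounds, capped by [K], to which completeness
    applies directly. *)
Lemma limit_from_functional {c : R} {a r d : nat -> R} {e0 eps : R} (p dp At w : R -> R) (m K l : R) :
  delay_solution c a r d e0 eps p dp -> m <> 0 -> mass_functional p At m (e0 / 2) ->
  (forall t, 0 < w t) -> slowly_varying w -> 0 < K -> (forall t, p t <= K * w t) ->
  (forall q, 0 < q -> exists T, forall t, t <= - T -> Rabs (At t - l * w t) <= q * w t) ->
  0 <= l / m /\
  forall q, 0 < q -> exists T, forall t, t <= - T -> Rabs (p t - l / m * w t) <= q * w t.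
Proof.
  intros Hds Hm HAm Hw Hslow HK Hpw HAl.
  assert (Hnn := ds_nonneg Hds).
  assert (Hinf : exists y, 0 <= y <= K /\
    (forall q, 0 < q -> exists T, forall t, t <= - T -> - (q * w t) <= 1 * (p t - y * w t)) /\
    (forall q T, 0 < q -> exists t, t <= - T /\ 1 * (p t - y * w t) <= q * w t)).
  { destruct (completeness (fun z => z <= K /\ exists T, forall t, t <= - T -> z * w t <= p t)) as [y [Hy1 Hy2]].
    - exists K. intros z [Hz _]; exact Hz.
    - exists 0. split; [lra|]. exists 0. intros t _. rewrite Rmult_0_l; apply Hnn.
    - exists y. assert (0 <= y <= K).
      { split; [apply Hy1; split; [lra|]; exists 0; intros t _; rewrite Rmult_0_l; apply Hnn|].
        apply Hy2. intros z [Hz _]; exact Hz. }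
      split; [assumption|]. split.
      + intros q Hq. destruct (classic (exists z, y - q < z /\ z <= K /\ exists T, forall t, t <= - T -> z * w t <= p t)) as [[z [Hz1 [Hz2 [T HT]]]]|Hno].
        * exists T. intros t Ht. specialize (HT t Ht). specialize (Hw t).
          assert ((y - q) * w t <= z * w t) by (apply Rmult_le_compat_r; lra). lra.
        * exfalso. assert (y <= y - q); [|lra]. apply Hy2. intros z [Hz1 Hz2].
          apply Rnot_lt_le. intros Hlt. apply Hno. exists z. tauto.
      + intros q T Hq. apply NNPP. intros Hno.
        assert (Hall : forall t, t <= - T -> (y + q) * w t <= p t).
        { intros t Ht. apply Rnot_lt_le. intros Hlt. apply Hno. exists t. split; [exact Ht|lra]. }
        destruct (Rle_lt_dec (y + q) K) as [H1|H1].
        * assert (y + q <= y); [|lra]. apply Hy1. split; [exact H1|]. exists T; exact Hall.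
        * specialize (Hall (- T) (Rle_refl _)). specialize (Hpw (- T)). specialize (Hw (- T)).
          assert (K * w (- T) < (y + q) * w (- T)) by (apply Rmult_lt_compat_r; lra). lra. }
  assert (Hsup : exists y, 0 <= y <= K /\
    (forall q, 0 < q -> exists T, forall t, t <= - T -> - (q * w t) <= -1 * (p t - y * w t)) /\
    (forall q T, 0 < q -> exists t, t <= - T /\ -1 * (p t - y * w t) <= q * w t)).
  { assert (HbK : forall z, (forall T, exists t, t <= - T /\ z * w t <= p t) -> z <= K).
    { intros z Hz. destruct (Hz 0) as [t [_ Ht]]. specialize (Hpw t). specialize (Hw t).
      apply (Rmult_le_reg_r (w t)); lra. }
    assert (H00 : forall T, exists t, t <= - T /\ 0 * w t <= p t).
    { intros T; exists (- T); split; [lra|]. rewrite Rmult_0_l; apply Hnn. }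
    destruct (completeness (fun z => forall T, exists t, t <= - T /\ z * w t <= p t)) as [y [Hy1 Hy2]].
    - exists K. exact HbK.
    - exists 0. exact H00.
    - exists y. split; [split; [apply Hy1; exact H00|apply Hy2; exact HbK]|]. split.
      + intros q Hq. apply NNPP. intros Hno.
        assert (y + q <= y); [|lra]. apply Hy1. intros T. apply NNPP. intros Hno2. apply Hno.
        exists T. intros t Ht. apply Rnot_lt_le. intros Hlt. apply Hno2. exists t. split; [exact Ht|lra].
      + intros q T Hq. destruct (classic (exists z, y - q < z /\ forall T, exists t, t <= - T /\ z * w t <= p t)) as [[z [Hz1 Hz2]]|Hno].
        * destruct (Hz2 T) as [t [Ht1 Ht2]]. exists t. split; [exact Ht1|]. specialize (Hw t).
          assert ((y - q) * w t <= z * w t) by (apply Rmult_le_compat_r; lra). lra.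
        * exfalso. assert (y <= y - q); [|lra]. apply Hy2. intros z Hz.
          apply Rnot_lt_le. intros Hlt. apply Hno. exists z. tauto. }
  destruct Hinf as [y1 [Hy1 [Hl1 Ha1]]]. destruct Hsup as [y2 [Hy2 [Hl2 Ha2]]].
  assert (E1 : m * y1 = l) by (eapply (extremal_limit_value p dp At w m K l 1 y1); eauto).
  assert (E2 : m * y2 = l) by (eapply (extremal_limit_value p dp At w m K l (-1) y2); eauto).
  assert (F1 : l / m = y1) by (rewrite <- E1; field; exact Hm).
  assert (F2 : l / m = y2) by (rewrite <- E2; field; exact Hm).
  split; [lra|]. intros q Hq.
  destruct (Hl1 q Hq) as [T1 HT1]. destruct (Hl2 q Hq) as [T2 HT2].
  exists (Rmax T1 T2). intros t Ht. pose proof (Rmax_l T1 T2). pose proof (Rmax_r T1 T2).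
  specialize (HT1 t ltac:(lra)). specialize (HT2 t ltac:(lra)).
  apply Rabs_le. rewrite F1 at 1. rewrite F2. split; lra.
Qed.

(** * Convergence of fluxes, and the weights used in the bounds *)

Lemma exists_primitive (p : R -> R) :
  (forall t, continuous p t) -> exists P, P 0 = 0 /\ forall t, is_derive P t (p t).
Proof.
  intros Hp. exists (fun t => RInt p 0 t). split; [apply (RInt_point 0 p)|].
  intros t. apply (is_derive_RInt p (fun t => RInt p 0 t) 0 t).
  - exists (mkposreal 1 Rlt_0_1). intros x _. apply (RInt_correct p 0 x).
    apply (ex_RInt_continuous p 0 x). intros z _. apply Hp.
  - apply Hp.
Qed.

(** With [B] the primitive of the bound, [A + B] is nondecreasing and [A - B] nonincreasing, so
    every [A - B] lies below every [A + B]; the number separating them is the limit at [-oo]. *)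
Lemma exponential_convergence (A f : R -> R) (C e : R) :
  0 < e -> 0 <= C -> (forall t, is_derive A t (f t)) ->
  (forall t, t <= 0 -> Rabs (f t) <= C * exp (e * t)) ->
  exists l, forall t, t <= 0 -> Rabs (A t - l) <= C / e * exp (e * t).
Proof.
  intros He HC HA Hf.
  set (B := fun t => C / e * exp (e * t)).
  assert (HB : forall t, is_derive B t (C * exp (e * t))).
  { intros t. unfold B. auto_derive; [exact I|]. field. lra. }
  assert (HBpos : forall t, 0 <= B t).
  { intros t. unfold B. apply Rmult_le_pos; [apply Rdiv_le_0_compat; lra|left; apply exp_pos]. }
  assert (Hinc : forall s t, s <= t -> t <= 0 -> A s + B s <= A t + B t).
  { intros s t Hst Ht. apply (is_derive_nonneg_le (fun t => A t + B t) (fun t => f t + C * exp (e * t))); [exact Hst| |].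
    - intros x _. apply (is_derive_plus A B); [apply HA|apply HB].
    - intros x Hx. specialize (Hf x ltac:(lra)). apply Rabs_le_between in Hf. lra. }
  assert (Hdec : forall s t, s <= t -> t <= 0 -> A t - B t <= A s - B s).
  { intros s t Hst Ht. 
    assert (- (A s - B s) <= - (A t - B t)); [|lra].
    apply (is_derive_nonneg_le (fun t => - (A t - B t)) (fun t => - (f t - C * exp (e * t)))); [exact Hst| |].
    - intros x _. apply (is_derive_opp (fun t => A t - B t)). apply (is_derive_minus A B); [apply HA|apply HB].
    - intros x Hx. specialize (Hf x ltac:(lra)). apply Rabs_le_between in Hf. lra. }
  assert (Hcross : forall s t, s <= 0 -> t <= 0 -> A s - B s <= A t + B t).
  { intros s t Hs Ht. pose proof (HBpos s). pose proof (HBpos t).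
    destruct (Rle_lt_dec s t).
    - specialize (Hinc s t r Ht). lra.
    - specialize (Hdec t s ltac:(lra) Hs). lra. }
  destruct (completeness (fun z => exists s, s <= 0 /\ z = A s - B s)) as [l [Hl1 Hl2]].
  - exists (A 0 + B 0). intros z [s [Hs ->]]. apply Hcross; lra.
  - exists (A 0 - B 0). exists 0. split; [lra|reflexivity].
  - exists l. intros t Ht. change (Rabs (A t - l) <= B t).
    assert (A t - B t <= l) by (apply Hl1; exists t; split; [exact Ht|reflexivity]).
    assert (l <= A t + B t) by (apply Hl2; intros z [s [Hs ->]]; apply Hcross; assumption).
    apply Rabs_le; lra.
Qed.

Lemma log_lipschitz_const (e : R) : 0 <= e -> log_lipschitz e (fun _ => 1).
Proof. intros He t s. rewrite Rmult_1_l. apply exp_abs_ge_1; exact He. Qed.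

Lemma log_lipschitz_exp (e b : R) : Rabs b <= e -> log_lipschitz e (fun t => exp (b * t)).
Proof.
  intros He t s. rewrite <- exp_plus. apply exp_le.
  replace (b * (t + s)) with (b * t + b * s) by ring.
  assert (b * s <= e * Rabs s); [|lra].
  eapply Rle_trans; [apply RRle_abs|]. rewrite Rabs_mult. apply Rmult_le_compat_r; [apply Rabs_pos|exact He].
Qed.

Lemma log_lipschitz_linear (e N : R) : 0 < N -> / N <= e -> log_lipschitz e (fun t => N + Rabs t).
Proof.
  intros HN He t s.
  assert (Hi : 0 < / N) by (apply Rinv_0_lt_compat; exact HN).
  pose proof (exp_ineq1_le (e * Rabs s)). pose proof (Rabs_pos t). pose proof (Rabs_pos s).
  pose proof (Rabs_triang t s).
  assert (1 <= N * e).
  { apply (Rmult_le_compat_l N) in He; [|lra]. rewrite Rinv_r in He by lra. exact He. }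
  apply Rle_trans with ((N + Rabs t) * (1 + e * Rabs s)).
  - assert (Rabs s <= N * e * Rabs s) by (rewrite <- (Rmult_1_l (Rabs s)) at 1; apply Rmult_le_compat_r; lra).
    assert (0 <= e * (Rabs t * Rabs s)) by (apply Rmult_le_pos; [lra|apply Rmult_le_pos; assumption]).
    lra.
  - apply Rmult_le_compat_l; lra.
Qed.

Lemma slowly_varying_const : slowly_varying (fun _ => 1).
Proof.
  intros eta Heta. exists 0. intros t _ s. rewrite !Rmult_1_l.
  assert (1 <= exp (eta * Rabs s)) by (apply exp_abs_ge_1; lra). split; assumption.
Qed.

Lemma slowly_varying_linear (N : R) : 0 < N -> slowly_varying (fun t => N + Rabs t).
Proof.
  intros HN eta Heta.
  (* Used for [|s| > - t / 2]. One factor [exp (eta |s| / 4)] exceeds [8 / (eta N) + 2] and the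
     other three are bounded below linearly; their product with [N] contains [6 |s| + 2 N], more
     than [N - t]. *)
  destruct (exp_ge_eventually (eta / 4) (8 / (eta * N) + 2)) as [T1 [HT10 HT1]]; [lra|].
  exists (2 * T1 + 2 / eta + N). intros t Ht s.
  assert (Hpe : 0 < 2 / eta) by (apply Rdiv_lt_0_compat; lra).
  assert (Hat : Rabs t = - t) by (apply Rabs_left; lra).
  split.
  - assert (Hi : / (N + - t) <= eta).
    { rewrite <- (Rinv_inv eta). apply Rinv_le_contravar; [apply Rinv_0_lt_compat; lra|].
      unfold Rdiv in *. lra. }
    pose proof (log_lipschitz_linear eta (N + - t) ltac:(lra) Hi 0 s) as Hl. cbv beta in Hl.
    rewrite Rplus_0_l, Rabs_R0, Rplus_0_r in Hl.
    pose proof (Rabs_triang t s). rewrite Hat in *. lra.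
  - pose proof (Rabs_pos (t + s)).
    destruct (Rle_lt_dec (Rabs s) (- t / 2)) as [Hs|Hs].
    + pose proof (exp_ineq1_le (eta * Rabs s)).
      assert (Hts : - t / 2 <= Rabs (t + s)).
      { apply Rabs_le_between in Hs. rewrite (Rabs_left1 (t + s)) by lra. lra. }
      assert (- t <= Rabs (t + s) + Rabs s).
      { rewrite <- Hat. replace t with (t + s + - s) at 1 by ring. rewrite <- (Rabs_Ropp s). apply Rabs_triang. }
      apply Rle_trans with ((N + Rabs (t + s)) * (1 + eta * Rabs s)); [|apply Rmult_le_compat_l; lra].
      assert (1 <= eta * (N + Rabs (t + s))).
      { assert (/ eta <= N + Rabs (t + s)) by (unfold Rdiv in *; assert (0 < / eta) by (apply Rinv_0_lt_compat; lra); lra).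
        apply (Rmult_le_compat_l eta) in H2; [|lra]. rewrite Rinv_r in H2 by lra. exact H2. }
      pose proof (Rabs_pos s). 
      assert (Rabs s <= eta * (N + Rabs (t + s)) * Rabs s) by (rewrite <- (Rmult_1_l (Rabs s)) at 1; apply Rmult_le_compat_r; lra).
      lra.
    + specialize (HT1 (Rabs s) ltac:(lra)).
      assert (H2 : exp (eta * Rabs s) = exp (eta / 4 * Rabs s) * exp (3 * (eta / 4 * Rabs s))) by (rewrite <- exp_plus; f_equal; field).
      pose proof (exp_ineq1_le (3 * (eta / 4 * Rabs s))).
      pose proof (Rabs_pos s).
      assert (Hpos8 : 0 < 8 / (eta * N)) by (apply Rdiv_lt_0_compat; [lra|apply Rmult_lt_0_compat; lra]).
      assert (0 <= eta / 4 * Rabs s) by (apply Rmult_le_pos; lra).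
      apply Rle_trans with (N * exp (eta * Rabs s)); [|apply Rmult_le_compat_r; [left; apply exp_pos|lra]].
      rewrite H2.
      assert (N * ((8 / (eta * N) + 2) * (1 + 3 * (eta / 4 * Rabs s))) <= N * (exp (eta / 4 * Rabs s) * exp (3 * (eta / 4 * Rabs s)))).
      { apply Rmult_le_compat_l; [lra|]. apply Rmult_le_compat; lra. }
      assert (N * ((8 / (eta * N) + 2) * (1 + 3 * (eta / 4 * Rabs s))) = 8 / eta + 6 * Rabs s + 2 * N + 6 * N * (eta / 4 * Rabs s)) by (field; lra).
      assert (0 <= 6 * N * (eta / 4 * Rabs s)) by (repeat apply Rmult_le_pos; lra).
      assert (0 < 8 / eta) by (apply Rdiv_lt_0_compat; lra).
      lra.
Qed.

Lemma ds_bounded_right {c : R} {a r d : nat -> R} {e0 eps : R} {p dp : R -> R} (T : R) :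
  delay_solution c a r d e0 eps p dp ->
  exists G, 0 < G /\ forall t, - T <= t -> p t <= G.
Proof.
  intros Hds. destruct (ds_bounded Hds) as [G1 HG1].
  destruct (ds_growth Hds 1 ltac:(lra)) as [G2 HG2].
  pose proof (ds_nonneg Hds) as Hn.
  assert (0 <= G1) by (specialize (HG1 0 ltac:(lra)); specialize (Hn 0); lra).
  assert (0 <= G2).
  { specialize (HG2 0). specialize (Hn 0). pose proof (exp_pos (1 * Rabs 0)). nra. }
  assert (0 <= G2 * exp (Rabs T)) by (apply Rmult_le_pos; [lra|left; apply exp_pos]).
  exists (G1 + G2 * exp (Rabs T) + 1). split; [lra|].
  intros t Ht. destruct (Rle_lt_dec 0 t) as [H2|H2].
  - specialize (HG1 t H2). lra.
  - specialize (HG2 t). assert (exp (1 * Rabs t) <= exp (Rabs T)).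
    { apply exp_le. rewrite (Rabs_left t) by lra. pose proof (RRle_abs T). lra. }
    assert (G2 * exp (1 * Rabs t) <= G2 * exp (Rabs T)) by (apply Rmult_le_compat_l; lra). lra.
Qed.

Lemma ds_negligible {c : R} {a r d : nat -> R} {e0 eps : R} {p dp : R -> R} (e : R) :
  delay_solution c a r d e0 eps p dp -> 0 < e ->
  forall q, 0 < q -> exists T, forall t, t < T -> p t <= q * exp (- e * t).
Proof.
  intros Hds He q Hq.
  destruct (ds_growth Hds (e / 2) ltac:(lra)) as [G HG].
  destruct (exp_ge_eventually (e / 2) (G / q)) as [T [HT0 HT]]; [lra|].
  exists (- T). intros t Ht. specialize (HT (- t) ltac:(lra)). specialize (HG t).
  rewrite (Rabs_left t) in HG by lra.
  replace (- e * t) with (e / 2 * - t + e / 2 * - t) by field. rewrite exp_plus.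
  pose proof (exp_pos (e / 2 * - t)).
  apply (Rmult_le_compat_l q) in HT; [|lra]. replace (q * (G / q)) with G in HT by (field; lra).
  eapply Rle_trans; [exact HG|]. rewrite <- Rmult_assoc. apply Rmult_le_compat_r; lra.
Qed.

Lemma continuous_exp_linear (b t : R) : continuous (fun t => exp (b * t)) t.
Proof. apply (ex_derive_continuous (fun t => exp (b * t)) t). auto_derive; exact I. Qed.

(** Boundedness comes first, with [w1 = 1] and a growing exponential as [w2]; then the limit is
    [l / m]. If it is 0, the improved smallness permits a second application of the same bound with
    a decaying [w1]. *)
Lemma asymptotics_constant {c : R} {a r d : nat -> R} {e0 eps : R} (p dp At : R -> R) (m l C e : R) :
  delay_solution c a r d e0 eps p dp -> m <> 0 -> mass_functional p At m (e0 / 2) ->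
  0 < e -> 0 <= C -> (forall t, t <= 0 -> Rabs (At t - l) <= C * exp (e * t)) ->
  (exists x, 0 < x /\ forall q, 0 < q -> exists T, forall t, t <= - T -> Rabs (p t - x) <= q) \/
  (exists b K, 0 < b /\ forall t, t <= 0 -> p t <= K * exp (b * t)).
Proof.
  intros Hds Hm HAm He HC HAl.
  destruct (bound_from_functional Hds Hm HAm) as [e3 [T0 [K [He3 [HT0 [HK Hbound]]]]]].
  destruct (ds_bounded_right T0 Hds) as [G [HG0 HG]].
  set (C0 := Rabs l + C + G). assert (HC0 : 0 < C0) by (pose proof (Rabs_pos l); unfold C0; lra).
  assert (Hbd : forall t, p t <= K * C0 * 1).
  { apply (Hbound C0 (fun _ => 1) (fun t => exp (- e3 * t)) HC0).
    - intros; lra.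
    - intros; apply exp_pos.
    - intros; apply continuous_const.
    - intros; apply continuous_exp_linear.
    - apply log_lipschitz_const; lra.
    - apply log_lipschitz_exp. rewrite Rabs_Ropp, Rabs_pos_eq; lra.
    - apply (ds_negligible e3 Hds He3).
    - intros t Ht. specialize (HAl t ltac:(lra)).
      assert (exp (e * t) <= 1) by (rewrite <- exp_0; apply exp_le; nra).
      assert (C * exp (e * t) <= C * 1) by (apply Rmult_le_compat_l; lra).
      replace (At t) with ((At t - l) + l) by ring. eapply Rle_trans; [apply Rabs_triang|]. unfold C0; lra.
    - intros t Ht. specialize (HG t Ht). pose proof (Rabs_pos l). unfold C0; lra. }
  assert (HKC : 0 < K * C0) by (apply Rmult_lt_0_compat; lra).
  destruct (limit_from_functional p dp At (fun _ => 1) m (K * C0) l Hds Hm HAm) as [Hx Hlim]; try assumption.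
  - intros; lra.
  - apply slowly_varying_const.
  - intros q Hq. destruct (exp_ge_eventually e (C / q)) as [T [HT1 HT]]; [exact He|].
    exists T. intros t Ht. specialize (HT (- t) ltac:(lra)). rewrite !Rmult_1_r.
    eapply Rle_trans; [apply HAl; lra|].
    replace (e * t) with (- (e * - t)) by ring. rewrite exp_Ropp.
    pose proof (exp_pos (e * - t)).
    apply (Rmult_le_compat_l q) in HT; [|lra]. replace (q * (C / q)) with C in HT by (field; lra).
    apply (Rmult_le_reg_r (exp (e * - t))); [assumption|]. rewrite Rmult_assoc, Rinv_l by lra. lra.
  - destruct Hx as [Hx|Hx].
    + left. exists (l / m). split; [exact Hx|]. intros q Hq. destruct (Hlim q Hq) as [T HT].
      exists T. intros t Ht. specialize (HT t Ht). rewrite !Rmult_1_r in HT. exact HT.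
    + right. set (b := Rmin e e3). assert (Hb : 0 < b) by (apply Rmin_glb_lt; assumption).
      assert (Hbe : b <= e) by apply Rmin_l. assert (Hbe3 : b <= e3) by apply Rmin_r.
      assert (Hl0 : l = 0).
      { replace l with (l / m * m) by (field; exact Hm). rewrite <- Hx. ring. }
      subst l. rewrite <- Hx in Hlim.
      (* The first summand serves the flux on the left; the second serves [p] on [[-T0, +oo)], where
         [exp (b t) >= exp (- b T0)]. *)
      set (C1 := C + K * C0 * exp (b * T0)).
      assert (HC1 : 0 < C1).
      { unfold C1. assert (0 < K * C0 * exp (b * T0)) by (apply Rmult_lt_0_compat; [lra|apply exp_pos]). lra. }
      exists b, (K * C1). split; [exact Hb|]. intros t _. revert t.
      apply (Hbound C1 (fun t => exp (b * t)) (fun _ => 1) HC1).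
      * intros; apply exp_pos.
      * intros; lra.
      * intros; apply continuous_exp_linear.
      * intros; apply continuous_const.
      * apply log_lipschitz_exp. rewrite Rabs_pos_eq; lra.
      * apply log_lipschitz_const; lra.
      * intros q Hq. destruct (Hlim q Hq) as [T HT]. exists (- T). intros t Ht.
        specialize (HT t ltac:(lra)). apply Rabs_le_between in HT. lra.
      * intros t Ht. specialize (HAl t ltac:(lra)). rewrite Rminus_0_r in HAl.
        eapply Rle_trans; [exact HAl|].
        assert (exp (e * t) <= exp (b * t)) by (apply exp_le; nra).
        pose proof (exp_pos (e * t)). apply Rmult_le_compat; try lra.
        unfold C1. assert (0 < K * C0 * exp (b * T0)) by (apply Rmult_lt_0_compat; [lra|apply exp_pos]). lra.
      * intros t Ht. specialize (Hbd t). unfold C1.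
        assert (1 <= exp (b * T0) * exp (b * t)) by (rewrite <- exp_plus, <- exp_0; apply exp_le; nra).
        assert (0 <= C * exp (b * t)) by (apply Rmult_le_pos; [lra|left; apply exp_pos]).
        assert (K * C0 * 1 <= K * C0 * (exp (b * T0) * exp (b * t))) by (apply Rmult_le_compat_l; lra). lra.
Qed.

Lemma asymptotics_linear {c : R} {a r d : nat -> R} {e0 eps : R} (p dp At : R -> R) (m l C : R) :
  delay_solution c a r d e0 eps p dp -> m <> 0 -> mass_functional p At m (e0 / 2) ->
  l <> 0 -> (forall t, t <= 0 -> Rabs (At t - l * t) <= C) ->
  exists x, 0 < x /\ forall q, 0 < q -> exists T, forall t, t <= - T -> Rabs (p t - x * - t) <= q * - t.
Proof.
  intros Hds Hm HAm Hl HAl.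
  assert (HC : 0 <= C) by (specialize (HAl 0 ltac:(lra)); pose proof (Rabs_pos (At 0 - l * 0)); lra).
  destruct (bound_from_functional Hds Hm HAm) as [e3 [T0 [K [He3 [HT0 [HK Hbound]]]]]].
  destruct (ds_bounded_right T0 Hds) as [G [HG0 HG]].
  (* The logarithmic derivative of [N + |t|] is at most [1 / N <= e3], as the a priori bound
     demands. *)
  set (N := 1 + / e3). assert (HN : 1 < N) by (assert (0 < / e3) by (apply Rinv_0_lt_compat; exact He3); unfold N; lra).
  assert (HNe : / N <= e3).
  { rewrite <- (Rinv_inv e3). apply Rinv_le_contravar; [apply Rinv_0_lt_compat; exact He3|unfold N; lra]. }
  set (C0 := Rabs l + C + G). pose proof (Rabs_pos l) as Hlp.
  assert (HC0 : 0 < C0) by (unfold C0; lra).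
  assert (HlN : log_lipschitz e3 (fun t => N + Rabs t)) by (apply log_lipschitz_linear; lra).
  assert (Hbd : forall t, p t <= K * C0 * (N + Rabs t)).
  { apply (Hbound C0 (fun t => N + Rabs t) (fun t => exp (- e3 * t)) HC0).
    - intros t; pose proof (Rabs_pos t); lra.
    - intros; apply exp_pos.
    - intros t. apply (continuous_plus (fun _ => N) Rabs); [apply continuous_const|]. apply continuity_pt_filterlim, Rcontinuity_abs.
    - intros; apply continuous_exp_linear.
    - exact HlN.
    - apply log_lipschitz_exp. rewrite Rabs_Ropp, Rabs_pos_eq; lra.
    - apply (ds_negligible e3 Hds He3).
    - intros t Ht. specialize (HAl t ltac:(lra)).
      replace (At t) with ((At t - l * t) + l * t) by ring. eapply Rle_trans; [apply Rabs_triang|].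
      rewrite Rabs_mult. pose proof (Rabs_pos t).
      assert (0 <= G * (N + Rabs t)) by (apply Rmult_le_pos; lra).
      assert (C * 1 <= C * (N + Rabs t)) by (apply Rmult_le_compat_l; lra).
      assert (Rabs l * Rabs t <= Rabs l * (N + Rabs t)) by (apply Rmult_le_compat_l; lra).
      unfold C0; lra.
    - intros t Ht. specialize (HG t Ht). pose proof (Rabs_pos t).
      assert (G * 1 <= G * (N + Rabs t)) by (apply Rmult_le_compat_l; lra).
      assert (0 <= (Rabs l + C) * (N + Rabs t)) by (apply Rmult_le_pos; lra).
      unfold C0; lra. }
  assert (HKC : 0 < K * C0) by (apply Rmult_lt_0_compat; lra).
  destruct (limit_from_functional p dp At (fun t => N + Rabs t) m (K * C0) (- l) Hds Hm HAm) as [Hx Hlim]; try assumption.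
  - intros t; pose proof (Rabs_pos t); lra.
  - apply slowly_varying_linear; lra.
  - intros q Hq. exists ((C + Rabs l * N) / q).
    assert (0 <= (C + Rabs l * N) / q) by (apply Rdiv_le_0_compat; [|exact Hq]; assert (0 <= Rabs l * N) by (apply Rmult_le_pos; lra); lra).
    intros t Ht. specialize (HAl t ltac:(lra)).
    rewrite (Rabs_left1 t) by lra.
    replace (At t - - l * (N + - t)) with ((At t - l * t) + l * N) by ring.
    eapply Rle_trans; [apply Rabs_triang|]. rewrite Rabs_mult, (Rabs_pos_eq N) by lra.
    assert (C + Rabs l * N <= q * - t).
    { replace (C + Rabs l * N) with (q * ((C + Rabs l * N) / q)) by (field; lra). apply Rmult_le_compat_l; lra. }
    assert (0 <= q * N) by (apply Rmult_le_pos; lra). lra.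
  (* The sign is that of [l t = - l |t|] for [t <= 0]. The limit lemma gives [x >= 0], and [l <> 0]
     makes it strict. *)
  - set (x := - l / m) in *. exists x.
    assert (Hx0 : x <> 0).
    { intros H0. apply Hl. replace l with (- (x * m)) by (unfold x; field; exact Hm). rewrite H0; ring. }
    split; [lra|]. intros q Hq. destruct (Hlim (q / 3) ltac:(lra)) as [T HT].
    exists (Rmax T (Rmax N (3 * (x * N) / q))). intros t Ht.
    pose proof (Rmax_l T (Rmax N (3 * (x * N) / q))). pose proof (Rmax_r T (Rmax N (3 * (x * N) / q))).
    pose proof (Rmax_l N (3 * (x * N) / q)). pose proof (Rmax_r N (3 * (x * N) / q)).
    specialize (HT t ltac:(lra)). rewrite (Rabs_left1 t) in HT by lra.
    assert (3 * (x * N) <= q * - t).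
    { replace (3 * (x * N)) with (q * (3 * (x * N) / q)) by (field; lra). apply Rmult_le_compat_l; lra. }
    assert (q / 3 * (N + - t) <= 2 * (q / 3 * - t)).
    { assert (q / 3 * N <= q / 3 * - t) by (apply Rmult_le_compat_l; lra). lra. }
    assert (0 <= x * N) by (apply Rmult_le_pos; lra).
    apply Rabs_le_between in HT. apply Rabs_le. lra.
Qed.

(** If the mass [m] is nonzero, the convergent flux determines a limit of [p]. If [m = 0], the flux
    [A2] of the primitive has derivative [A], so [A2 - l t] converges: [l = 0] leads back to the
    constant case, [l <> 0] to linear growth in [|t|]. The third alternative is the degenerate limit
    0. *)
Lemma asymptotics {c : R} {a r d : nat -> R} {e0 eps : R} {p dp : R -> R} :
  delay_solution c a r d e0 eps p dp ->
  (exists x, 0 < x /\ forall q, 0 < q -> exists T, forall t, t <= - T -> Rabs (p t - x) <= q) \/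
  (exists x, 0 < x /\ forall q, 0 < q -> exists T, forall t, t <= - T -> Rabs (p t - x * - t) <= q * - t) \/
  (exists b K, 0 < b /\ forall t, t <= 0 -> p t <= K * exp (b * t)).
Proof.
  intros Hds. 
  pose proof (ds_a Hds) as HKa. pose proof (ds_d Hds) as HKd.
  pose proof (kernel_pos HKa) as He0. pose proof (ds_eps Hds) as Heps.
  pose proof (ds_nonneg Hds) as Hn. pose proof (ds_derive Hds) as Hdp.
  destruct (exists_primitive p) as [P [HP0 HP]].
  { intros t. apply (ex_derive_continuous p t). exists (dp t). apply Hdp. }
  destruct (exists_primitive P) as [Q [HQ0 HQ]].
  { intros t. apply (ex_derive_continuous P t). exists (p t). apply HP. }
  (* The primitive [P] inherits the growth rate [3 e4], which has to stay below the [e0 / 2] of the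
     flux lemmas. *)
  set (e4 := e0 / 16).
  destruct (ds_growth Hds e4 ltac:(unfold e4; lra)) as [G HG].
  assert (HG' : forall t, Rabs (p t) <= G * exp (e4 * Rabs t)) by (intros t; rewrite Rabs_pos_eq by apply Hn; apply HG).
  assert (HG0 : 0 <= G).
  { specialize (HG 0). specialize (Hn 0). pose proof (exp_pos (e4 * Rabs 0)). nra. }
  assert (HGh : forall t, Rabs (p t) <= G * exp (e0 / 2 * Rabs t)).
  { intros t. eapply Rle_trans; [apply HG'|]. apply Rmult_le_compat_l; [exact HG0|]. apply exp_le.
    apply Rmult_le_compat_r; [apply Rabs_pos|unfold e4; lra]. }
  assert (HPG : forall t, Rabs (P t) <= G / e4 * exp (e0 / 2 * Rabs t)).
  { intros t. pose proof (primitive_increment p P G e4 t t ltac:(unfold e4; lra) HG0 HP HG') as H.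
    rewrite Rminus_diag, HP0, Rminus_0_r in H. eapply Rle_trans; [exact H|].
    pose proof (abs_le_exp t e4 ltac:(unfold e4; lra)) as Ha.
    pose proof (exp_pos (e4 * Rabs t)).
    apply Rle_trans with (G * exp (e4 * Rabs t) * (/ e4 * exp (e4 * Rabs t) * exp (e4 * Rabs t))).
    - apply Rmult_le_compat_l; [apply Rmult_le_pos; lra|]. apply Rmult_le_compat_r; lra.
    - replace (G * exp (e4 * Rabs t) * (/ e4 * exp (e4 * Rabs t) * exp (e4 * Rabs t)))
        with (G / e4 * (exp (e4 * Rabs t) * exp (e4 * Rabs t) * exp (e4 * Rabs t))) by (unfold Rdiv; ring).
      apply Rmult_le_compat_l; [apply Rdiv_le_0_compat; [lra|unfold e4; lra]|].
      rewrite <- !exp_plus. apply exp_le. pose proof (Rabs_pos t). 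
      replace (e4 * Rabs t + e4 * Rabs t + e4 * Rabs t) with (3 * e4 * Rabs t) by ring.
      apply Rmult_le_compat_r; [assumption|unfold e4; lra]. }
  set (A := flux c a r p P).
  set (f := fun t => c * dp t + Series (fun j => a j * (p t - p (t - r j)))).
  assert (HA : forall t, is_derive A t (f t)).
  { intros t. apply (is_derive_flux c a r e0 (e0 / 2) G p dp P t HKa ltac:(lra) HP Hdp HGh). }
  (* Growth of [p] at rate [b] consumes at most half of the gain [exp (eps t)]; the other half makes
     [f] integrable at [-oo]. *)
  set (b := Rmin (eps / 2) e0).
  assert (Hb : 0 < b) by (apply Rmin_glb_lt; lra).
  assert (Hbe : b <= eps / 2) by apply Rmin_l. assert (Hbe0 : b <= e0) by apply Rmin_r.
  destruct (ds_growth Hds b Hb) as [Gb HGb].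
  assert (HGb0 : 0 <= Gb).
  { specialize (HGb 0). specialize (Hn 0). pose proof (exp_pos (b * Rabs 0)). nra. }
  pose proof (kernel_le d r e0 b ltac:(lra) HKd) as HKdb.
  set (Cf := Gb * Series (fun j => d j * exp (b * Rabs (r j)))).
  assert (HCf : 0 <= Cf).
  { apply Rmult_le_pos; [exact HGb0|]. apply Series_nonneg; [|apply (kernel_summable HKdb)].
    intros j. apply Rmult_le_pos; [apply (kernel_nonneg HKd)|left; apply exp_pos]. }
  assert (Hf : forall t, t <= 0 -> Rabs (f t) <= Cf * exp (eps / 2 * t)).
  { intros t Ht. pose proof (ds_eq Hds t) as Heq.
    replace (f t) with (c * dp t - Series (fun j => a j * (p (t - r j) - p t))).
    2:{ unfold f, Rminus at 1. f_equal. rewrite <- Series_opp. apply Series_ext. intros j; ring. }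
    eapply Rle_trans; [exact Heq|].
    pose proof (kernel_Series_le d r (fun j => p (t - r j)) b (Gb * exp (b * Rabs t)) HKdb) as HS.
    assert (HSb : Rabs (Series (fun j => d j * p (t - r j))) <= Gb * exp (b * Rabs t) * Series (fun j => d j * exp (b * Rabs (r j)))).
    { apply HS. intros j. rewrite Rabs_pos_eq by apply Hn. eapply Rle_trans; [apply HGb|].
      rewrite Rmult_assoc. apply Rmult_le_compat_l; [exact HGb0|]. unfold Rminus. rewrite <- (Rabs_Ropp (r j)).
      apply exp_abs_plus; lra. }
    pose proof (RRle_abs (Series (fun j => d j * p (t - r j)))).
    apply Rle_trans with (exp (eps * t) * (Gb * exp (b * Rabs t) * Series (fun j => d j * exp (b * Rabs (r j))))).
    - apply Rmult_le_compat_l; [left; apply exp_pos|lra].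
    - replace (exp (eps * t) * (Gb * exp (b * Rabs t) * Series (fun j => d j * exp (b * Rabs (r j)))))
        with (Cf * (exp (eps * t) * exp (b * Rabs t))) by (unfold Cf; ring).
      apply Rmult_le_compat_l; [exact HCf|]. rewrite <- exp_plus. apply exp_le.
      rewrite Rabs_left1 by exact Ht. nra. }
  destruct (exponential_convergence A f Cf (eps / 2) ltac:(lra) HCf HA Hf) as [l Hl].
  assert (HCe : 0 <= Cf / (eps / 2)) by (apply Rdiv_le_0_compat; lra).
  set (m := c + Series (fun j => a j * r j)).
  destruct (Req_dec m 0) as [Hm|Hm].
  2:{ assert (HAm : mass_functional p A m (e0 / 2)) by (apply (flux_mass c a r e0 (e0 / 2) G p P HKa ltac:(lra) HP HGh)).
      destruct (asymptotics_constant p dp A m l _ (eps / 2) Hds Hm HAm ltac:(lra) HCe Hl) as [H|H]; [left|right; right]; exact H. }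
  set (A2 := flux c a r P Q).
  set (m2 := - / 2 * Series (fun j => a j * r j ^ 2)).
  assert (HA2m : mass_functional p A2 m2 (e0 / 2)).
  { apply (flux_mass2 c a r e0 (e0 / 2) (G / e4) p P Q HKa ltac:(lra) HP HQ HPG Hm). }
  assert (Hm2 : m2 <> 0).
  { assert (a 0%nat * r 0%nat ^ 2 <= Series (fun j => a j * r j ^ 2)).
    { apply (Series_ge_term (fun j => a j * r j ^ 2) 0).
      - intros j. apply Rmult_le_pos; [apply (kernel_nonneg HKa)|apply pow2_ge_0].
      - pose proof (kernel_moment a r e0 0 2 ltac:(lra) HKa) as HM.
        eapply ex_series_ext; [|exact HM]. intros j; simpl. rewrite Rmult_0_l, exp_0, !Rmult_1_r, <- Rabs_mult, Rabs_pos_eq by nra. reflexivity. }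
    rewrite (ds_r0 Hds) in H. pose proof (ds_a0 Hds). unfold m2. lra. }
  (* The derivative formula for the flux of [P] is literally the flux of [p]. *)
  assert (HA2 : forall t, is_derive A2 t (A t)).
  { intros t. replace (A t) with (c * p t + Series (fun j => a j * (P t - P (t - r j)))) by reflexivity.
    apply (is_derive_flux c a r e0 (e0 / 2) (G / e4) P p Q t HKa ltac:(lra) HQ HP HPG). }
  destruct (exponential_convergence (fun t => A2 t - l * t) (fun t => A t - l) (Cf / (eps / 2)) (eps / 2) ltac:(lra) HCe) as [l2 Hl2].
  { intros t. apply (is_derive_minus A2 (fun t => l * t)); [apply HA2|]. auto_derive; [exact I|ring]. }
  { exact Hl. }
  set (C2 := Cf / (eps / 2) / (eps / 2)) in *. assert (HC2 : 0 <= C2) by (apply Rdiv_le_0_compat; lra).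
  destruct (Req_dec l 0) as [H0|H0].
  - destruct (asymptotics_constant p dp A2 m2 l2 C2 (eps / 2) Hds Hm2 HA2m ltac:(lra) HC2) as [H|H].
    + intros t Ht. specialize (Hl2 t Ht). rewrite H0, Rmult_0_l, Rminus_0_r in Hl2. exact Hl2.
    + left; exact H.
    + right; right; exact H.
  - right; left. apply (asymptotics_linear p dp A2 m2 l (C2 + Rabs l2) Hds Hm2 HA2m H0).
    intros t Ht. specialize (Hl2 t Ht).
    assert (exp (eps / 2 * t) <= 1) by (rewrite <- exp_0; apply exp_le; nra).
    assert (C2 * exp (eps / 2 * t) <= C2 * 1) by (apply Rmult_le_compat_l; lra).
    replace (A2 t - l * t) with ((A2 t - l * t - l2) + l2) by ring.
    eapply Rle_trans; [apply Rabs_triang|]. lra.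
Qed.

(** * The nonlinearity and the kernel over Z *)

(* The enumeration 0, 1, -1, 2, -2, ... of Z, matching the symmetric partial sums of [Zsum_to]. *)
Definition Zenum (j : nat) : Z :=
  if Nat.odd j then Z.of_nat (S (Nat.div2 j)) else (- Z.of_nat (Nat.div2 j))%Z.

Lemma Zenum_partial_sums (f : Z -> R) (N : nat) :
  sum_f_R0 (fun n : nat => match n with
                    | O => f 0%Z
                    | S _ => f (Z.of_nat n) + f (- Z.of_nat n)%Z
                    end) N = sum_f_R0 (fun j => f (Zenum j)) (2 * N).
Proof.
  induction N as [|N IH]; [reflexivity|].
  replace (2 * S N)%nat with (S (S (2 * N))) by lia.
  rewrite !tech5, IH.
  replace (Zenum (S (2 * N))) with (Z.of_nat (S N)).
  - replace (Zenum (S (S (2 * N)))) with (- Z.of_nat (S N))%Z; [ring|].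
    unfold Zenum. replace (S (S (2 * N))) with (2 * S N)%nat by lia.
    rewrite Nat.odd_mul. simpl Nat.odd. rewrite Nat.div2_double. reflexivity.
  - unfold Zenum. replace (S (2 * N)) with (2 * N + 1)%nat by lia.
    rewrite Nat.odd_odd. replace (2 * N + 1)%nat with (S (2 * N)) by lia.
    rewrite Nat.div2_succ_double. reflexivity.
Qed.

(** The symmetric partial sums are the even ones of the enumeration; for nonnegative terms,
    monotonicity supplies the odd ones. *)
Lemma Zsum_to_is_series (f : Z -> R) (l : R) :
  (forall k, 0 <= f k) -> (Zsum_to f l <-> is_series (fun j => f (Zenum j)) l).
Proof.
  intros Hf. set (s := fun j => f (Zenum j)).
  assert (Hs : forall j, 0 <= s j) by (intros; apply Hf).
  assert (Hmono : forall n m, (n <= m)%nat -> sum_f_R0 s n <= sum_f_R0 s m).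
  { intros n m H. induction H; [lra|]. rewrite tech5. specialize (Hs (S m)). lra. }
  unfold Zsum_to. split; intros H.
  - apply is_series_Reals. intros eps Heps. destruct (H eps Heps) as [N HN].
    assert (Hub : forall m, sum_f_R0 s m <= l).
    { intros m. apply Rnot_lt_le. intros Hlt.
      destruct (H (sum_f_R0 s m - l)) as [N' HN']; [lra|].
      specialize (HN' (N' + m)%nat ltac:(lia)). rewrite Zenum_partial_sums in HN'. fold s in HN'.
      specialize (Hmono m (2 * (N' + m))%nat ltac:(lia)).
      unfold Rdist in HN'. apply Rabs_def2 in HN'. lra. }
    exists (2 * N)%nat. intros n Hn. specialize (HN N (le_n _)).
    rewrite Zenum_partial_sums in HN. fold s in HN. specialize (Hmono (2 * N)%nat n ltac:(lia)). specialize (Hub n).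
    unfold Rdist in *. apply Rabs_def2 in HN. apply Rabs_def1; lra.
  - apply is_series_Reals in H. intros eps Heps. destruct (H eps Heps) as [N HN].
    exists N. intros n Hn. rewrite Zenum_partial_sums. apply HN. lia.
Qed.

Definition exp_sum_finite (b rho : nat -> R) (z : R) : Prop :=
  ex_series (fun j => b j * exp (- (z * rho j))).

Lemma exp_sum_finite_between (b rho : nat -> R) (z1 z z2 : R) :
  (forall j, 0 <= b j) -> z1 <= z <= z2 ->
  exp_sum_finite b rho z1 -> exp_sum_finite b rho z2 -> exp_sum_finite b rho z.
Proof.
  intros Hb Hz H1 H2. unfold exp_sum_finite in *.
  eapply ex_series_le_R; [|apply (ex_series_plus _ _ H1 H2)].
  intros j. specialize (Hb j). unfold plus; simpl.
  rewrite Rabs_pos_eq by (apply Rmult_le_pos; [exact Hb|left; apply exp_pos]).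
  rewrite <- Rmult_plus_distr_l. apply Rmult_le_compat_l; [exact Hb|].
  pose proof (exp_pos (- (z1 * rho j))). pose proof (exp_pos (- (z2 * rho j))).
  destruct (Rle_lt_dec 0 (rho j)).
  - assert (exp (- (z * rho j)) <= exp (- (z1 * rho j))) by (apply exp_le; nra). lra.
  - assert (exp (- (z * rho j)) <= exp (- (z2 * rho j))) by (apply exp_le; nra). lra.
Qed.

(** A finite sum at [gam] itself would bound [B] on the left of [gam], contrary to the blow-up; so
    finiteness at [z] means [z < gam]. The shift [s] only multiplies the sum by [exp (- z s)]. *)
Lemma gamma_cond_open (beta : Z -> R) (s z : R) :
  (forall k, 0 <= beta k) -> Zsum_to beta 1 -> gamma_cond beta -> 0 <= z ->
  exp_sum_finite (fun j => beta (Zenum j)) (fun j => IZR (Zenum j) + s) z ->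
  exists z', z < z' /\ exp_sum_finite (fun j => beta (Zenum j)) (fun j => IZR (Zenum j) + s) z'.
Proof.
  intros Hb Hsum Hg Hz Hfin.
  assert (Hterm : forall z k, 0 <= beta k * exp (- (z * IZR k))).
  { intros y k. apply Rmult_le_pos; [apply Hb|left; apply exp_pos]. }
  assert (Hiff : forall z, exp_sum_finite (fun j => beta (Zenum j)) (fun j => IZR (Zenum j) + s) z <-> B_finite beta z).
  { intros y. unfold exp_sum_finite, B_finite, Bval. split.
    - intros H. apply (ex_series_scal_l (exp (y * s))) in H. destruct H as [l Hl]. exists l.
      apply Zsum_to_is_series; [apply Hterm|]. eapply is_series_ext; [|exact Hl].
      intros j. cbv beta. unfold scal; simpl; unfold mult; simpl.
      replace (- (y * (IZR (Zenum j) + s))) with (- (y * IZR (Zenum j)) + - (y * s)) by ring.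
        rewrite exp_plus, (exp_Ropp (y * s)). pose proof (exp_pos (y * s)). field. lra.
    - intros [l Hl]. apply (Zsum_to_is_series _ _ (Hterm y)) in Hl.
      assert (H : ex_series (fun j => beta (Zenum j) * exp (- (y * IZR (Zenum j))))) by (exists l; exact Hl).
      apply (ex_series_scal_l (exp (- (y * s)))) in H. eapply ex_series_ext; [|exact H].
      intros j. unfold scal; simpl; unfold mult; simpl.
      replace (- (y * (IZR (Zenum j) + s))) with (- (y * IZR (Zenum j)) + - (y * s)) by ring.
      rewrite exp_plus. ring. }
  apply Hiff in Hfin.
  destruct Hg as [[gam [Hgam [Hin [Hout Hblow]]]]|[Hall _]].
  2:{ exists (z + 1). split; [lra|]. apply Hiff. apply Hall; lra. }
  assert (Hzg : z < gam).
  { destruct (Rtotal_order z gam) as [H|[H|H]]; [exact H| |exfalso; apply (Hout z H Hfin)].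
    exfalso. subst z. destruct Hfin as [l Hl].
    destruct (Hblow (1 + l)) as [del [Hdel Hblow']].
    set (z1 := Rmax (gam - del / 2) (gam / 2)).
    assert (Hz1 : gam - del < z1 < gam).
    { unfold z1. split; [|apply Rmax_lub_lt; lra]. apply Rlt_le_trans with (gam - del / 2); [lra|apply Rmax_l]. }
    assert (Hz10 : 0 < z1) by (unfold z1; apply Rlt_le_trans with (gam / 2); [lra|apply Rmax_r]).
    destruct (Hin z1 ltac:(lra)) as [l1 Hl1].
    specialize (Hblow' z1 l1 Hz1 Hl1).
    apply (Zsum_to_is_series _ _ (Hterm gam)) in Hl. apply (Zsum_to_is_series _ _ (Hterm z1)) in Hl1.
    apply (Zsum_to_is_series _ _ Hb) in Hsum.
    (* Terms with [k >= 0] are at most [beta k], of total 1; those with [k < 0] are at most their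
       values at [gam]. *)
    assert (Hle : l1 <= 1 + l).
    { pose proof (is_series_plus _ _ _ _ Hsum Hl) as Hpl.
      rewrite <- (is_series_unique _ _ Hl1).
      replace (1 + l) with (Series (fun j => beta (Zenum j) + beta (Zenum j) * exp (- (gam * IZR (Zenum j))))) by (apply is_series_unique; exact Hpl).
      apply Series_le.
      - intros j. split; [apply Hterm|].
        rewrite <- (Rmult_1_r (beta (Zenum j))) at 2. rewrite <- Rmult_plus_distr_l.
        apply Rmult_le_compat_l; [apply Hb|].
        pose proof (exp_pos (- (gam * IZR (Zenum j)))).
        destruct (Rle_lt_dec 0 (IZR (Zenum j))).
        + assert (exp (- (z1 * IZR (Zenum j))) <= 1) by (rewrite <- exp_0; apply exp_le; nra). lra.
        + assert (exp (- (z1 * IZR (Zenum j))) <= exp (- (gam * IZR (Zenum j)))) by (apply exp_le; nra). lra.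
      - eexists. exact Hpl. }
    lra. }
  exists ((z + gam) / 2). split; [lra|]. apply Hiff. apply Hin. lra.
Qed.

(** The form in which (H) is used. [re_holder] reaches up to any bound [M], so that the remainder
    estimate holds along a whole bounded front. [re_contract] looks only to the left of [kappa],
    because fronts turn out to lie below [kappa], by [re_below]. *)
Record reaction (g : R -> R) (kappa g0 : R) : Prop := {
  re_kappa : 0 < kappa;
  re_nonneg : forall x, 0 <= x -> 0 <= g x;
  re_mono : forall x y, 0 <= x -> x <= y -> g x <= g y;
  re_zero : g 0 = 0;
  re_g0 : 1 < g0;
  re_linear : forall q, 0 < q -> exists u0, 0 < u0 /\ forall u, 0 < u <= u0 -> Rabs (g u - g0 * u) <= q * u;
  re_holder : exists th, 0 < th /\ forall M, exists C, 0 < C /\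
     forall u, 0 < u <= M -> Rabs (g u - g0 * u) <= C * (u * Rpower u th);
  re_contract : exists q e, 0 <= q < 1 /\ 0 < e /\
     forall x y, kappa - e <= x -> x <= y -> y <= kappa -> g y - g x <= q * (y - x);
  re_below : forall x, kappa < x -> g x < x
}.
Arguments re_kappa {g kappa g0} _.
Arguments re_nonneg {g kappa g0} _.
Arguments re_mono {g kappa g0} _.
Arguments re_zero {g kappa g0} _.
Arguments re_g0 {g kappa g0} _.
Arguments re_linear {g kappa g0} _.
Arguments re_holder {g kappa g0} _.
Arguments re_contract {g kappa g0} _.
Arguments re_below {g kappa g0} _.

Lemma reaction_of_hyp (g : R -> R) (kappa : R) :
  hyp_H_weak g kappa -> exists g0, reaction g kappa g0.
Proof.
  intros [Hk [Hnn [Hcont [Hmono [Hfix [[g0 [Hg0 [Hlin [C [th [del [HC [Hth [Hdel Hhol]]]]]]]]] [dg [e [He [Hdg [Hcdg Hdgk]]]]]]]]]]].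
  assert (Hz : g 0 = 0) by (apply Hfix; [lra|left; reflexivity]).
  assert (Hgk : g kappa = kappa) by (apply Hfix; [lra|right; reflexivity]).
  assert (Hcon : exists q e, 0 <= q < 1 /\ 0 < e /\
     forall x y, kappa - e <= x -> x <= y -> y <= kappa + e -> g y - g x <= q * (y - x)).
  (* The midpoint between the slope at [kappa] and 1. The contraction is proved on both sides of
     [kappa], the right side being needed for [re_below]. *)
  { set (q := Rmax 0 ((1 + dg kappa) / 2)).
    assert (Hq : 0 <= q < 1) by (unfold q; split; [apply Rmax_l|apply Rmax_lub_lt; lra]).
    destruct (Hcdg kappa ltac:(rewrite Rminus_diag, Rabs_R0; exact He) ((1 - dg kappa) / 2) ltac:(lra)) as [e1 [He1 Hd]].
    set (e' := Rmin e e1 / 2). 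
    assert (Hm : 0 < Rmin e e1) by (apply Rmin_glb_lt; lra).
    pose proof (Rmin_l e e1). pose proof (Rmin_r e e1).
    exists q, e'. split; [exact Hq|]. split; [unfold e'; lra|].
    intros x y Hx Hxy Hy.
    assert (q * x - g x <= q * y - g y); [|lra].
    apply (is_derive_nonneg_le (fun x => q * x - g x) (fun x => q - dg x)); [exact Hxy| |].
    - intros z Hz'. apply (is_derive_minus (fun x => q * x) g).
      + auto_derive; [exact I|ring].
      + apply is_derive_Reals. apply Hdg. apply Rabs_def1; unfold e' in *; lra.
    - intros z Hz'. assert (dg z <= (1 + dg kappa) / 2).
      { destruct (Req_dec z kappa) as [->|Hne]; [lra|].
        specialize (Hd z). simpl in Hd. unfold Rdist in Hd.
        assert (Hzz : Rabs (dg z - dg kappa) < (1 - dg kappa) / 2).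
        { apply Hd. split; [split; [exact I|auto]|]. apply Rabs_def1; unfold e' in *; lra. }
        apply Rabs_def2 in Hzz. lra. }
      pose proof (Rmax_r 0 ((1 + dg kappa) / 2)). fold q in H2. lra. }
  destruct Hcon as [q [e' [Hq [He' Hcon]]]].
  exists g0. split; try assumption.
  - intros eps Heps. destruct (Hlin eps Heps) as [d [Hd H]]. exists (d / 2). split; [lra|].
    intros u Hu. specialize (H u ltac:(lra)). rewrite Hz, Rminus_0_r in H.
    replace (g u - g0 * u) with ((g u / u - g0) * u) by (field; lra).
    rewrite Rabs_mult, (Rabs_pos_eq u) by lra. apply Rmult_le_compat_r; lra.
  - exists th. split; [lra|]. intros M.
    assert (Hdp : 0 < del * Rpower del th) by (apply Rmult_lt_0_compat; [lra|apply exp_pos]).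
    (* Beyond [del] the difference is bounded and [u^(1 + th)] is at least [del^(1 + th)]. *)
    set (C2 := (g (Rabs M) + g0 * Rabs M) / (del * Rpower del th)).
    pose proof (Rabs_pos M) as HM.
    assert (HC2 : 0 <= C2).
    { apply Rdiv_le_0_compat; [|exact Hdp]. specialize (Hnn (Rabs M) HM). nra. }
    exists (C + C2). split; [lra|]. intros u Hu.
    assert (Hpu : 0 < u * Rpower u th) by (apply Rmult_lt_0_compat; [lra|apply exp_pos]).
    destruct (Rle_lt_dec u del) as [H|H].
    + specialize (Hhol u ltac:(lra)).
      replace (g u - g0 * u) with ((g u / u - g0) * u) by (field; lra).
      rewrite Rabs_mult, (Rabs_pos_eq u) by lra.
      apply Rle_trans with (C * Rpower u th * u); [apply Rmult_le_compat_r; lra|]. nra.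
    + assert (HuM : u <= Rabs M) by (pose proof (RRle_abs M); lra).
      assert (Hle : Rabs (g u - g0 * u) <= g (Rabs M) + g0 * Rabs M).
      { specialize (Hmono u (Rabs M) ltac:(lra) HuM). specialize (Hnn u ltac:(lra)). apply Rabs_le. nra. }
      assert (Hp : del * Rpower del th <= u * Rpower u th).
      { apply Rmult_le_compat; [lra|left; apply exp_pos|lra|]. apply Rle_Rpower_l; lra. }
      eapply Rle_trans; [exact Hle|].
      replace (g (Rabs M) + g0 * Rabs M) with (C2 * (del * Rpower del th)) by (unfold C2; field; split; [apply Rgt_not_eq, exp_pos|lra]).
      apply Rle_trans with (C2 * (u * Rpower u th)); [apply Rmult_le_compat_l; lra|].
      apply Rmult_le_compat_r; lra.
  - exists q, e'. split; [exact Hq|]. split; [exact He'|]. intros x y H1 H2 H3. apply Hcon; lra.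
  (* If [g M >= M], the contraction just to the right of [kappa] and the intermediate value theorem
     produce a fixed point above [kappa]. [Rmax 0 x] extends [g] continuously to the whole line. *)
  - intros M HM. apply Rnot_le_lt. intros HgM.
    set (x1 := Rmin M (kappa + e')).
    assert (Hx1 : kappa < x1) by (apply Rmin_glb_lt; lra).
    assert (Hx1M : x1 <= M) by apply Rmin_l. assert (Hx1e : x1 <= kappa + e') by apply Rmin_r.
    assert (Hgx1 : g x1 < x1).
    { specialize (Hcon kappa x1 ltac:(lra) ltac:(lra) Hx1e). rewrite Hgk in Hcon. nra. }
    set (f := fun x => g (Rmax 0 x) - x).
    assert (Hf : continuity f).
    { intros x. apply continuity_pt_minus; [|apply derivable_continuous_pt, derivable_pt_id].
      intros eps Heps. destruct (Hcont (Rmax 0 x) (Rmax_l _ _) eps Heps) as [d [Hd H]].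
      exists d. split; [exact Hd|]. intros y [_ Hy]. simpl in *. unfold Rdist in *.
      apply H; [apply Rmax_l|]. apply Rle_lt_trans with (Rabs (y - x)); [|exact Hy].
      unfold Rmax. destruct (Rle_dec 0 y), (Rle_dec 0 x); split_Rabs; lra. }
    assert (Hpos : forall x, 0 <= x -> f x = g x - x) by (intros x Hx; unfold f; rewrite Rmax_right by exact Hx; reflexivity).
    destruct (IVT_cor f x1 M Hf Hx1M) as [z [Hz1 Hz2]].
    { rewrite !Hpos by lra. nra. }
    rewrite Hpos in Hz2 by lra.
    destruct (proj1 (Hfix z ltac:(lra)) ltac:(lra)); lra.
Qed.

(** * Exponential decay of fronts *)

(** The lattice shift and the delay are merged into one displacement [rho j], an integer plus [c h].
    [la_open] is the form in which the condition on [B] is used: a rate where the sum is finite is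
    never the right end of the domain. *)
Record lattice (D c : R) (b rho : nat -> R) (g : R -> R) (kappa g0 : R) : Prop := {
  la_D : 0 < D;
  la_c : c <> 0;
  la_nonneg : forall j, 0 <= b j;
  la_sum : is_series b 1;
  la_open : forall z, 0 <= z -> exp_sum_finite b rho z -> exists z', z < z' /\ exp_sum_finite b rho z';
  la_reaction : reaction g kappa g0
}.
Arguments la_D {D c b rho g kappa g0} _.
Arguments la_c {D c b rho g kappa g0} _.
Arguments la_nonneg {D c b rho g kappa g0} _.
Arguments la_sum {D c b rho g kappa g0} _.
Arguments la_open {D c b rho g kappa g0} _.
Arguments la_reaction {D c b rho g kappa g0} _.

Record front (D c : R) (b rho : nat -> R) (g : R -> R) (kappa : R) (phi dphi : R -> R) : Prop := {
  fr_pos : forall t, 0 < phi t;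
  fr_bounded : exists M, forall t, phi t <= M;
  fr_minus : forall q, 0 < q -> exists T, forall t, t < T -> phi t < q;
  fr_plus : forall q, 0 < q -> exists T, forall t, T < t -> Rabs (phi t - kappa) < q;
  fr_derive : forall t, is_derive phi t (dphi t);
  fr_eq : forall t, c * dphi t = D * (phi (t + 1) + phi (t - 1) - 2 * phi t) - phi t
                      + Series (fun j => b j * g (phi (t - rho j)))
}.
Arguments fr_pos {D c b rho g kappa phi dphi} _.
Arguments fr_bounded {D c b rho g kappa phi dphi} _.
Arguments fr_minus {D c b rho g kappa phi dphi} _.
Arguments fr_plus {D c b rho g kappa phi dphi} _.
Arguments fr_derive {D c b rho g kappa phi dphi} _.
Arguments fr_eq {D c b rho g kappa phi dphi} _.

Lemma ex_series_nonlinear (D c : R) (b rho : nat -> R) (g : R -> R) (kappa g0 : R) (u : R -> R) (M : R) :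
  lattice D c b rho g kappa g0 -> (forall t, 0 <= u t <= M) ->
  forall t, ex_series (fun j => b j * g (u (t - rho j))).
Proof.
  intros HL Hu t. pose proof (la_reaction HL) as HR.
  assert (Hb : ex_series b) by (exists 1; apply (la_sum HL)).
  apply (ex_series_scal_l (g M)) in Hb. eapply ex_series_le_R; [|exact Hb].
  intros j. unfold scal; simpl; unfold mult; simpl. specialize (Hu (t - rho j)).
  pose proof (la_nonneg HL j).
  pose proof (re_nonneg HR (u (t - rho j)) ltac:(lra)).
  pose proof (re_mono HR (u (t - rho j)) M ltac:(lra) ltac:(lra)).
  rewrite Rabs_pos_eq by (apply Rmult_le_pos; assumption).
  rewrite Rmult_comm. apply Rmult_le_compat_r; assumption.
Qed.

Lemma front_ex_series {D c : R} {b rho : nat -> R} {g : R -> R} {kappa g0 : R} {phi dphi : R -> R} :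
  lattice D c b rho g kappa g0 -> front D c b rho g kappa phi dphi ->
  forall t, ex_series (fun j => b j * g (phi (t - rho j))).
Proof.
  intros HL HF. destruct (fr_bounded HF) as [M HM].
  apply (ex_series_nonlinear D c b rho g kappa g0 phi M HL).
  intros t. split; [left; apply (fr_pos HF)|apply HM].
Qed.

Lemma front_harnack {D c : R} {b rho : nat -> R} {g : R -> R} {kappa g0 : R} {phi dphi : R -> R} (N : nat) :
  lattice D c b rho g kappa g0 -> front D c b rho g kappa phi dphi ->
  exists C, 0 < C /\ forall t s, Rabs s <= INR N -> phi (t + s) <= C * phi t.
Proof.
  intros HL HF. pose proof (la_D HL) as HD.
  destruct (harnack c D (2 * D + 1) N (la_c HL) HD ltac:(lra)) as [C [HC H]].
  exists C. split; [exact HC|]. intros t.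
  pose proof (fr_pos HF) as Hpos.
  assert (Hser : forall t, 0 <= Series (fun j => b j * g (phi (t - rho j)))).
  { intros x. apply Series_nonneg; [|apply (front_ex_series HL HF)].
    intros j. apply Rmult_le_pos; [apply (la_nonneg HL)|].
    apply (re_nonneg (la_reaction HL)). left; apply Hpos. }
  assert (Hin : forall s, D * phi (t + s + 1) + D * phi (t + s - 1) - (2 * D + 1) * phi (t + s) <= c * dphi (t + s)).
  { intros s. rewrite (fr_eq HF). specialize (Hser (t + s)). lra. }
  apply (H (fun s => phi (t + s)) (fun s => dphi (t + s)) (phi t)).
  - left; apply Hpos.
  - intros s. replace (dphi (t + s)) with (1 * dphi (t + s)) by ring.
    apply (is_derive_comp phi (fun s => t + s)); [apply (fr_derive HF)|]. auto_derive; [exact I|ring].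
  - intros s _. specialize (Hin s). pose proof (Hpos t). pose proof (Hpos (t + s - 1)).
    replace (t + (s + 1)) with (t + s + 1) by ring. assert (0 < D * phi (t + s - 1)) by (apply Rmult_lt_0_compat; assumption). lra.
  - intros s _. specialize (Hin s). pose proof (Hpos t). pose proof (Hpos (t + s + 1)).
    replace (t + (s - 1)) with (t + s - 1) by ring. assert (0 < D * phi (t + s + 1)) by (apply Rmult_lt_0_compat; assumption). lra.
  - intros s _. pose proof (Hpos t). pose proof (Hpos (t + s)). lra.
  - rewrite Rplus_0_r. lra.
Qed.

(** Demanded for all [t]; for a bounded front and [z >= 0] it is a condition at [-oo], as
    [exp_decay_of_left] shows. *)
Definition exp_decay (phi : R -> R) (z : R) : Prop := exists K, forall t, phi t <= K * exp (z * t).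

Lemma exp_decay_le {D c : R} {b rho : nat -> R} {g : R -> R} {kappa : R} {phi dphi : R -> R} (z1 z2 : R) :
  front D c b rho g kappa phi dphi -> 0 <= z1 <= z2 -> exp_decay phi z2 -> exp_decay phi z1.
Proof.
  intros HF Hz [K HK]. destruct (fr_bounded HF) as [M HM].
  pose proof (fr_pos HF) as Hpos.
  assert (HM0 : 0 < M) by (specialize (HM 0); specialize (Hpos 0); lra).
  assert (HK0 : 0 <= K). { specialize (HK 0). specialize (Hpos 0). pose proof (exp_pos (z2 * 0)). nra. }
  exists (K + M). intros t. pose proof (exp_pos (z1 * t)). specialize (HK t). specialize (HM t).
  destruct (Rle_lt_dec t 0) as [Ht|Ht].
  - assert (exp (z2 * t) <= exp (z1 * t)) by (apply exp_le; nra).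
    assert (K * exp (z2 * t) <= K * exp (z1 * t)) by (apply Rmult_le_compat_l; assumption).
    assert (0 < M * exp (z1 * t)) by (apply Rmult_lt_0_compat; assumption). lra.
  - assert (1 <= exp (z1 * t)) by (rewrite <- exp_0; apply exp_le; nra).
    assert (M * 1 <= M * exp (z1 * t)) by (apply Rmult_le_compat_l; lra).
    assert (0 <= K * exp (z1 * t)) by (apply Rmult_le_pos; lra). lra.
Qed.

Lemma exp_decay_zero {D c : R} {b rho : nat -> R} {g : R -> R} {kappa : R} {phi dphi : R -> R} :
  front D c b rho g kappa phi dphi -> exp_decay phi 0.
Proof.
  intros HF. destruct (fr_bounded HF) as [M HM]. exists M. intros t.
  rewrite Rmult_0_l, exp_0, Rmult_1_r. apply HM.
Qed.

Lemma exp_decay_of_left {D c : R} {b rho : nat -> R} {g : R -> R} {kappa : R} {phi dphi : R -> R} (z K T : R) :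
  front D c b rho g kappa phi dphi -> 0 <= z -> (forall t, t <= T -> phi t <= K * exp (z * t)) -> exp_decay phi z.
Proof.
  intros HF Hz HK. destruct (fr_bounded HF) as [M HM].
  pose proof (fr_pos HF) as Hpos.
  assert (HM0 : 0 < M) by (specialize (HM 0); specialize (Hpos 0); lra).
  exists (Rabs K + M * exp (- (z * T))). intros t. pose proof (exp_pos (z * t)).
  assert (0 <= Rabs K * exp (z * t)) by (apply Rmult_le_pos; [apply Rabs_pos|lra]).
  assert (0 < M * exp (- (z * T))) by (apply Rmult_lt_0_compat; [exact HM0|apply exp_pos]).
  assert (0 < M * exp (- (z * T)) * exp (z * t)) by (apply Rmult_lt_0_compat; assumption).
  destruct (Rle_lt_dec t T) as [Ht|Ht].
  - specialize (HK t Ht). pose proof (RRle_abs K). assert (K * exp (z * t) <= Rabs K * exp (z * t)) by (apply Rmult_le_compat_r; lra). lra.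
  - specialize (HM t). assert (1 <= exp (- (z * T)) * exp (z * t)) by (rewrite <- exp_plus, <- exp_0; apply exp_le; nra).
    assert (M * 1 <= M * (exp (- (z * T)) * exp (z * t))) by (apply Rmult_le_compat_l; lra). lra.
Qed.

(** Iterating Harnack gives [phi 0 <= C^n phi (- n)], so a front cannot decay faster than at rate
    [ln C]. *)
Lemma exp_decay_bounded_rate {D c : R} {b rho : nat -> R} {g : R -> R} {kappa g0 : R} {phi dphi : R -> R} :
  lattice D c b rho g kappa g0 -> front D c b rho g kappa phi dphi ->
  exists Z, forall z, exp_decay phi z -> z <= Z.
Proof.
  intros HL HF. destruct (front_harnack 1 HL HF) as [C [HC Hh]].
  pose proof (fr_pos HF) as Hpos.
  exists (ln C). intros z [K HK]. apply Rnot_lt_le. intros Hz.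
  set (q := C * exp (- z)).
  assert (Hq : 0 < q < 1).
  { unfold q. split; [apply Rmult_lt_0_compat; [exact HC|apply exp_pos]|].
    rewrite <- (exp_ln C) at 1 by exact HC. rewrite <- exp_plus, <- exp_0. apply exp_increasing. lra. }
  assert (Hn : forall n, phi 0 <= C ^ n * phi (- INR n)).
  { induction n as [|n IH].
    - simpl. rewrite Ropp_0. lra.
    - rewrite S_INR. specialize (Hh (- (INR n + 1)) 1). rewrite Rabs_R1 in Hh. simpl INR in Hh. specialize (Hh (Rle_refl _)).
      replace (- (INR n + 1) + 1) with (- INR n) in Hh by ring.
      assert (0 < C ^ n) by (apply pow_lt; exact HC).
      apply Rle_trans with (C ^ n * phi (- INR n)); [exact IH|]. simpl.
      apply Rle_trans with (C ^ n * (C * phi (- (INR n + 1)))); [apply Rmult_le_compat_l; lra|]. right; ring. }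
  assert (Hqn : forall n, phi 0 <= K * q ^ n).
  { intros n. eapply Rle_trans; [apply Hn|]. assert (0 < C ^ n) by (apply pow_lt; exact HC).
    apply Rle_trans with (C ^ n * (K * exp (z * - INR n))); [apply Rmult_le_compat_l; [lra|apply HK]|].
    right. unfold q. rewrite Rpow_mult_distr.
    replace (exp (z * - INR n)) with (exp (- z) ^ n); [ring|].
    clear. induction n as [|n IH]; [simpl; rewrite Ropp_0, Rmult_0_r, exp_0; reflexivity|].
    rewrite S_INR. simpl. rewrite IH, <- exp_plus. f_equal. ring. }
  assert (HK0 : 0 < K). { specialize (Hqn 0%nat). simpl in Hqn. specialize (Hpos 0). lra. }
  destruct (pow_lt_1_zero q ltac:(rewrite Rabs_pos_eq; lra) (phi 0 / K)) as [N HN]; [apply Rdiv_lt_0_compat; [apply Hpos|exact HK0]|].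
  specialize (HN N (le_n _)). specialize (Hqn N). rewrite Rabs_pos_eq in HN by (apply pow_le; lra).
  apply (Rmult_lt_compat_l K) in HN; [|exact HK0]. replace (K * (phi 0 / K)) with (phi 0) in HN by (field; lra). lra.
Qed.

(* If [A] were negative somewhere it would grow like [exp (- mu t / CA)] at [-oo],
   faster than the a priori bound on [p] permits. *)
Lemma bounded_of_flux (A dA p : R -> R) (T mu CA B eta CH : R) :
  0 < mu -> 0 < CA -> 0 < CH -> eta < mu / CA ->
  (forall t, is_derive A t (dA t)) -> (forall t, 0 <= p t) ->
  (forall t, t <= T -> mu * p t <= dA t) ->
  (forall t, t <= T -> Rabs (A t) <= CA * p t) ->
  (forall t, t <= T -> p t <= B * exp (- eta * t)) ->
  (forall t s, Rabs s <= 1 -> p (t + s) <= CH * p t) ->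
  exists K, forall t, t <= T -> p t <= K.
Proof.
  intros Hmu HCA HCH Heta HA Hp HdA HAp HB Hh.
  set (k := mu / CA) in *.
  assert (HAnn : forall t, t <= T -> 0 <= A t).
  { intros t0 Ht0. apply Rnot_lt_le. intros Hneg.
    assert (Hy : forall t, t <= t0 -> A t * exp (k * t) <= A t0 * exp (k * t0)).
    { intros t Ht. apply (is_derive_nonneg_le (fun t => A t * exp (k * t)) (fun t => (dA t + k * A t) * exp (k * t))); [exact Ht| |].
      - intros x _. auto_derive; [exists (dA x); apply HA|].
        replace (Derive (fun x => A x) x) with (dA x) by (symmetry; apply is_derive_unique; apply HA). ring.
      - intros x Hx. apply Rmult_le_pos; [|left; apply exp_pos].
        specialize (HdA x ltac:(lra)). specialize (HAp x ltac:(lra)). apply Rabs_le_between in HAp.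
        assert (0 < k) by (apply Rdiv_lt_0_compat; lra).
        assert (k * (CA * p x) = mu * p x) by (unfold k; field; lra).
        assert (k * (- (CA * p x)) <= k * A x) by (apply Rmult_le_compat_l; lra). lra. }
    set (Y := - (A t0 * exp (k * t0))).
    assert (HY : 0 < Y). { unfold Y. pose proof (exp_pos (k * t0)). nra. }
    destruct (exp_ge_eventually (k - eta) ((CA * Rabs B + 1) / Y)) as [T1 [HT10 HT1]]; [lra|].
    set (t := Rmin t0 (- T1)). assert (t <= t0) by apply Rmin_l. assert (t <= - T1) by apply Rmin_r.
    specialize (HT1 (- t) ltac:(lra)). specialize (Hy t H). specialize (HAp t ltac:(lra)). specialize (HB t ltac:(lra)).
    apply Rabs_le_between in HAp.
    assert (E1 : exp ((k - eta) * - t) * exp (k * t) = exp (eta * t)) by (rewrite <- exp_plus; f_equal; ring).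
    assert (E2 : exp (- eta * t) * exp (eta * t) = 1) by (rewrite <- exp_plus, <- exp_0; f_equal; ring).
    pose proof (exp_pos (k * t)). pose proof (exp_pos (eta * t)). pose proof (exp_pos (- eta * t)).
    pose proof (exp_pos ((k - eta) * - t)).
    apply (Rmult_le_compat_l Y) in HT1; [|lra]. replace (Y * ((CA * Rabs B + 1) / Y)) with (CA * Rabs B + 1) in HT1 by (field; lra).
    assert (H5 : Y * exp ((k - eta) * - t) <= CA * Rabs B).
    { assert (H6 : Y <= CA * Rabs B * (exp (- eta * t) * exp (k * t))).
      { assert (Y <= - A t * exp (k * t)) by (unfold Y; lra).
        assert (p t <= Rabs B * exp (- eta * t)).
        { eapply Rle_trans; [exact HB|]. apply Rmult_le_compat_r; [lra|apply RRle_abs]. }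
        assert (CA * p t <= CA * (Rabs B * exp (- eta * t))) by (apply Rmult_le_compat_l; lra).
        assert (- A t * exp (k * t) <= CA * (Rabs B * exp (- eta * t)) * exp (k * t)) by (apply Rmult_le_compat_r; lra). lra. }
      apply (Rmult_le_compat_r (exp ((k - eta) * - t))) in H6; [|lra].
      replace (CA * Rabs B * (exp (- eta * t) * exp (k * t)) * exp ((k - eta) * - t))
        with (CA * Rabs B * (exp (- eta * t) * (exp ((k - eta) * - t) * exp (k * t)))) in H6 by ring.
      rewrite E1, E2 in H6. lra. }
    lra. }
  exists (CH * (A T / mu)). intros t Ht.
  (* With [0 <= A <= A T], the increase over a unit interval bounds [mu p] at some point of it, and
     Harnack transfers this to [t]. *)
  destruct (MVT_cor2 A dA (t - 1) t) as [x [Hx1 Hx2]]; [lra|intros x _; apply is_derive_Reals; apply HA|].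
  replace (t - (t - 1)) with 1 in Hx1 by ring.
  assert (A t <= A T).
  { apply (is_derive_nonneg_le A dA); [exact Ht|intros; apply HA|]. intros y Hy. specialize (HdA y ltac:(lra)).
    specialize (Hp y). assert (0 <= mu * p y) by (apply Rmult_le_pos; lra). lra. }
  specialize (HAnn (t - 1) ltac:(lra)). specialize (HdA x ltac:(lra)).
  specialize (Hh x (t - x) ltac:(apply Rabs_le; lra)). replace (x + (t - x)) with t in Hh by ring.
  eapply Rle_trans; [exact Hh|]. apply Rmult_le_compat_l; [lra|].
  apply (Rmult_le_reg_l mu); [exact Hmu|]. replace (mu * (A T / mu)) with (A T) by (field; lra). lra.
Qed.

(** * Improving the decay rate where the characteristic function is positive *)

Definition cons2 (u v : R) (x : nat -> R) (j : nat) : R :=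
  match j with O => u | S O => v | S (S n) => x n end.

Lemma is_series_cons2 (u v : R) (x : nat -> R) (l : R) :
  is_series x l -> is_series (cons2 u v x) (u + (v + l)).
Proof.
  intros H.
  assert (H1 : is_series (fun n => cons2 u v x (S n)) (v + l)).
  { replace (v + l) with (plus l (cons2 u v x 1%nat)) by (unfold plus; simpl; ring).
    apply (is_series_decr_1 (fun n => cons2 u v x (S n))). simpl. unfold plus; simpl. unfold opp; simpl.
    replace (l + v + - v) with l by ring. exact H. }
  replace (u + (v + l)) with (plus (v + l) (cons2 u v x 0%nat)) by (unfold plus; simpl; ring).
  apply is_series_decr_1. unfold plus, opp; simpl. replace (v + l + u + - u) with (v + l) by ring. exact H1.
Qed.

Lemma is_series_truncated (x : nat -> R) (N : nat) :
  is_series (fun n => if (n <=? N)%nat then x n else 0) (sum_f_R0 x N).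
Proof.
  set (y := fun n => if (n <=? N)%nat then x n else 0).
  apply is_series_Reals. intros eps Heps. exists N. intros n Hn.
  assert (H : sum_f_R0 y n = sum_f_R0 x N).
  { induction Hn as [|n Hn IH].
    - apply sum_eq. intros i Hi. unfold y. apply Nat.leb_le in Hi. rewrite Hi; reflexivity.
    - rewrite tech5, IH. unfold y. replace (S n <=? N)%nat with false; [ring|].
      symmetry. apply Nat.leb_gt. lia. }
  change (Rdist (sum_f_R0 y n) (sum_f_R0 x N) < eps). rewrite H. unfold Rdist. rewrite Rminus_diag, Rabs_R0. exact Heps.
Qed.

Lemma continuity_finite_exp_sum (b rho : nat -> R) (N : nat) :
  continuity (fun y => sum_f_R0 (fun n => b n * exp (- (y * rho n))) N).
Proof.
  assert (H : forall n, continuity (fun y => b n * exp (- (y * rho n)))).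
  { intros n y. apply continuity_pt_filterlim. apply (ex_derive_continuous (fun y => b n * exp (- (y * rho n)))).
    auto_derive; exact I. }
  induction N as [|N IH]; [apply H|].
  intros y. apply (continuity_pt_plus (fun y => sum_f_R0 (fun n => b n * exp (- (y * rho n))) N)); [apply IH|apply H].
Qed.

Lemma finite_abs_bound (rho : nat -> R) (N : nat) : exists K, 1 <= K /\ forall n, (n <= N)%nat -> Rabs (rho n) <= K.
Proof.
  induction N as [|N [K [HK IH]]].
  - exists (1 + Rabs (rho 0%nat)). pose proof (Rabs_pos (rho 0%nat)). split; [lra|]. intros n Hn. replace n with 0%nat by lia. lra.
  - exists (K + Rabs (rho (S N))). pose proof (Rabs_pos (rho (S N))). split; [lra|].
    intros n Hn. destruct (Nat.eq_dec n (S N)) as [->|Hne]; [lra|]. specialize (IH n ltac:(lia)). lra.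
Qed.

Lemma sum_le_Series (x : nat -> R) (N : nat) : (forall j, 0 <= x j) -> ex_series x -> sum_f_R0 x N <= Series x.
Proof.
  intros Hx He. rewrite (Series_incr_n x (S N)); [|lia|exact He]. simpl pred.
  assert (0 <= Series (fun k => x (S N + k)%nat)); [|lra].
  apply Series_nonneg; [intros; apply Hx|]. apply (ex_series_incr_n x (S N)); exact He.
Qed.

Lemma scal_sum_l (x : nat -> R) (N : nat) (k : R) : k * sum_f_R0 x N = sum_f_R0 (fun n => k * x n) N.
Proof. rewrite scal_sum. apply sum_eq. intros; ring. Qed.

Lemma exists_nat_ge (x : R) : exists N, x <= INR N.
Proof.
  destruct (nfloor_ex (Rabs x) (Rabs_pos x)) as [n [_ Hn]]. exists (S n). rewrite S_INR.
  pose proof (RRle_abs x). lra.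
Qed.

(** For [p = phi exp (- z' t)] with [z'] slightly above [zs], the flux satisfies [A' >= mu p] and,
    by Harnack, [|A| <= CA p]; then [bounded_of_flux] bounds [p]. The sum is cut at [N] and the
    slope lowered to [q < g0] because its finiteness at [zs] is not known yet: [front_rate] derives
    it from this lemma. It matters that [eta] is chosen before [z], since [z] approaches [zs] from
    below. *)
Lemma decay_improve {D c : R} {b rho : nat -> R} {g : R -> R} {kappa g0 : R} {phi dphi : R -> R} (zs q : R) (N : nat) :
  lattice D c b rho g kappa g0 -> front D c b rho g kappa phi dphi ->
  0 <= zs -> 0 < q < g0 ->
  0 < - c * zs + D * (exp zs + exp (- zs) - 2) - 1 + q * sum_f_R0 (fun n => b n * exp (- (zs * rho n))) N ->
  exists eta, 0 < eta /\ forall z, 0 <= z -> zs - eta < z <= zs -> exp_decay phi z -> exp_decay phi (zs + eta).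
Proof.
  intros HL HF Hzs Hq Hchi.
  set (chi := fun y => - c * y + D * (exp y + exp (- y) - 2) - 1 + q * sum_f_R0 (fun n => b n * exp (- (y * rho n))) N).
  change (0 < chi zs) in Hchi.
  pose proof (la_D HL) as HD. pose proof (la_c HL) as Hc.
  pose proof (la_nonneg HL) as Hb. pose proof (la_sum HL) as Hsum.
  pose proof (la_reaction HL) as HR.
  pose proof (fr_pos HF) as Hpos.
  destruct (fr_bounded HF) as [M HM].
  assert (HM0 : 0 < M) by (specialize (HM 0); specialize (Hpos 0); lra).
  assert (Hcont : continuity_pt chi zs).
  { unfold chi. apply continuity_pt_plus.
    - apply continuity_pt_filterlim. apply (ex_derive_continuous (fun y => - c * y + D * (exp y + exp (- y) - 2) - 1)).
      auto_derive; repeat split.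
    - apply continuity_pt_scal. apply continuity_finite_exp_sum. }
  set (mu := chi zs / 2).
  destruct (Hcont mu ltac:(unfold mu; lra)) as [d [Hd Hchid]].
  destruct (finite_abs_bound rho N) as [Rr [HR1 HRho]].
  destruct (exists_nat_ge Rr) as [N' HN'].
  destruct (front_harnack N' HL HF) as [CH0 [HCH0 Hharn0]].
  set (Ez := exp ((zs + 1) * Rr)). assert (HEz : 0 < Ez) by apply exp_pos.
  set (CH := CH0 * Ez). assert (HCH : 0 < CH) by (apply Rmult_lt_0_compat; assumption).
  set (sm := D * exp (zs + 1) + D + q * Ez).
  assert (Hsm : 0 < sm).
  { unfold sm. assert (0 < D * exp (zs + 1)) by (apply Rmult_lt_0_compat; [exact HD|apply exp_pos]).
    assert (0 < q * Ez) by (apply Rmult_lt_0_compat; lra). lra. }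
  set (CA := Rabs c + sm * (CH * Rr)).
  assert (HCA : 0 < CA).
  { unfold CA. pose proof (Rabs_pos c). assert (0 < sm * (CH * Rr)) by (repeat apply Rmult_lt_0_compat; lra). lra. }
  assert (Hk : 0 < mu / CA) by (apply Rdiv_lt_0_compat; unfold mu; lra).
  (* [d / 2] keeps [chi z' >= mu]; 1 keeps the constants uniform in [z']; the last bound gives
     [z' - z < 2 eta < mu / CA], as [bounded_of_flux] requires. *)
  set (eta := Rmin (d / 2) (Rmin 1 (mu / CA / 4))).
  assert (Heta : 0 < eta) by (repeat apply Rmin_glb_lt; lra).
  assert (Heta1 : eta <= d / 2) by apply Rmin_l.
  assert (Heta2 : eta <= 1) by (unfold eta; eapply Rle_trans; [apply Rmin_r|apply Rmin_l]).
  assert (Heta3 : eta <= mu / CA / 4) by (unfold eta; eapply Rle_trans; [apply Rmin_r|apply Rmin_r]).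
  clearbody eta. exists eta. split; [exact Heta|]. intros z Hz0 Hz [K HK].
  set (z' := zs + eta).
  assert (Hz'chi : mu <= chi z').
  { specialize (Hchid z'). simpl in Hchid. unfold Rdist in Hchid.
    assert (Hx : Rabs (chi z' - chi zs) < mu).
    { apply Hchid. split; [split; [exact I|unfold z'; lra]|]. unfold z'. apply Rabs_def1; lra. }
    apply Rabs_def2 in Hx. unfold mu in *. lra. }
  assert (Hz' : 0 < z' <= zs + 1) by (unfold z'; lra).
  set (p := fun t => phi t * exp (- (z' * t))).
  set (dp := fun t => (dphi t - z' * phi t) * exp (- (z' * t))).
  assert (Hdp : forall t, is_derive p t (dp t)).
  { intros t. unfold p, dp. auto_derive; [exists (dphi t); apply (fr_derive HF)|].
    replace (Derive (fun x => phi x) t) with (dphi t) by (symmetry; apply is_derive_unique; apply (fr_derive HF)). ring. }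
  assert (Hp : forall t, 0 < p t) by (intros t; unfold p; apply Rmult_lt_0_compat; [apply Hpos|apply exp_pos]).
  destruct (exists_primitive p) as [P [HP0 HP]].
  { intros t. apply (ex_derive_continuous p t). exists (dp t). apply Hdp. }
  assert (Hharn : forall t s, Rabs s <= Rr -> p (t + s) <= CH * p t).
  { intros t s Hs. unfold p, CH.
    replace (- (z' * (t + s))) with (- (z' * t) + - (z' * s)) by ring. rewrite exp_plus.
    assert (H1 : exp (- (z' * s)) <= Ez).
    { apply exp_le. apply Rle_trans with (z' * Rr); [|apply Rmult_le_compat_r; lra].
      apply Rabs_le_between in Hs. assert (z' * - s <= z' * Rr) by (apply Rmult_le_compat_l; lra). lra. }
    specialize (Hharn0 t s ltac:(lra)).
    replace (CH0 * Ez * (phi t * exp (- (z' * t)))) with (CH0 * phi t * (exp (- (z' * t)) * Ez)) by ring.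
    pose proof (exp_pos (- (z' * t))). pose proof (exp_pos (- (z' * s))).
    apply Rmult_le_compat; [left; apply Hpos|left; apply Rmult_lt_0_compat; assumption|exact Hharn0|].
    apply Rmult_le_compat_l; lra. }
  set (tr := fun x : nat -> R => fun n => if (n <=? N)%nat then x n else 0).
  set (a := cons2 (D * exp z') (D * exp (- z')) (tr (fun n => q * (b n * exp (- (z' * rho n)))))).
  set (r := cons2 (-1) 1 rho).
  assert (Han : forall j, 0 <= a j).
  { intros [|[|n]]; unfold a, cons2, tr.
    - left; apply Rmult_lt_0_compat; [exact HD|apply exp_pos].
    - left; apply Rmult_lt_0_compat; [exact HD|apply exp_pos].
    - destruct (n <=? N)%nat; [|lra]. repeat apply Rmult_le_pos; try lra; [apply Hb|left; apply exp_pos]. }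
  assert (Haser : forall x : nat -> R, is_series (fun j => a j * x j)
     (D * exp z' * x 0%nat + (D * exp (- z') * x 1%nat + sum_f_R0 (fun n => q * (b n * exp (- (z' * rho n))) * x (S (S n))) N))).
  { intros x. eapply is_series_ext; [|apply is_series_cons2, is_series_truncated].
    intros [|[|n]]; unfold a, cons2, tr; try reflexivity. destruct (n <=? N)%nat; [reflexivity|symmetry; apply Rmult_0_l]. }
  assert (HKa : kernel a r (z' + 1)).
  { split; [lra|exact Han|]. eexists. apply Haser. }
  assert (HpG : forall t, Rabs (p t) <= M * exp (z' * Rabs t)).
  { intros t. rewrite Rabs_pos_eq by (left; apply Hp). unfold p. pose proof (exp_pos (- (z' * t))).
    apply Rmult_le_compat; [left; apply Hpos|lra|apply HM|]. apply exp_le.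
    pose proof (Rabs_pos t). assert (- t <= Rabs t) by (rewrite <- Rabs_Ropp; apply RRle_abs).
    assert (z' * - t <= z' * Rabs t) by (apply Rmult_le_compat_l; lra). lra. }
  set (A := flux c a r p P).
  set (dA := fun t => c * dp t + Series (fun j => a j * (p t - p (t - r j)))).
  assert (HA : forall t, is_derive A t (dA t)).
  { intros t. apply (is_derive_flux c a r (z' + 1) z' M p dp P t HKa ltac:(lra) HP Hdp HpG). }
  destruct (re_linear HR (g0 - q) ltac:(lra)) as [u0 [Hu0 Hlin]].
  destruct (fr_minus HF u0 Hu0) as [T0 HT0].
  set (T := T0 - Rr - 1).
  assert (HdA : forall t, t <= T -> mu * p t <= dA t).
  { intros t Ht. unfold dA. rewrite (is_series_unique _ _ (Haser (fun j => p t - p (t - r j)))).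
    unfold r, cons2. replace (t - -1) with (t + 1) by ring.
    assert (E1 : exp z' * p (t + 1) = phi (t + 1) * exp (- (z' * t))).
    { unfold p. replace (- (z' * (t + 1))) with (- (z' * t) + - z') by ring. rewrite exp_plus, (exp_Ropp z').
      pose proof (exp_pos z'). field. lra. }
    assert (E2 : exp (- z') * p (t - 1) = phi (t - 1) * exp (- (z' * t))).
    { unfold p. replace (- (z' * (t - 1))) with (- (z' * t) + z') by ring. rewrite exp_plus, (exp_Ropp z').
      pose proof (exp_pos z'). field. lra. }
    assert (E3 : sum_f_R0 (fun n => q * (b n * exp (- (z' * rho n))) * (p t - p (t - rho n))) N
        = q * sum_f_R0 (fun n => b n * exp (- (z' * rho n))) N * p t
          - exp (- (z' * t)) * sum_f_R0 (fun n => b n * (q * phi (t - rho n))) N).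
    { assert (HE3 : forall n, q * (b n * exp (- (z' * rho n))) * (p t - p (t - rho n)) =
        q * p t * (b n * exp (- (z' * rho n))) - exp (- (z' * t)) * (b n * (q * phi (t - rho n)))).
      { intros n. assert (exp (- (z' * rho n)) * p (t - rho n) = phi (t - rho n) * exp (- (z' * t))).
        { unfold p. replace (- (z' * t)) with (- (z' * rho n) + - (z' * (t - rho n))) by ring. rewrite exp_plus. ring. }
        replace (q * (b n * exp (- (z' * rho n))) * (p t - p (t - rho n))) with
          (q * p t * (b n * exp (- (z' * rho n))) - q * b n * (exp (- (z' * rho n)) * p (t - rho n))) by ring.
        rewrite H. ring. }
      rewrite (sum_eq _ (fun n => q * p t * (b n * exp (- (z' * rho n))) - exp (- (z' * t)) * (b n * (q * phi (t - rho n)))) N)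
        by (intros; apply HE3).
      rewrite minus_sum, <- !scal_sum_l. ring. }
    assert (HS : sum_f_R0 (fun n => b n * (q * phi (t - rho n))) N <= Series (fun j => b j * g (phi (t - rho j)))).
    { eapply Rle_trans; [|apply (sum_le_Series _ N)].
      - apply sum_Rle. intros n Hn. apply Rmult_le_compat_l; [apply Hb|].
        specialize (HRho n Hn). apply Rabs_le_between in HRho.
        assert (Hsm' : phi (t - rho n) < u0) by (apply HT0; unfold T in Ht; lra).
        pose proof (Hpos (t - rho n)).
        specialize (Hlin (phi (t - rho n)) ltac:(lra)). apply Rabs_le_between in Hlin. lra.
      - intros j. apply Rmult_le_pos; [apply Hb|apply (re_nonneg HR); left; apply Hpos].
      - apply (front_ex_series HL HF). }
    rewrite E3.
    assert (E4 : c * dp t = (D * (phi (t + 1) + phi (t - 1) - 2 * phi t) - phi t + Series (fun j => b j * g (phi (t - rho j)))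
        - c * z' * phi t) * exp (- (z' * t))).
    { unfold dp. rewrite <- (fr_eq HF t). ring. }
    rewrite E4.
    (* The derivative of the flux equals [chi z' p] plus what truncation and the lowered slope have
       discarded, which is nonnegative. *)
    assert (E5 : chi z' * p t + exp (- (z' * t)) * (Series (fun j => b j * g (phi (t - rho j))) - sum_f_R0 (fun n => b n * (q * phi (t - rho n))) N)
      = (D * (phi (t + 1) + phi (t - 1) - 2 * phi t) - phi t + Series (fun j => b j * g (phi (t - rho j)))
        - c * z' * phi t) * exp (- (z' * t)) +
        (D * exp z' * (p t - p (t + 1)) + (D * exp (- z') * (p t - p (t - 1)) +
         (q * sum_f_R0 (fun n => b n * exp (- (z' * rho n))) N * p t
          - exp (- (z' * t)) * sum_f_R0 (fun n => b n * (q * phi (t - rho n))) N)))).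
    { replace (D * exp z' * (p t - p (t + 1))) with (D * exp z' * p t - D * (exp z' * p (t + 1))) by ring.
      replace (D * exp (- z') * (p t - p (t - 1))) with (D * exp (- z') * p t - D * (exp (- z') * p (t - 1))) by ring.
      rewrite E1, E2. unfold chi, p. ring. }
    rewrite <- E5.
    assert (mu * p t <= chi z' * p t) by (apply Rmult_le_compat_r; [left; apply Hp|exact Hz'chi]).
    assert (0 <= exp (- (z' * t)) * (Series (fun j => b j * g (phi (t - rho j))) - sum_f_R0 (fun n => b n * (q * phi (t - rho n))) N)).
    { apply Rmult_le_pos; [left; apply exp_pos|lra]. }
    lra. }
  assert (HAp : forall t, t <= T -> Rabs (A t) <= CA * p t).
  { intros t _. unfold A, flux.
    set (X := CH * Rr * p t).
    assert (HX : 0 < X) by (apply (Rmult_lt_0_compat (CH * Rr)); [apply Rmult_lt_0_compat; lra|apply Hp]).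
    assert (HPX : forall x, Rabs x <= Rr -> Rabs (P t - P (t - x)) <= X).
    { intros x Hx. eapply Rle_trans.
      - apply (derivative_bound_lipschitz P p (t - x) t (CH * p t)); [intros; apply HP|].
        intros y Hy. rewrite Rabs_pos_eq by (left; apply Hp).
        replace y with (t + (y - t)) by ring. apply Hharn.
        eapply Rle_trans; [|exact Hx]. unfold Rmin, Rmax in Hy. destruct (Rle_dec (t - x) t); split_Rabs; lra.
      - replace (t - (t - x)) with x by ring. unfold X. replace (CH * Rr * p t) with (CH * p t * Rr) by ring.
        apply Rmult_le_compat_l; [left; apply Rmult_lt_0_compat; [exact HCH|apply Hp]|exact Hx]. }
    pose proof (Haser (fun _ => X)) as Hs1.
    assert (HS : Rabs (Series (fun j => a j * (P t - P (t - r j)))) <= sm * X).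
    { apply Rle_trans with (Series (fun j => a j * X)).
      - apply Series_abs_le; [|eexists; exact Hs1].
        intros j. rewrite Rabs_mult, (Rabs_pos_eq (a j)) by apply Han.
        assert (Hcase : a j = 0 \/ Rabs (r j) <= Rr).
        { destruct j as [|[|n]]; unfold a, r, cons2, tr.
          - right. rewrite Rabs_left by lra. lra.
          - right. rewrite Rabs_R1. lra.
          - destruct (n <=? N)%nat eqn:E; [right|left; reflexivity]. apply HRho. apply Nat.leb_le; exact E. }
        destruct Hcase as [H0|H0]; [rewrite H0; lra|]. apply Rmult_le_compat_l; [apply Han|apply HPX; exact H0].
      - rewrite (is_series_unique _ _ Hs1).
        assert (F1 : exp z' <= exp (zs + 1)) by (apply exp_le; lra).
        assert (F2 : exp (- z') <= 1) by (rewrite <- exp_0; apply exp_le; lra).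
        assert (F3 : sum_f_R0 (fun n => q * (b n * exp (- (z' * rho n))) * X) N <= q * Ez * X).
        { apply Rle_trans with (sum_f_R0 (fun n => q * Ez * X * b n) N).
          - apply sum_Rle. intros n Hn.
            assert (exp (- (z' * rho n)) <= Ez).
            { apply exp_le. specialize (HRho n Hn). apply Rabs_le_between in HRho.
              assert (z' * - rho n <= z' * Rr) by (apply Rmult_le_compat_l; lra).
              assert (z' * Rr <= (zs + 1) * Rr) by (apply Rmult_le_compat_r; lra). lra. }
            replace (q * (b n * exp (- (z' * rho n))) * X) with (q * X * b n * exp (- (z' * rho n))) by ring.
            replace (q * Ez * X * b n) with (q * X * b n * Ez) by ring.
            apply Rmult_le_compat_l; [|assumption]. specialize (Hb n).
            apply Rmult_le_pos; [apply Rmult_le_pos; lra|exact Hb].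
          - rewrite <- scal_sum_l.
            assert (sum_f_R0 b N <= 1).
            { rewrite <- (is_series_unique _ _ Hsum). apply sum_le_Series; [exact Hb|exists 1; exact Hsum]. }
            rewrite <- (Rmult_1_r (q * Ez * X)) at 2. apply Rmult_le_compat_l; [|assumption].
            apply Rmult_le_pos; [apply Rmult_le_pos; lra|lra]. }
        assert (F4 : D * exp z' * X <= D * exp (zs + 1) * X) by (apply Rmult_le_compat_r; [lra|]; apply Rmult_le_compat_l; lra).
        assert (F5 : D * exp (- z') * X <= D * 1 * X) by (apply Rmult_le_compat_r; [lra|]; apply Rmult_le_compat_l; lra).
        unfold sm. lra. }
    eapply Rle_trans; [apply Rabs_triang|]. rewrite Rabs_mult, (Rabs_pos_eq (p t)) by (left; apply Hp).
    unfold CA. replace ((Rabs c + sm * (CH * Rr)) * p t) with (Rabs c * p t + sm * X) by (unfold X; ring). lra. }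
  destruct (bounded_of_flux A dA p T mu CA K (z' - z) CH) as [K' HK']; try assumption.
  - unfold mu; lra.
  - unfold z'; lra.
  - intros t; left; apply Hp.
  - intros t _. unfold p. replace (- (z' - z) * t) with (z * t + - (z' * t)) by ring. rewrite exp_plus, <- Rmult_assoc.
    apply Rmult_le_compat_r; [left; apply exp_pos|apply HK].
  - intros t s Hs. apply Hharn. lra.
  - apply (exp_decay_of_left _ K' T HF); [lra|].
    intros t Ht. specialize (HK' t Ht). unfold p in HK'.
    apply (Rmult_le_compat_r (exp (z' * t))) in HK'; [|left; apply exp_pos].
    rewrite Rmult_assoc, <- exp_plus in HK'. replace (- (z' * t) + z' * t) with 0 in HK' by ring. rewrite exp_0 in HK'. lra.
Qed.

(** Right side minus left side of the equation linearised at 0, tested on [exp (z t)]: negative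
    where that exponential is a strict supersolution. *)
Definition char_fun (D c : R) (b rho : nat -> R) (g0 z : R) : R :=
  - c * z + D * (exp z + exp (- z) - 2) - 1 + g0 * Series (fun j => b j * exp (- (z * rho j))).

Lemma is_derive_global_min (f : R -> R) (t l : R) :
  is_derive f t l -> (forall x, f t <= f x) -> l = 0.
Proof.
  intros Hd Hmin. apply is_derive_Reals in Hd.
  pose (pr := exist _ l Hd : derivable_pt f t).
  assert (H : derive_pt f t pr = 0).
  { apply (deriv_minimum f (t - 1) (t + 1) t pr); [lra|lra|]. intros; apply Hmin. }
  exact H.
Qed.

(** [A exp (z' t) + nu exp (z t)] is a strict supersolution even for the slope [g0 + del]. If the
    front exceeded it, the maximal ratio [m > 1] would be attained, since [phi] decays faster than
    [exp (z t)]; at that point the multiple [m v] touches [phi] from above, against the equation.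
    Letting [nu] tend to 0 leaves [A exp (z' t)]. *)
Lemma decay_barrier {D c : R} {b rho : nat -> R} {g : R -> R} {kappa g0 : R} {phi dphi : R -> R} (z z' y : R) :
  lattice D c b rho g kappa g0 -> front D c b rho g kappa phi dphi ->
  0 <= z -> z < z' -> exp_sum_finite b rho z -> exp_sum_finite b rho z' ->
  char_fun D c b rho g0 z < 0 -> char_fun D c b rho g0 z' < 0 ->
  z < y -> exp_decay phi y -> exp_decay phi z'.
Proof.
  intros HL HF Hz Hzz' HFz HFz' Hchi Hchi' Hzy [K HK].
  pose proof (la_D HL) as HD.
  pose proof (la_nonneg HL) as Hb.
  pose proof (la_reaction HL) as HR. pose proof (re_g0 HR) as Hg0.
  pose proof (fr_pos HF) as Hpos.
  destruct (fr_bounded HF) as [M HM].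
  assert (HM0 : 0 < M) by (specialize (HM 0); specialize (Hpos 0); lra).
  set (E := fun z => Series (fun j => b j * exp (- (z * rho j)))).
  assert (HE : forall x, exp_sum_finite b rho x -> 0 <= E x).
  { intros x Hx. apply Series_nonneg; [|exact Hx]. intros j. apply Rmult_le_pos; [apply Hb|left; apply exp_pos]. }
  pose proof (HE z HFz) as HEz. pose proof (HE z' HFz') as HEz'.
  (* Strictness of both signs leaves room to raise the slope, so that [g u <= (g0 + del) u] holds
     for small [u]. *)
  assert (Hdel : exists del, 0 < del /\ char_fun D c b rho g0 z + del * E z < 0 /\ char_fun D c b rho g0 z' + del * E z' < 0).
  { set (d1 := - char_fun D c b rho g0 z / (E z + 1)). set (d2 := - char_fun D c b rho g0 z' / (E z' + 1)).
    assert (H1 : 0 < d1) by (apply Rdiv_lt_0_compat; lra). assert (H2 : 0 < d2) by (apply Rdiv_lt_0_compat; lra).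
    assert (H3 : d1 * (E z + 1) = - char_fun D c b rho g0 z) by (unfold d1; field; lra).
    assert (H4 : d2 * (E z' + 1) = - char_fun D c b rho g0 z') by (unfold d2; field; lra).
    pose proof (Rmin_l d1 d2). pose proof (Rmin_r d1 d2).
    exists (Rmin d1 d2). split; [apply Rmin_glb_lt; assumption|].
    assert (Rmin d1 d2 * E z <= d1 * E z) by (apply Rmult_le_compat_r; lra).
    assert (Rmin d1 d2 * E z' <= d2 * E z') by (apply Rmult_le_compat_r; lra). split; lra. }
  destruct Hdel as [del [Hdel [Hc1 Hc2]]].
  set (q := g0 + del).
  destruct (re_linear HR del Hdel) as [u0 [Hu0 Hlin]].
  destruct (fr_minus HF u0 Hu0) as [T0 HT0].
  pose proof (re_nonneg HR M ltac:(lra)) as HgM.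
  set (A := (M + g M) * exp (- (z' * T0))).
  assert (HA : 0 < A) by (apply Rmult_lt_0_compat; [lra|apply exp_pos]).
  assert (HAright : forall t, T0 <= t -> M + g M <= A * exp (z' * t)).
  { intros t Ht. unfold A. rewrite Rmult_assoc, <- exp_plus.
    assert (1 <= exp (- (z' * T0) + z' * t)) by (rewrite <- exp_0; apply exp_le; nra).
    rewrite <- (Rmult_1_r (M + g M)) at 1. apply Rmult_le_compat_l; lra. }
  assert (HK0 : 0 < K). { specialize (HK 0). specialize (Hpos 0). pose proof (exp_pos (y * 0)). nra. }
  assert (Hnu : forall nu, 0 < nu -> forall t, phi t <= A * exp (z' * t) + nu * exp (z * t)).
  { intros nu Hnu t1. apply Rnot_lt_le. intros Hlt.
    set (v := fun t => A * exp (z' * t) + nu * exp (z * t)) in *.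
    change (v t1 < phi t1) in Hlt.
    assert (Hv : forall t, 0 < v t).
    { intros t. unfold v. pose proof (exp_pos (z' * t)). pose proof (exp_pos (z * t)).
      assert (0 < A * exp (z' * t)) by (apply Rmult_lt_0_compat; assumption).
      assert (0 < nu * exp (z * t)) by (apply Rmult_lt_0_compat; assumption). lra. }
    assert (Hdv : forall t, is_derive v t (A * (z' * exp (z' * t)) + nu * (z * exp (z * t)))).
    { intros t. unfold v. auto_derive; [exact I|ring]. }
    destruct (exp_ge_eventually (y - z) (K / nu)) as [T1 [HT10 HT1]]; [lra|].
    destruct (continuous_max_attained (fun t => phi t / v t) 1 (Rmax (Rabs T0) T1) t1) as [t0 [Ht0 Hmax]].
    - intros t. apply (ex_derive_continuous (fun t => phi t / v t)).
      apply (ex_derive_div phi v); [exists (dphi t); apply (fr_derive HF)|eexists; apply Hdv|specialize (Hv t); lra].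
    - intros t Ht. specialize (Hv t). apply (Rmult_le_reg_r (v t)); [exact Hv|].
      replace (phi t / v t * v t) with (phi t) by (field; lra). rewrite Rmult_1_l.
      pose proof (Rmax_l (Rabs T0) T1). pose proof (Rmax_r (Rabs T0) T1).
      destruct (Rle_lt_dec T0 t) as [H1|H1].
      + specialize (HAright t H1). specialize (HM t). unfold v.
        assert (0 < nu * exp (z * t)) by (apply Rmult_lt_0_compat; [exact Hnu|apply exp_pos]). lra.
      + assert (t <= - T1).
        { destruct (Rle_lt_dec 0 t) as [H2|H2]; [|rewrite (Rabs_left t) in Ht by lra; lra].
          rewrite (Rabs_pos_eq t) in Ht by lra. pose proof (RRle_abs T0). lra. }
        specialize (HT1 (- t) ltac:(lra)).
        apply (Rmult_le_compat_l nu) in HT1; [|lra]. replace (nu * (K / nu)) with K in HT1 by (field; lra).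
        eapply Rle_trans; [apply HK|].
        assert (K * exp (y * t) <= nu * exp (z * t)).
        { replace (z * t) with ((y - z) * - t + y * t) by ring. rewrite exp_plus, <- Rmult_assoc.
          apply Rmult_le_compat_r; [left; apply exp_pos|exact HT1]. }
        assert (0 < A * exp (z' * t)) by (apply Rmult_lt_0_compat; [exact HA|apply exp_pos]). unfold v. lra.
    - specialize (Hv t1). apply (Rmult_lt_reg_r (v t1)); [exact Hv|].
      replace (phi t1 / v t1 * v t1) with (phi t1) by (field; lra). lra.
    - set (m := phi t0 / v t0) in *.
      assert (Hle : forall t, phi t <= m * v t).
      { intros t. specialize (Hmax t). cbv beta in Hmax. specialize (Hv t).
        apply (Rmult_le_compat_r (v t)) in Hmax; [|lra]. replace (phi t / v t * v t) with (phi t) in Hmax by (field; lra). exact Hmax. }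
      assert (Heq : phi t0 = m * v t0) by (unfold m; specialize (Hv t0); field; lra).
      assert (Hder : m * (A * (z' * exp (z' * t0)) + nu * (z * exp (z * t0))) - dphi t0 = 0).
      { apply (is_derive_global_min (fun t => m * v t - phi t) t0).
        - apply (is_derive_minus (fun t => m * v t) phi); [|apply (fr_derive HF)].
          apply (is_derive_scal v t0 m). apply Hdv.
        - intros x. specialize (Hle x). lra. }
      assert (Hg : forall s, g (phi s) <= q * (m * v s)).
      { intros s. specialize (Hv s). specialize (Hle s).
        destruct (Rle_lt_dec T0 s) as [H1|H1].
        - specialize (HAright s H1).
          pose proof (re_mono HR (phi s) M ltac:(left; apply Hpos) (HM s)).
          assert (A * exp (z' * s) <= v s) by (unfold v; assert (0 < nu * exp (z * s)) by (apply Rmult_lt_0_compat; [exact Hnu|apply exp_pos]); lra).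
          assert (1 * v s <= m * v s) by (apply Rmult_le_compat_r; lra).
          assert (1 * (m * v s) <= q * (m * v s)) by (apply Rmult_le_compat_r; [nra|unfold q; lra]). lra.
        - specialize (HT0 s H1). pose proof (Hpos s). specialize (Hlin (phi s) ltac:(lra)). apply Rabs_le_between in Hlin.
          assert (q * phi s <= q * (m * v s)) by (apply Rmult_le_compat_l; [unfold q; lra|exact Hle]). unfold q in *; lra. }
      assert (Hser : is_series (fun j => b j * (q * (m * v (t0 - rho j)))) (q * m * (A * exp (z' * t0) * E z' + nu * exp (z * t0) * E z))).
      { pose proof (is_series_scal_l (q * m * A * exp (z' * t0)) _ _ (Series_correct _ HFz')) as S1.
        pose proof (is_series_scal_l (q * m * nu * exp (z * t0)) _ _ (Series_correct _ HFz)) as S2.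
        pose proof (is_series_plus _ _ _ _ S1 S2) as S3.
        match type of S3 with is_series _ ?l => replace l with (q * m * (A * exp (z' * t0) * E z' + nu * exp (z * t0) * E z)) in S3 end.
        2:{ unfold plus, scal; simpl; unfold mult; simpl. unfold E. ring. }
        eapply is_series_ext; [|exact S3]. intros j. unfold plus, scal; simpl; unfold mult; simpl. unfold v.
        replace (z' * (t0 - rho j)) with (z' * t0 + - (z' * rho j)) by ring.
        replace (z * (t0 - rho j)) with (z * t0 + - (z * rho j)) by ring.
        rewrite !exp_plus. ring. }
      assert (HS : Series (fun j => b j * g (phi (t0 - rho j))) <= q * m * (A * exp (z' * t0) * E z' + nu * exp (z * t0) * E z)).
      { rewrite <- (is_series_unique _ _ Hser). apply Series_le; [|eexists; exact Hser].
        intros j. split; [apply Rmult_le_pos; [apply Hb|apply (re_nonneg HR); left; apply Hpos]|].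
        apply Rmult_le_compat_l; [apply Hb|apply Hg]. }
      pose proof (fr_eq HF t0) as Hf.
      assert (Hdd : dphi t0 = m * (A * (z' * exp (z' * t0)) + nu * (z * exp (z * t0)))) by lra.
      rewrite Hdd in Hf.
      assert (Hv1 : D * (phi (t0 + 1) + phi (t0 - 1) - 2 * phi t0) <= m * (D * (v (t0 + 1) + v (t0 - 1) - 2 * v t0))).
      { pose proof (Hle (t0 + 1)). pose proof (Hle (t0 - 1)).
        replace (m * (D * (v (t0 + 1) + v (t0 - 1) - 2 * v t0))) with (D * (m * v (t0 + 1) + m * v (t0 - 1) - 2 * (m * v t0))) by ring.
        apply Rmult_le_compat_l; lra. }
      assert (Hv2 : v (t0 + 1) + v (t0 - 1) - 2 * v t0 = A * exp (z' * t0) * (exp z' + exp (- z') - 2) + nu * exp (z * t0) * (exp z + exp (- z) - 2)).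
      { unfold v. replace (z' * (t0 + 1)) with (z' * t0 + z') by ring. replace (z * (t0 + 1)) with (z * t0 + z) by ring.
        replace (z' * (t0 - 1)) with (z' * t0 + - z') by ring. replace (z * (t0 - 1)) with (z * t0 + - z) by ring.
        rewrite !exp_plus. ring. }
      rewrite Hv2 in Hv1.
      assert (Hm : 0 < m) by lra.
      assert (N1 : m * (A * exp (z' * t0)) * (char_fun D c b rho g0 z' + del * E z') < 0).
      { assert (0 < m * (A * exp (z' * t0))) by (apply Rmult_lt_0_compat; [lra|]; apply Rmult_lt_0_compat; [lra|apply exp_pos]). nra. }
      assert (N2 : m * (nu * exp (z * t0)) * (char_fun D c b rho g0 z + del * E z) < 0).
      { assert (0 < m * (nu * exp (z * t0))) by (apply Rmult_lt_0_compat; [lra|]; apply Rmult_lt_0_compat; [lra|apply exp_pos]). nra. }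
      unfold char_fun in N1, N2. fold (E z) in N2. fold (E z') in N1.
      unfold v in Heq. unfold q in HS. lra. }
  exists A. intros t. apply Rle_plus_epsilon. intros e He.
  specialize (Hnu (e * exp (- (z * t))) ltac:(apply Rmult_lt_0_compat; [exact He|apply exp_pos]) t).
  rewrite Rmult_assoc, <- exp_plus in Hnu. replace (- (z * t) + z * t) with 0 in Hnu by ring. rewrite exp_0 in Hnu. lra.
Qed.

Lemma ex_series_of_bounded (x : nat -> R) (K : R) :
  (forall j, 0 <= x j) -> (forall N, sum_f_R0 x N <= K) -> ex_series x.
Proof.
  intros Hx HK.
  destruct (ex_finite_lim_seq_incr (sum_n x) K) as [l Hl].
  - intros n. rewrite sum_Sn. unfold plus; simpl. specialize (Hx (S n)). lra.
  - intros n. rewrite sum_n_Reals. apply HK.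
  - exists l. exact Hl.
Qed.

Lemma char_fun_continuous (D c : R) (b rho : nat -> R) (g0 z1 z z2 : R) :
  (forall j, 0 <= b j) -> exp_sum_finite b rho z1 -> exp_sum_finite b rho z2 -> z1 < z < z2 ->
  continuous (char_fun D c b rho g0) z.
Proof.
  intros Hb H1 H2 Hz.
  assert (Hdom : forall y j, z1 <= y <= z2 ->
     Rabs (b j * exp (- (y * rho j))) <= b j * exp (- (z1 * rho j)) + b j * exp (- (z2 * rho j))).
  { intros y j Hy. specialize (Hb j).
    rewrite Rabs_pos_eq by (apply Rmult_le_pos; [exact Hb|left; apply exp_pos]).
    rewrite <- Rmult_plus_distr_l. apply Rmult_le_compat_l; [exact Hb|].
    pose proof (exp_pos (- (z1 * rho j))). pose proof (exp_pos (- (z2 * rho j))).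
    destruct (Rle_lt_dec 0 (rho j)).
    - assert (exp (- (y * rho j)) <= exp (- (z1 * rho j))) by (apply exp_le; nra). lra.
    - assert (exp (- (y * rho j)) <= exp (- (z2 * rho j))) by (apply exp_le; nra). lra. }
  unfold char_fun. apply (continuous_plus (fun z => - c * z + D * (exp z + exp (- z) - 2) - 1)).
  - apply (ex_derive_continuous (fun y => - c * y + D * (exp y + exp (- y) - 2) - 1)). auto_derive; repeat split.
  - apply (continuous_mult (fun _ => g0)); [apply continuous_const|].
    apply (series_dominated (locally z) (fun y j => b j * exp (- (y * rho j))) (fun j => b j * exp (- (z * rho j)))
      (fun j => b j * exp (- (z1 * rho j)) + b j * exp (- (z2 * rho j)))).
    + apply (ex_series_plus _ _ H1 H2).
    + intros j. apply (ex_derive_continuous (fun y => b j * exp (- (y * rho j)))). auto_derive; exact I.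
    + assert (He : 0 < Rmin (z - z1) (z2 - z)) by (apply Rmin_glb_lt; lra).
      exists (mkposreal _ He). intros y Hy j. apply Hdom.
      unfold ball in Hy; simpl in Hy; unfold AbsRing_ball, abs, minus, plus, opp in Hy; simpl in Hy.
      apply Rabs_def2 in Hy. pose proof (Rmin_l (z - z1) (z2 - z)). pose proof (Rmin_r (z - z1) (z2 - z)). lra.
    + intros j. apply Hdom; lra.
Qed.

(** [lam] is the supremum of the decay rates. By [decay_improve] no truncated characteristic value
    at [lam] is positive, which bounds the partial sums and gives both finiteness and
    [char_fun <= 0]; a strictly negative value would let the barrier pass beyond [lam]. *)
Lemma front_rate {D c : R} {b rho : nat -> R} {g : R -> R} {kappa g0 : R} {phi dphi : R -> R} :
  lattice D c b rho g kappa g0 -> front D c b rho g kappa phi dphi ->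
  exists lam, 0 < lam /\ exp_sum_finite b rho lam /\ char_fun D c b rho g0 lam = 0 /\
    (forall z, 0 <= z < lam -> exp_decay phi z) /\ (forall z, lam < z -> ~ exp_decay phi z).
Proof.
  intros HL HF.
  pose proof (la_D HL) as HD.
  pose proof (la_nonneg HL) as Hb. pose proof (la_sum HL) as Hsum.
  pose proof (la_reaction HL) as HR. pose proof (re_g0 HR) as Hg0.
  destruct (exp_decay_bounded_rate HL HF) as [Z HZ].
  destruct (completeness (fun z => 0 <= z /\ exp_decay phi z)) as [lam [Hl1 Hl2]].
  - exists Z. intros z [_ Hz]. apply HZ; exact Hz.
  - exists 0. split; [lra|]. apply (exp_decay_zero HF).
  - assert (Hlam0 : 0 <= lam) by (apply Hl1; split; [lra|apply (exp_decay_zero HF)]).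
    assert (Hnear : forall e, 0 < e -> exists z, 0 <= z /\ lam - e < z <= lam /\ exp_decay phi z).
    { intros e He. apply NNPP. intros Hno. assert (lam <= lam - e); [|lra].
      apply Hl2. intros z [Hz1 Hz2]. apply Rnot_lt_le. intros Hlt. apply Hno. exists z.
      split; [exact Hz1|]. split; [|exact Hz2]. split; [exact Hlt|]. apply Hl1. split; assumption. }
    assert (Hbelow : forall z, 0 <= z < lam -> exp_decay phi z).
    { intros z Hz. destruct (Hnear (lam - z) ltac:(lra)) as [y [Hy0 [Hy1 Hy2]]].
      apply (exp_decay_le z y HF); [lra|exact Hy2]. }
    assert (Habove : forall z, lam < z -> ~ exp_decay phi z).
    { intros z Hz Hd. assert (z <= lam); [|lra]. apply Hl1. split; [lra|exact Hd]. }
    assert (Hnoimp : forall q N, 0 < q < g0 ->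
       - c * lam + D * (exp lam + exp (- lam) - 2) - 1 + q * sum_f_R0 (fun n => b n * exp (- (lam * rho n))) N <= 0).
    { intros q N Hq. apply Rnot_lt_le. intros Hlt.
      destruct (decay_improve lam q N HL HF Hlam0 Hq Hlt) as [eta [Heta H]].
      destruct (Hnear eta Heta) as [z [Hz0 [Hz1 Hz2]]].
      apply (Habove (lam + eta)); [lra|]. apply (H z); assumption. }
    assert (Hterm : forall j, 0 <= b j * exp (- (lam * rho j))) by (intros j; apply Rmult_le_pos; [apply Hb|left; apply exp_pos]).
    set (w := - c * lam + D * (exp lam + exp (- lam) - 2) - 1).
    assert (Hfin : exp_sum_finite b rho lam).
    (* The choice [q = 1] is allowed because [g0 > 1]. *)
    { apply (ex_series_of_bounded _ (- w)); [exact Hterm|].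
      intros N. specialize (Hnoimp 1 N ltac:(lra)). fold w in Hnoimp. lra. }
    assert (Hchi : char_fun D c b rho g0 lam <= 0).
    { unfold char_fun. fold w.
      set (E := Series (fun j => b j * exp (- (lam * rho j)))).
      assert (HqE : forall q, 0 < q < g0 -> w + q * E <= 0).
      { intros q Hq. assert (E <= - w / q).
        { unfold E. pose proof (is_lim_seq_le (sum_n (fun j => b j * exp (- (lam * rho j)))) (fun _ => - w / q)
            (Series (fun j => b j * exp (- (lam * rho j)))) (- w / q)) as Hle. simpl in Hle. apply Hle.
          - intros n. rewrite sum_n_Reals. specialize (Hnoimp q n Hq). fold w in Hnoimp.
            apply (Rmult_le_reg_l q); [lra|]. replace (q * (- w / q)) with (- w) by (field; lra). lra.
          - apply (Series_correct _ Hfin).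
          - apply is_lim_seq_const. }
        apply (Rmult_le_compat_l q) in H; [|lra]. replace (q * (- w / q)) with (- w) in H by (field; lra). lra. }
      assert (HE : 0 <= E) by (apply Series_nonneg; assumption).
      apply Rle_plus_epsilon. intros e He.
      set (d := Rmin (g0 / 2) (e / (E + 1))).
      assert (Hd : 0 < d) by (apply Rmin_glb_lt; [lra|apply Rdiv_lt_0_compat; lra]).
      pose proof (Rmin_l (g0 / 2) (e / (E + 1))). pose proof (Rmin_r (g0 / 2) (e / (E + 1))). fold d in H, H0.
      specialize (HqE (g0 - d) ltac:(lra)).
      assert (d * (E + 1) <= e).
      { replace e with (e / (E + 1) * (E + 1)) by (field; lra). apply Rmult_le_compat_r; lra. }
      lra. }
    assert (Hfin0 : exp_sum_finite b rho 0).
    { exists 1. eapply is_series_ext; [|exact Hsum]. intros j. rewrite Rmult_0_l, Ropp_0, exp_0. symmetry; apply Rmult_1_r. }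
    (* At 0 the characteristic function equals [g0 - 1 > 0]. *)
    assert (Hlam : 0 < lam).
    { destruct Hlam0 as [H|H]; [exact H|]. exfalso. rewrite <- H in Hchi. unfold char_fun in Hchi.
      rewrite (Series_ext _ b) in Hchi by (intros j; rewrite Rmult_0_l, Ropp_0, exp_0; ring).
      rewrite (is_series_unique _ _ Hsum), Ropp_0, exp_0 in Hchi. lra. }
    exists lam. split; [exact Hlam|]. split; [exact Hfin|]. split; [|split; assumption].
    destruct Hchi as [Hchi|Hchi]; [exfalso|exact Hchi].
    destruct (la_open HL lam Hlam0 Hfin) as [z2 [Hz2 Hfin2]].
    pose proof (char_fun_continuous D c b rho g0 0 lam z2 Hb Hfin0 Hfin2 ltac:(lra)) as Hcont.
    destruct (proj1 (filterlim_locally _ _) Hcont (mkposreal (- char_fun D c b rho g0 lam) ltac:(lra))) as [d Hd].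
    assert (Hneg : forall y, Rabs (y - lam) < d -> char_fun D c b rho g0 y < 0).
    { intros y Hy. specialize (Hd y Hy). unfold ball in Hd; simpl in Hd; unfold AbsRing_ball, abs, minus, plus, opp in Hd; simpl in Hd.
      apply Rabs_def2 in Hd. lra. }
    pose proof (cond_pos d) as Hdp.
    set (e := Rmin (d / 2) (Rmin (lam / 2) ((z2 - lam) / 2))).
    assert (He : 0 < e) by (repeat apply Rmin_glb_lt; lra).
    assert (He1 : e <= d / 2) by apply Rmin_l.
    assert (He2 : e <= lam / 2) by (unfold e; eapply Rle_trans; [apply Rmin_r|apply Rmin_l]).
    assert (He3 : e <= (z2 - lam) / 2) by (unfold e; eapply Rle_trans; [apply Rmin_r|apply Rmin_r]).
    clearbody e.
    apply (Habove (lam + e)); [lra|].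
    (* Exponents on both sides of [lam]: the barrier is lowered to rate [lam + e], and the known
       rate [lam - e / 2] beats its slower part [lam - e]. *)
    apply (decay_barrier (lam - e) (lam + e) (lam - e / 2) HL HF); try lra.
    + apply (exp_sum_finite_between b rho 0 _ z2); [exact Hb|lra|exact Hfin0|exact Hfin2].
    + apply (exp_sum_finite_between b rho 0 _ z2); [exact Hb|lra|exact Hfin0|exact Hfin2].
    + apply Hneg. apply Rabs_def1; lra.
    + apply Hneg. apply Rabs_def1; lra.
    + apply Hbelow; lra.
Qed.

Lemma kernel_exp_weight (b rho : nat -> R) (z e u v k : R) :
  (forall j, 0 <= b j) -> 0 < e -> 0 <= u -> 0 <= v -> 0 <= k ->
  exp_sum_finite b rho (z - e) -> exp_sum_finite b rho (z + e) ->
  kernel (cons2 u v (fun n => k * (b n * exp (- (z * rho n))))) (cons2 (-1) 1 rho) e.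
Proof.
  intros Hb He Hu Hv Hk H1 H2. split; [exact He| |].
  - intros [|[|n]]; simpl; try assumption. repeat apply Rmult_le_pos; [exact Hk|apply Hb|left; apply exp_pos].
  - assert (H : ex_series (fun n => k * (b n * exp (- (z * rho n))) * exp (e * Rabs (rho n)))).
    { pose proof (ex_series_scal_l k _ (ex_series_plus _ _ H1 H2)) as H3.
      eapply ex_series_le_R; [|exact H3]. intros n. unfold scal, plus; simpl; unfold mult; simpl.
      specialize (Hb n). rewrite Rabs_pos_eq by (repeat apply Rmult_le_pos; try assumption; left; apply exp_pos).
      rewrite Rmult_assoc. apply Rmult_le_compat_l; [exact Hk|].
      rewrite Rmult_assoc, <- Rmult_plus_distr_l. apply Rmult_le_compat_l; [exact Hb|].
      rewrite <- exp_plus. pose proof (exp_pos (- ((z - e) * rho n))). pose proof (exp_pos (- ((z + e) * rho n))).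
      unfold Rabs. destruct (Rcase_abs (rho n)).
      - replace (- (z * rho n) + e * - rho n) with (- ((z + e) * rho n)) by ring. lra.
      - replace (- (z * rho n) + e * rho n) with (- ((z - e) * rho n)) by ring. lra. }
    destruct H as [l Hl]. eexists. eapply is_series_ext; [|apply (is_series_cons2 (u * exp (e * Rabs (-1))) (v * exp (e * Rabs 1)) _ _ Hl)].
    intros [|[|n]]; reflexivity.
Qed.

(** Dividing by [exp (lam t)] turns [char_fun lam = 0] into the cancellation of all multiples of
    [p t], which leaves differences [p (t - r_j) - p t]. The Hoelder bound makes the remainder
    smaller by [exp (eps t)]. *)
Lemma front_delay_solution {D c : R} {b rho : nat -> R} {g : R -> R} {kappa g0 : R} {phi dphi : R -> R} (lam : R) :
  lattice D c b rho g kappa g0 -> front D c b rho g kappa phi dphi ->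
  0 < lam -> exp_sum_finite b rho lam -> char_fun D c b rho g0 lam = 0 ->
  (forall z, 0 <= z < lam -> exp_decay phi z) ->
  exists a r d e0 eps dp, delay_solution c a r d e0 eps (fun t => phi t * exp (- (lam * t))) dp.
Proof.
  intros HL HF Hlam Hfin Hchi Hdec.
  pose proof (la_D HL) as HD.
  pose proof (la_nonneg HL) as Hb. pose proof (la_sum HL) as Hsum.
  pose proof (la_reaction HL) as HR. pose proof (re_g0 HR) as Hg0.
  pose proof (fr_pos HF) as Hpos.
  destruct (fr_bounded HF) as [M HM].
  assert (HM0 : 0 < M) by (specialize (HM 0); specialize (Hpos 0); lra).
  destruct (re_holder HR) as [th [Hth Hhol]]. destruct (Hhol M) as [C [HC Hh]].
  destruct (la_open HL lam ltac:(lra) Hfin) as [z2 [Hz2 Hfin2]].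
  assert (Hfin0 : exp_sum_finite b rho 0).
  { exists 1. eapply is_series_ext; [|exact Hsum]. intros j. rewrite Rmult_0_l, Ropp_0, exp_0. symmetry; apply Rmult_1_r. }
  assert (Hfinb : forall z, 0 <= z <= z2 -> exp_sum_finite b rho z).
  { intros z Hz. apply (exp_sum_finite_between b rho 0 z z2); assumption. }
  (* With [eps <= e0], the exponents [lam - e0], [lam + e0] and [lam + eps + e0] all stay inside
     [[0, z2]], where the exponential sums are finite. *)
  set (e0 := Rmin (lam / 4) ((z2 - lam) / 4)).
  assert (He0 : 0 < e0) by (apply Rmin_glb_lt; lra).
  assert (He01 : e0 <= lam / 4) by apply Rmin_l. assert (He02 : e0 <= (z2 - lam) / 4) by apply Rmin_r.
  (* The second bound makes [eps / th < lam] an admissible decay rate, so that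
     [phi^th <= K^th exp (eps s)]. *)
  set (eps := Rmin e0 (th * lam / 2)).
  assert (Hthlam : 0 < th * lam) by (apply Rmult_lt_0_compat; assumption).
  assert (Heps : 0 < eps) by (apply Rmin_glb_lt; lra).
  assert (Heps1 : eps <= e0) by apply Rmin_l. assert (Heps2 : eps <= th * lam / 2) by apply Rmin_r.
  clearbody eps. clearbody e0.
  assert (Hy : 0 <= eps / th < lam).
  { split; [apply Rdiv_le_0_compat; lra|]. apply (Rmult_lt_reg_r th); [exact Hth|]. replace (eps / th * th) with eps by (field; lra). lra. }
  destruct (Hdec _ Hy) as [K HK].
  assert (HK0 : 0 < K). { specialize (HK 0). specialize (Hpos 0). pose proof (exp_pos (eps / th * 0)). nra. }
  set (C1 := C * exp (th * ln K)).
  assert (HC1 : 0 < C1) by (apply Rmult_lt_0_compat; [exact HC|apply exp_pos]).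
  assert (Hnl : forall s, Rabs (g (phi s) - g0 * phi s) <= C1 * (phi s * exp (eps * s))).
  { intros s. pose proof (Hpos s) as Hps. eapply Rle_trans; [apply Hh; split; [exact Hps|apply HM]|].
    assert (Rpower (phi s) th <= exp (th * ln K) * exp (eps * s)).
    { unfold Rpower. rewrite <- exp_plus. apply exp_le.
      assert (ln (phi s) <= ln K + eps / th * s).
      { rewrite <- (ln_exp (eps / th * s)), <- ln_mult by (exact HK0 || apply exp_pos).
        destruct (HK s) as [H|H]; [left; apply ln_increasing; assumption|right; rewrite H; reflexivity]. }
      apply (Rmult_le_compat_l th) in H; [|lra]. replace (th * (ln K + eps / th * s)) with (th * ln K + eps * s) in H by (field; lra). exact H. }
    unfold C1. replace (C * exp (th * ln K) * (phi s * exp (eps * s))) with (C * (phi s * (exp (th * ln K) * exp (eps * s)))) by ring.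
    apply Rmult_le_compat_l; [lra|]. apply Rmult_le_compat_l; lra. }
  set (p := fun t => phi t * exp (- (lam * t))).
  set (dp := fun t => (dphi t - lam * phi t) * exp (- (lam * t))).
  assert (Hdp : forall t, is_derive p t (dp t)).
  { intros t. unfold p, dp. auto_derive; [exists (dphi t); apply (fr_derive HF)|].
    replace (Derive (fun x => phi x) t) with (dphi t) by (symmetry; apply is_derive_unique; apply (fr_derive HF)). ring. }
  set (a := cons2 (D * exp lam) (D * exp (- lam)) (fun n => g0 * (b n * exp (- (lam * rho n))))).
  set (r := cons2 (-1) 1 rho).
  set (d := cons2 0 0 (fun n => C1 * (b n * exp (- ((lam + eps) * rho n))))).
  exists a, r, d, e0, eps, dp. change (delay_solution c a r d e0 eps p dp).
  assert (HDe : forall x, 0 < D * exp x) by (intros x; apply Rmult_lt_0_compat; [exact HD|apply exp_pos]).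
  assert (HKa : kernel a r e0).
  { apply kernel_exp_weight; try assumption; try lra; try (left; apply HDe); apply Hfinb; lra. }
  assert (HKd : kernel d r e0).
  { apply kernel_exp_weight; try assumption; try lra; apply Hfinb; lra. }
  split; try assumption; try reflexivity.
  - apply (la_c HL).
  - apply HDe.
  - apply HDe.
  - intros t. left. apply Rmult_lt_0_compat; [apply Hpos|apply exp_pos].
  - intros t.
    set (E := Series (fun j => b j * exp (- (lam * rho j)))).
    assert (Hbsum : ex_series b) by (exists 1; exact Hsum).
    assert (Hexphi : ex_series (fun j => b j * phi (t - rho j))).
    { apply (ex_series_scal_l M) in Hbsum. eapply ex_series_le_R; [|exact Hbsum]. intros j.
      unfold scal; simpl; unfold mult; simpl.
      rewrite Rabs_pos_eq by (apply Rmult_le_pos; [apply Hb|left; apply Hpos]). rewrite Rmult_comm.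
      apply Rmult_le_compat_r; [apply Hb|apply HM]. }
    assert (Hexg := front_ex_series HL HF t).
    assert (HS : is_series (fun j => a j * (p (t - r j) - p t))
       (D * exp lam * (p (t + 1) - p t) + (D * exp (- lam) * (p (t - 1) - p t) +
         (exp (- (lam * t)) * g0 * Series (fun j => b j * phi (t - rho j)) - g0 * p t * E)))).
    { pose proof (is_series_scal_l (exp (- (lam * t)) * g0) _ _ (Series_correct _ Hexphi)) as S1.
      pose proof (is_series_scal_l (g0 * p t) _ _ (Series_correct _ Hfin)) as S2.
      pose proof (is_series_minus _ _ _ _ S1 S2) as S3.
      pose proof (is_series_cons2 (D * exp lam * (p (t + 1) - p t)) (D * exp (- lam) * (p (t - 1) - p t)) _ _ S3) as S4.
      eapply is_series_ext; [|exact S4]. intros [|[|n]]; unfold a, r, cons2.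
      - replace (t - -1) with (t + 1) by ring. reflexivity.
      - reflexivity.
      - unfold minus, plus, opp, scal; simpl; unfold mult; simpl. unfold p.
        replace (- (lam * (t - rho n))) with (- (lam * t) + lam * rho n) by ring. rewrite exp_plus.
        replace (exp (- (lam * rho n))) with (/ exp (lam * rho n)) by (rewrite exp_Ropp; reflexivity).
        pose proof (exp_pos (lam * rho n)). change (exp (- (lam * t)) * g0 * (b n * phi (t - rho n)) + - (g0 * (phi t * exp (- (lam * t))) * (b n * / exp (lam * rho n))) =
          g0 * (b n * / exp (lam * rho n)) * (phi (t - rho n) * (exp (- (lam * t)) * exp (lam * rho n)) - phi t * exp (- (lam * t)))).
        field. lra. }
    rewrite (is_series_unique _ _ HS).
    assert (E1 : exp lam * p (t + 1) = phi (t + 1) * exp (- (lam * t))).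
    { unfold p. replace (- (lam * (t + 1))) with (- (lam * t) + - lam) by ring. rewrite exp_plus, (exp_Ropp lam).
      pose proof (exp_pos lam). field. lra. }
    assert (E2 : exp (- lam) * p (t - 1) = phi (t - 1) * exp (- (lam * t))).
    { unfold p. replace (- (lam * (t - 1))) with (- (lam * t) + lam) by ring. rewrite exp_plus, (exp_Ropp lam).
      pose proof (exp_pos lam). field. lra. }
    assert (Hdiff : ex_series (fun j => b j * (g (phi (t - rho j)) - g0 * phi (t - rho j)))).
    { pose proof (ex_series_minus _ _ Hexg (ex_series_scal_l g0 _ Hexphi)) as H1.
      eapply ex_series_ext; [|exact H1]. intros j. unfold minus, plus, opp, scal; simpl; unfold mult; simpl.
      change (b j * g (phi (t - rho j)) + - (g0 * (b j * phi (t - rho j))) = b j * (g (phi (t - rho j)) - g0 * phi (t - rho j))). ring. }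
    assert (E3 : Series (fun j => b j * (g (phi (t - rho j)) - g0 * phi (t - rho j))) =
       Series (fun j => b j * g (phi (t - rho j))) - g0 * Series (fun j => b j * phi (t - rho j))).
    { rewrite <- Series_scal_l, <- Series_minus; [apply Series_ext; intros j; ring|exact Hexg|].
      apply (ex_series_scal_l g0) in Hexphi. exact Hexphi. }
    match goal with |- Rabs ?x <= _ => replace x with (exp (- (lam * t)) * Series (fun j => b j * (g (phi (t - rho j)) - g0 * phi (t - rho j)))) end.
    2:{ rewrite E3.
        replace (c * dp t) with ((D * (phi (t + 1) + phi (t - 1) - 2 * phi t) - phi t + Series (fun j => b j * g (phi (t - rho j)))
          - c * lam * phi t) * exp (- (lam * t))) by (unfold dp; rewrite <- (fr_eq HF t); ring).
        replace (D * exp lam * (p (t + 1) - p t)) with (D * (exp lam * p (t + 1)) - D * exp lam * p t) by ring.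
        replace (D * exp (- lam) * (p (t - 1) - p t)) with (D * (exp (- lam) * p (t - 1)) - D * exp (- lam) * p t) by ring.
        rewrite E1, E2. unfold char_fun in Hchi. fold E in Hchi.
        assert (Hz : p t * (- c * lam + D * (exp lam + exp (- lam) - 2) - 1 + g0 * E) = 0) by (rewrite Hchi; ring).
        unfold p in *. lra. }
    rewrite Rabs_mult, (Rabs_pos_eq (exp (- (lam * t)))) by (left; apply exp_pos).
    assert (Hdterm : forall n, C1 * (b n * exp (- ((lam + eps) * rho n))) * p (t - rho n)
        = exp (- (lam * t)) * (C1 * (b n * (phi (t - rho n) * exp (- (eps * rho n)))))).
    { intros n. unfold p. replace (- ((lam + eps) * rho n)) with (- (lam * rho n) + - (eps * rho n)) by ring.
      replace (- (lam * t)) with (- (lam * rho n) + - (lam * (t - rho n))) by ring. rewrite !exp_plus. ring. }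
    assert (Hex1 : ex_series (fun n => C1 * (b n * (phi (t - rho n) * exp (- (eps * rho n)))))).
    { pose proof (ex_series_scal_l (C1 * M) _ (Hfinb eps ltac:(lra))) as H1.
      eapply ex_series_le_R; [|exact H1]. intros n. unfold scal; simpl; unfold mult; simpl.
      pose proof (exp_pos (- (eps * rho n))). pose proof (Hpos (t - rho n)).
      rewrite Rabs_pos_eq by (apply Rmult_le_pos; [lra|apply Rmult_le_pos; [apply Hb|apply Rmult_le_pos; lra]]).
      replace (C1 * M * (b n * exp (- (eps * rho n)))) with (C1 * (b n * (M * exp (- (eps * rho n))))) by ring.
      apply Rmult_le_compat_l; [lra|]. apply Rmult_le_compat_l; [apply Hb|]. apply Rmult_le_compat_r; [lra|apply HM]. }
    assert (Hdser : Series (fun j => d j * p (t - r j)) = exp (- (lam * t)) * Series (fun n => C1 * (b n * (phi (t - rho n) * exp (- (eps * rho n)))))).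
    { apply is_series_unique.
      pose proof (is_series_scal_l (exp (- (lam * t))) _ _ (Series_correct _ Hex1)) as S1.
      pose proof (is_series_cons2 0 0 _ _ S1) as S2. rewrite !Rplus_0_l in S2.
      eapply is_series_ext; [|exact S2]. intros [|[|n]]; unfold d, r, cons2.
      - symmetry; apply Rmult_0_l.
      - symmetry; apply Rmult_0_l.
      - symmetry; apply Hdterm. }
    rewrite Hdser.
    replace (exp (eps * t) * (exp (- (lam * t)) * Series (fun n => C1 * (b n * (phi (t - rho n) * exp (- (eps * rho n)))))))
      with (exp (- (lam * t)) * (exp (eps * t) * Series (fun n => C1 * (b n * (phi (t - rho n) * exp (- (eps * rho n))))))) by ring.
    apply Rmult_le_compat_l; [left; apply exp_pos|].
    rewrite <- Series_scal_l. apply Series_abs_le; [|apply (ex_series_scal_l (exp (eps * t))) in Hex1; exact Hex1].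
    intros j. rewrite Rabs_mult, (Rabs_pos_eq (b j)) by apply Hb.
    replace (exp (eps * t) * (C1 * (b j * (phi (t - rho j) * exp (- (eps * rho j))))))
      with (b j * (C1 * (phi (t - rho j) * (exp (eps * t) * exp (- (eps * rho j)))))) by ring.
    rewrite <- exp_plus. replace (eps * t + - (eps * rho j)) with (eps * (t - rho j)) by ring.
    apply Rmult_le_compat_l; [apply Hb|apply Hnl].
  (* Rates just below [lam] translate into arbitrarily slow exponential growth of [p]; the maximum
     with 0 keeps the rate in the range of [Hdec]. *)
  - intros eta Heta. set (z := Rmax 0 (lam - eta)).
    assert (Hz : 0 <= z < lam) by (unfold z; split; [apply Rmax_l|apply Rmax_lub_lt; lra]).
    assert (Hze : lam - z <= eta) by (pose proof (Rmax_r 0 (lam - eta)); fold z in H; lra).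
    destruct (Hdec z Hz) as [G HG]. exists G. intros t. unfold p.
    pose proof (exp_pos (- (lam * t))). pose proof (exp_pos (z * t)).
    assert (HG0 : 0 < G). { specialize (HG t). specialize (Hpos t). nra. }
    apply Rle_trans with (G * exp (z * t) * exp (- (lam * t))); [apply Rmult_le_compat_r; [lra|apply HG]|].
    rewrite Rmult_assoc, <- exp_plus. apply Rmult_le_compat_l; [lra|]. apply exp_le.
    replace (z * t + - (lam * t)) with ((lam - z) * - t) by ring.
    assert (- t <= Rabs t) by (rewrite <- Rabs_Ropp; apply RRle_abs). pose proof (Rabs_pos t).
    apply Rle_trans with ((lam - z) * Rabs t); [apply Rmult_le_compat_l; lra|apply Rmult_le_compat_r; lra].
  - exists M. intros t Ht. unfold p. rewrite <- (Rmult_1_r M).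
    assert (exp (- (lam * t)) <= 1) by (rewrite <- exp_0; apply exp_le; assert (0 <= lam * t) by (apply Rmult_le_pos; lra); lra).
    apply Rmult_le_compat; [left; apply Hpos|left; apply exp_pos|apply HM|assumption].
Qed.

Definition asymptotic_at_minus_infinity (phi : R -> R) (lam : R) (i : nat) (x : R) : Prop :=
  forall q, 0 < q -> exists T, forall t, t <= - T ->
    Rabs (phi t - x * (exp (lam * t) * (- t) ^ i)) <= q * (exp (lam * t) * (- t) ^ i).

(** The degenerate alternative would give [phi] the rate [lam + z], beyond the supremum. *)
Lemma front_asymptotics {D c : R} {b rho : nat -> R} {g : R -> R} {kappa g0 : R} {phi dphi : R -> R} :
  lattice D c b rho g kappa g0 -> front D c b rho g kappa phi dphi ->
  exists lam i x, 0 < lam /\ (i <= 1)%nat /\ 0 < x /\ asymptotic_at_minus_infinity phi lam i x.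
Proof.
  intros HL HF.
  destruct (front_rate HL HF) as [lam [Hlam [Hfin [Hchi [Hdec Hnot]]]]].
  destruct (front_delay_solution lam HL HF Hlam Hfin Hchi Hdec) as [a [r [d [e0 [eps [dp Hds]]]]]].
  assert (Hmul : forall t y, Rabs (phi t * exp (- (lam * t)) - y) * exp (lam * t) = Rabs (phi t - y * exp (lam * t))).
  { intros t y. rewrite <- (Rabs_pos_eq (exp (lam * t))) at 1 by (left; apply exp_pos). rewrite <- Rabs_mult. f_equal.
    rewrite exp_Ropp. pose proof (exp_pos (lam * t)). field. lra. }
  destruct (asymptotics Hds) as [[x [Hx H]]|[[x [Hx H]]|[z [K [Hz H]]]]].
  - exists lam, 0%nat, x. repeat split; try assumption; [lia|]. intros q Hq. destruct (H q Hq) as [T HT].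
    exists T. intros t Ht. specialize (HT t Ht). simpl. rewrite Rmult_1_r.
    rewrite <- Hmul. apply Rmult_le_compat_r; [left; apply exp_pos|exact HT].
  - exists lam, 1%nat, x. repeat split; try assumption; [lia|]. intros q Hq. destruct (H q Hq) as [T HT].
    exists T. intros t Ht. specialize (HT t Ht). simpl. rewrite Rmult_1_r.
    replace (x * (exp (lam * t) * - t)) with (x * - t * exp (lam * t)) by ring.
    replace (q * (exp (lam * t) * - t)) with (q * - t * exp (lam * t)) by ring.
    rewrite <- Hmul. apply Rmult_le_compat_r; [left; apply exp_pos|exact HT].
  - exfalso. apply (Hnot (lam + z)); [lra|].
    apply (exp_decay_of_left _ K 0 HF); [lra|]. intros t Ht. specialize (H t Ht). cbv beta in H.
    apply (Rmult_le_compat_r (exp (lam * t))) in H; [|left; apply exp_pos].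
    rewrite !Rmult_assoc, <- !exp_plus in H. replace (- (lam * t) + lam * t) with 0 in H by ring.
    rewrite exp_0, Rmult_1_r in H. replace ((lam + z) * t) with (z * t + lam * t) by ring. exact H.
Qed.

(** * Sliding *)

Definition decay_weight (lam : R) (i : nat) (t : R) : R := exp (lam * t) * (- t) ^ i.

Lemma decay_weight_pos (lam : R) (i : nat) (t : R) : t < 0 -> 0 < decay_weight lam i t.
Proof. intros Ht. apply Rmult_lt_0_compat; [apply exp_pos|apply pow_lt; lra]. Qed.

(** For [i = 1] the function [- t exp (lam t)] has its maximum at [- 1 / lam], which explains the
    restriction on [t]. *)
Lemma decay_weight_monotone (lam : R) (i : nat) (s t : R) :
  0 < lam -> (i <= 1)%nat -> s <= t -> t <= - / lam -> decay_weight lam i s <= decay_weight lam i t.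
Proof.
  intros Hlam Hi Hst Ht. unfold decay_weight.
  assert (Hl : 0 < / lam) by (apply Rinv_0_lt_compat; exact Hlam).
  assert (Hlt : lam * s <= lam * t) by (apply Rmult_le_compat_l; lra).
  destruct i as [|[|i]]; [| |lia]; simpl.
  - rewrite !Rmult_1_r. apply exp_le; exact Hlt.
  - rewrite !Rmult_1_r. replace (lam * t) with (lam * s + lam * (t - s)) by ring.
    rewrite exp_plus, Rmult_assoc. apply Rmult_le_compat_l; [left; apply exp_pos|].
    pose proof (exp_ineq1_le (lam * (t - s))).
    assert (1 <= lam * - t).
    { apply (Rmult_le_compat_l lam) in Ht; [|lra]. replace (lam * - / lam) with (-1) in Ht by (field; lra). lra. }
    apply Rle_trans with ((1 + lam * (t - s)) * - t); [|apply Rmult_le_compat_r; lra].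
    assert (1 * (t - s) <= lam * - t * (t - s)) by (apply Rmult_le_compat_r; lra). lra.
Qed.

(** The limit superior at [-oo] of the second weight, shifted by [S], over the first is at most
    [r exp (lam2 S)]. It is used with [r = 0] when the second weight is of smaller order, and
    [r = 1] when both are equal. *)
Definition weight_ratio (r lam1 : R) (i1 : nat) (lam2 : R) (i2 : nat) : Prop :=
  forall S e, 0 < e -> exists T, forall t, t <= - T ->
    decay_weight lam2 i2 (t + S) <= (r * exp (lam2 * S) + e) * decay_weight lam1 i1 t.

Lemma weight_ratio_faster (lam1 lam2 : R) (i1 i2 : nat) :
  lam1 < lam2 -> (i2 <= 1)%nat -> weight_ratio 0 lam1 i1 lam2 i2.
Proof.
  intros Hlt Hi2 S e He. set (d := lam2 - lam1). assert (Hd : 0 < d) by (unfold d; lra).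
  pose proof (exp_pos (lam2 * S)) as HeS. pose proof (Rabs_pos S) as HS.
  (* One half of the gap [d] absorbs the constants, the other half the factor [- t]. *)
  destruct (exp_ge_eventually (d / 2) (exp (lam2 * S) * (2 + Rabs S) * / (e * (d / 2)))) as [T [HT0 HT]]; [lra|].
  exists (Rmax T (1 + Rabs S)). intros t Ht.
  pose proof (Rmax_l T (1 + Rabs S)). pose proof (Rmax_r T (1 + Rabs S)).
  specialize (HT (- t) ltac:(lra)). rewrite Rmult_0_l, Rplus_0_l.
  assert (HSb : - Rabs S <= S <= Rabs S) by (split; [pose proof (RRle_abs (- S)); rewrite Rabs_Ropp in *; lra|apply RRle_abs]).
  assert (H1 : (- (t + S)) ^ i2 <= (2 + Rabs S) * - t).
  { assert (0 <= Rabs S * (- t - 1)) by (apply Rmult_le_pos; lra).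
    destruct i2 as [|[|i2]]; [| |lia]; simpl; lra. }
  assert (H2 : 1 <= (- t) ^ i1) by (apply pow_R1_Rle; lra).
  assert (Hed : 0 < e * (d / 2)) by (apply Rmult_lt_0_compat; lra).
  assert (H3 : exp (lam2 * S) * (2 + Rabs S) <= e * (d / 2) * exp (d / 2 * - t)).
  { apply (Rmult_le_compat_l (e * (d / 2))) in HT; [|lra].
    replace (e * (d / 2) * (exp (lam2 * S) * (2 + Rabs S) * / (e * (d / 2)))) with (exp (lam2 * S) * (2 + Rabs S)) in HT by (field; lra). exact HT. }
  pose proof (exp_ineq1_le (d / 2 * - t)) as H4. pose proof (exp_pos (d / 2 * - t)) as H5.
  unfold decay_weight.
  apply Rle_trans with (e * exp (lam1 * t)).
  2:{ pose proof (exp_pos (lam1 * t)). rewrite <- (Rmult_1_r (e * exp (lam1 * t))), <- Rmult_assoc.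
      apply Rmult_le_compat_l; [apply Rmult_le_pos; lra|exact H2]. }
  replace (lam2 * (t + S)) with (lam1 * t + (lam2 * S + - (d / 2 * - t + d / 2 * - t))) by (unfold d; field).
  rewrite exp_plus. rewrite (Rmult_comm e), Rmult_assoc. apply Rmult_le_compat_l; [left; apply exp_pos|].
  rewrite exp_plus, exp_Ropp, exp_plus.
  apply (Rmult_le_reg_r (exp (d / 2 * - t) * exp (d / 2 * - t))); [apply Rmult_lt_0_compat; lra|].
  replace (exp (lam2 * S) * / (exp (d / 2 * - t) * exp (d / 2 * - t)) * (- (t + S)) ^ i2 * (exp (d / 2 * - t) * exp (d / 2 * - t)))
    with (exp (lam2 * S) * (- (t + S)) ^ i2) by (field; lra).
  apply Rle_trans with (exp (lam2 * S) * ((2 + Rabs S) * - t)); [apply Rmult_le_compat_l; lra|].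
  apply Rle_trans with (e * (d / 2) * exp (d / 2 * - t) * - t).
  - rewrite <- Rmult_assoc. apply Rmult_le_compat_r; lra.
  - replace (e * (d / 2) * exp (d / 2 * - t) * - t) with (e * exp (d / 2 * - t) * (d / 2 * - t)) by ring.
    rewrite <- (Rmult_assoc e). apply Rmult_le_compat_l; [apply Rmult_le_pos; lra|lra].
Qed.

Lemma weight_ratio_simple_double (lam : R) : weight_ratio 0 lam 1 lam 0.
Proof.
  intros S e He. exists (exp (lam * S) / e). intros t Ht. unfold decay_weight. simpl.
  rewrite Rmult_0_l, Rplus_0_l, !Rmult_1_r, Rmult_plus_distr_l, exp_plus.
  assert (exp (lam * S) <= e * - t).
  { replace (exp (lam * S)) with (e * (exp (lam * S) / e)) by (field; lra). apply Rmult_le_compat_l; lra. }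
  replace (e * (exp (lam * t) * - t)) with (exp (lam * t) * (e * - t)) by ring.
  apply Rmult_le_compat_l; [left; apply exp_pos|assumption].
Qed.

Lemma weight_ratio_same (lam : R) (i : nat) : (i <= 1)%nat -> weight_ratio 1 lam i lam i.
Proof.
  intros Hi S e He. pose proof (exp_pos (lam * S)) as HeS. pose proof (Rabs_pos S) as HS.
  assert (0 <= exp (lam * S) * Rabs S / e) by (apply Rdiv_le_0_compat; [apply Rmult_le_pos; lra|exact He]).
  exists (exp (lam * S) * Rabs S / e). intros t Ht. unfold decay_weight.
  rewrite Rmult_1_l, Rmult_plus_distr_l, exp_plus.
  pose proof (exp_pos (lam * t)).
  destruct i as [|[|i]]; [| |lia]; simpl; rewrite ?Rmult_1_r.
  - assert (0 < e * exp (lam * t)) by (apply Rmult_lt_0_compat; lra). lra.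
  - assert (exp (lam * S) * Rabs S <= e * - t).
    { replace (exp (lam * S) * Rabs S) with (e * (exp (lam * S) * Rabs S / e)) by (field; lra). apply Rmult_le_compat_l; lra. }
    assert (exp (lam * S) * - S <= exp (lam * S) * Rabs S) by (apply Rmult_le_compat_l; [lra|rewrite <- Rabs_Ropp; apply RRle_abs]).
    replace (exp (lam * t) * exp (lam * S) * - (t + S)) with (exp (lam * t) * (exp (lam * S) * - t + exp (lam * S) * - S)) by ring.
    replace ((exp (lam * S) + e) * (exp (lam * t) * - t)) with (exp (lam * t) * (exp (lam * S) * - t + e * - t)) by ring.
    apply Rmult_le_compat_l; lra.
Qed.

(** The strict inequality leaves room for shifts slightly above [S]. Monotonicity of the weight
    reduces all [s <= S + e] to the largest one, so a single [T] serves them all although [psi] is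
    not monotone. *)
Lemma asymptotic_domination (phi psi : R -> R) (lam1 lam2 : R) (i1 i2 : nat) (x1 x2 r S : R) :
  asymptotic_at_minus_infinity phi lam1 i1 x1 -> asymptotic_at_minus_infinity psi lam2 i2 x2 ->
  0 < lam2 -> (i2 <= 1)%nat -> 0 < x2 -> 0 <= r -> weight_ratio r lam1 i1 lam2 i2 ->
  x2 * (r * exp (lam2 * S)) < x1 ->
  exists e T, 0 < e /\ forall s t, s <= S + e -> t <= - T -> psi (t + s) <= phi t.
Proof.
  intros Hphi Hpsi Hlam Hi Hx2 Hr Hrat Hlt.
  (* One small [q] plays the error in both asymptotics, the error in the weight ratio and the extra
     shift; at [q = 0] the inequality is the hypothesis. *)
  assert (Hq : exists q, 0 < q /\ (x2 + q) * (r * exp (lam2 * (S + q)) + q) + q < x1).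
  { set (F := fun q => (x2 + q) * (r * exp (lam2 * (S + q)) + q) + q).
    assert (HF : continuous F 0).
    { apply (ex_derive_continuous F). unfold F. auto_derive; exact I. }
    assert (HF0 : F 0 < x1) by (unfold F; rewrite !Rplus_0_r; exact Hlt).
    destruct (proj1 (filterlim_locally _ _) HF (mkposreal (x1 - F 0) ltac:(lra))) as [d Hd].
    pose proof (cond_pos d). exists (d / 2). split; [lra|].
    specialize (Hd (d / 2)). unfold ball in Hd; simpl in Hd; unfold AbsRing_ball, abs, minus, plus, opp in Hd; simpl in Hd.
    assert (Hx : Rabs (F (d / 2) + - F 0) < x1 - F 0).
    { apply Hd. rewrite Ropp_0, Rplus_0_r, Rabs_pos_eq; lra. }
    apply Rabs_def2 in Hx. change (F (d / 2) < x1). lra. }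
  destruct Hq as [q [Hq HFq]].
  set (S' := S + q). fold S' in HFq.
  destruct (Hphi q Hq) as [T1 HT1]. destruct (Hpsi q Hq) as [T2 HT2]. destruct (Hrat S' q Hq) as [T3 HT3].
  pose proof (Rinv_0_lt_compat _ Hlam) as Hil.
  exists q, (Rmax 1 (Rmax T1 (Rmax (T2 + Rabs S') (Rmax T3 (/ lam2 + Rabs S'))))). split; [exact Hq|].
  intros s t Hs Ht. fold S' in Hs.
  pose proof (Rmax_l 1 (Rmax T1 (Rmax (T2 + Rabs S') (Rmax T3 (/ lam2 + Rabs S'))))) as M1.
  pose proof (Rmax_r 1 (Rmax T1 (Rmax (T2 + Rabs S') (Rmax T3 (/ lam2 + Rabs S'))))) as M2.
  pose proof (Rmax_l T1 (Rmax (T2 + Rabs S') (Rmax T3 (/ lam2 + Rabs S')))) as M3.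
  pose proof (Rmax_r T1 (Rmax (T2 + Rabs S') (Rmax T3 (/ lam2 + Rabs S')))) as M4.
  pose proof (Rmax_l (T2 + Rabs S') (Rmax T3 (/ lam2 + Rabs S'))) as M5.
  pose proof (Rmax_r (T2 + Rabs S') (Rmax T3 (/ lam2 + Rabs S'))) as M6.
  pose proof (Rmax_l T3 (/ lam2 + Rabs S')) as M7. pose proof (Rmax_r T3 (/ lam2 + Rabs S')) as M8.
  pose proof (RRle_abs S') as HS'.
  specialize (HT1 t ltac:(lra)). specialize (HT2 (t + s) ltac:(lra)). specialize (HT3 t ltac:(lra)).
  fold (decay_weight lam1 i1 t) in HT1. fold (decay_weight lam2 i2 (t + s)) in HT2.
  apply Rabs_le_between in HT1. apply Rabs_le_between in HT2.
  pose proof (decay_weight_monotone lam2 i2 (t + s) (t + S') Hlam Hi ltac:(lra) ltac:(lra)) as Hmono.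
  pose proof (decay_weight_pos lam1 i1 t ltac:(lra)) as HW.
  assert (H1 : (x2 + q) * decay_weight lam2 i2 (t + s) <= (x2 + q) * ((r * exp (lam2 * S') + q) * decay_weight lam1 i1 t)) by (apply Rmult_le_compat_l; lra).
  assert (H2 : ((x2 + q) * (r * exp (lam2 * S') + q) + q) * decay_weight lam1 i1 t <= x1 * decay_weight lam1 i1 t) by (apply Rmult_le_compat_r; lra).
  lra.
Qed.

(** At a maximum above [kappa] the convolution is at most [g (phi t0) < phi t0], while derivative 0
    and a nonpositive second difference demand the opposite. *)
Lemma front_le_kappa {D c : R} {b rho : nat -> R} {g : R -> R} {kappa g0 : R} {phi dphi : R -> R} :
  lattice D c b rho g kappa g0 -> front D c b rho g kappa phi dphi -> forall t, phi t <= kappa.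
Proof.
  intros HL HF t1. apply Rnot_lt_le. intros Hlt.
  pose proof (la_D HL) as HD.
  pose proof (la_nonneg HL) as Hb. pose proof (la_sum HL) as Hsum.
  pose proof (la_reaction HL) as HR. pose proof (re_kappa HR) as Hk.
  pose proof (fr_pos HF) as Hpos.
  pose proof (fr_derive HF) as Hder.
  set (C := (kappa + phi t1) / 2).
  destruct (fr_minus HF kappa Hk) as [T1 HT1].
  destruct (fr_plus HF (C - kappa)) as [T2 HT2]; [unfold C; lra|].
  destruct (continuous_max_attained phi C (Rmax (Rabs T1) (Rabs T2)) t1) as [t0 [Ht0 Hmax]].
  - intros t. apply (ex_derive_continuous phi). exists (dphi t). apply Hder.
  - intros t Ht. pose proof (Rmax_l (Rabs T1) (Rabs T2)). pose proof (Rmax_r (Rabs T1) (Rabs T2)).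
    destruct (Rle_lt_dec 0 t) as [H1|H1].
    + rewrite (Rabs_pos_eq t) in Ht by lra. specialize (HT2 t ltac:(pose proof (RRle_abs T2); lra)). apply Rabs_def2 in HT2. lra.
    + rewrite (Rabs_left t) in Ht by lra. specialize (HT1 t ltac:(pose proof (RRle_abs (- T1)); rewrite Rabs_Ropp in *; lra)). unfold C; lra.
  - unfold C; lra.
  - assert (Hd0 : - dphi t0 = 0).
    { apply (is_derive_global_min (fun t => - phi t) t0); [apply (is_derive_opp phi); apply Hder|]. intros x. specialize (Hmax x). lra. }
    pose proof (fr_eq HF t0) as Heq. replace (dphi t0) with 0 in Heq by lra.
    assert (HS : Series (fun j => b j * g (phi (t0 - rho j))) <= g (phi t0)).
    { assert (Hs : is_series (fun j => g (phi t0) * b j) (g (phi t0) * 1)) by (apply (is_series_scal_l (g (phi t0)) _ _ Hsum)).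
      rewrite Rmult_1_r in Hs. rewrite <- (is_series_unique _ _ Hs). apply Series_le; [|eexists; exact Hs].
      intros j. split; [apply Rmult_le_pos; [apply Hb|apply (re_nonneg HR); left; apply Hpos]|].
      rewrite Rmult_comm. apply Rmult_le_compat_r; [apply Hb|]. apply (re_mono HR); [left; apply Hpos|apply Hmax]. }
    pose proof (re_below HR (phi t0) ltac:(unfold C in *; lra)).
    pose proof (Hmax (t0 + 1)). pose proof (Hmax (t0 - 1)).
    assert (D * (phi (t0 + 1) + phi (t0 - 1) - 2 * phi t0) <= D * 0) by (apply Rmult_le_compat_l; lra). lra.
Qed.

Lemma front_shift {D c : R} {b rho : nat -> R} {g : R -> R} {kappa : R} {phi dphi : R -> R} (s : R) :
  front D c b rho g kappa phi dphi -> front D c b rho g kappa (fun t => phi (t + s)) (fun t => dphi (t + s)).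
Proof.
  intros [H1 [M H2] H3 H4 H5 H6]. split.
  - intros t; apply H1.
  - exists M; intros t; apply H2.
  - intros q Hq. destruct (H3 q Hq) as [T HT]. exists (T - s). intros t Ht. apply HT; lra.
  - intros q Hq. destruct (H4 q Hq) as [T HT]. exists (T - s). intros t Ht. apply HT; lra.
  - intros t. replace (dphi (t + s)) with (1 * dphi (t + s)) by ring.
    apply (is_derive_comp phi (fun t => t + s)); [apply H5|]. auto_derive; [exact I|ring].
  - intros t. rewrite H6. replace (t + 1 + s) with (t + s + 1) by ring. replace (t - 1 + s) with (t + s - 1) by ring.
    f_equal. apply Series_ext. intros j. replace (t - rho j + s) with (t + s - rho j) by ring. reflexivity.
Qed.

(** At a positive maximum of [psi - phi], each contribution to the convolution is at most [q < 1]
    times the maximum: where [psi <= phi] by monotonicity of [g], and elsewhere because both values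
    lie in [[kappa - e, kappa]]. The maximum exists since [psi <= kappa] and [phi] tends to
    [kappa]. *)
Lemma comparison_right {D c : R} {b rho : nat -> R} {g : R -> R} {kappa g0 : R} {phi dphi psi dpsi : R -> R} (q e T : R) :
  lattice D c b rho g kappa g0 -> front D c b rho g kappa phi dphi -> front D c b rho g kappa psi dpsi ->
  0 <= q < 1 ->
  (forall x y, kappa - e <= x -> x <= y -> y <= kappa -> g y - g x <= q * (y - x)) ->
  (forall t, T <= t -> kappa - e <= phi t) -> (forall t, t <= T -> psi t <= phi t) ->
  forall t, psi t <= phi t.
Proof.
  intros HL HF HG Hq Hcon HT Hle t1. apply Rnot_lt_le. intros Hlt.
  pose proof (la_D HL) as HD.
  pose proof (la_nonneg HL) as Hb. pose proof (la_sum HL) as Hsum.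
  pose proof (la_reaction HL) as HR.
  pose proof (fr_pos HF) as Hpos. pose proof (fr_pos HG) as Hpos2.
  pose proof (fr_derive HF) as Hd1. pose proof (fr_derive HG) as Hd2.
  set (w := fun t => psi t - phi t). set (C := w t1 / 2). assert (HC : 0 < C) by (unfold C, w; lra).
  assert (Hdw : forall t, is_derive w t (dpsi t - dphi t)).
  { intros t. apply (is_derive_minus psi phi); [apply Hd2|apply Hd1]. }
  destruct (fr_plus HF (C / 2) ltac:(lra)) as [T1 HT1].
  destruct (continuous_max_attained w C (Rmax (Rabs T) (Rabs T1)) t1) as [t0 [Ht0 Hmax]].
  - intros t. apply (ex_derive_continuous w). eexists; apply Hdw.
  - intros t Ht. pose proof (Rmax_l (Rabs T) (Rabs T1)). pose proof (Rmax_r (Rabs T) (Rabs T1)).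
    destruct (Rle_lt_dec 0 t) as [H1|H1].
    + rewrite (Rabs_pos_eq t) in Ht by lra. specialize (HT1 t ltac:(pose proof (RRle_abs T1); lra)). apply Rabs_def2 in HT1.
      pose proof (front_le_kappa HL HG t). unfold w; lra.
    + rewrite (Rabs_left t) in Ht by lra. specialize (Hle t ltac:(pose proof (RRle_abs (- T)); rewrite Rabs_Ropp in *; lra)). unfold w; lra.
  - unfold C; fold (w t1); unfold C in HC; lra.
  - assert (Hd0 : - (dpsi t0 - dphi t0) = 0).
    { apply (is_derive_global_min (fun t => - w t) t0); [apply (is_derive_opp w); apply Hdw|]. intros x. specialize (Hmax x). lra. }
    pose proof (fr_eq HF t0) as E1. pose proof (fr_eq HG t0) as E2.
    replace (dpsi t0) with (dphi t0) in E2 by lra. rewrite E1 in E2.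
    assert (HS : Series (fun j => b j * g (psi (t0 - rho j))) - Series (fun j => b j * g (phi (t0 - rho j))) <= q * w t0).
    { rewrite <- Series_minus by (eapply front_ex_series; eassumption).
      assert (Hs : is_series (fun j => q * w t0 * b j) (q * w t0 * 1)) by (apply (is_series_scal_l (q * w t0) _ _ Hsum)).
      rewrite Rmult_1_r in Hs. rewrite <- (is_series_unique _ _ Hs).
      assert (Hterm : forall j, b j * g (psi (t0 - rho j)) - b j * g (phi (t0 - rho j)) <= q * w t0 * b j).
      { intros j. rewrite <- Rmult_minus_distr_l, Rmult_comm. apply Rmult_le_compat_r; [apply Hb|].
        set (s := t0 - rho j). destruct (Rle_lt_dec (psi s) (phi s)) as [H1|H1].
        - pose proof (re_mono HR (psi s) (phi s) ltac:(left; apply Hpos2) H1).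
          assert (0 <= q * w t0) by (apply Rmult_le_pos; lra). lra.
        - assert (T < s) by (apply Rnot_le_lt; intros H2; specialize (Hle s H2); lra).
          specialize (Hcon (phi s) (psi s) (HT s ltac:(lra)) ltac:(lra) (front_le_kappa HL HG s)).
          specialize (Hmax s). assert (q * (psi s - phi s) <= q * w t0) by (apply Rmult_le_compat_l; [lra|exact Hmax]). lra. }
      assert (Hneg : Series (fun j => q * w t0 * b j) - Series (fun j => b j * g (psi (t0 - rho j)) - b j * g (phi (t0 - rho j))) >= 0).
      { assert (Hexd : ex_series (fun j => b j * g (psi (t0 - rho j)) - b j * g (phi (t0 - rho j)))).
        { apply (ex_series_minus (fun j => b j * g (psi (t0 - rho j))) (fun j => b j * g (phi (t0 - rho j))));
            [apply (front_ex_series HL HG)|apply (front_ex_series HL HF)]. }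
        rewrite <- Series_minus; [|eexists; exact Hs|exact Hexd].
        apply Rle_ge, Series_nonneg; [intros j; specialize (Hterm j); lra|].
        apply (ex_series_minus (fun j => q * w t0 * b j)); [eexists; exact Hs|exact Hexd]. }
      lra. }
    pose proof (Hmax (t0 + 1)). pose proof (Hmax (t0 - 1)).
    assert (D * (w (t0 + 1) + w (t0 - 1) - 2 * w t0) <= D * 0) by (apply Rmult_le_compat_l; lra).
    assert (q * w t0 < 1 * w t0) by (apply Rmult_lt_compat_r; lra).
    unfold w in *. lra.
Qed.

(** Monotonicity of [g] only says that the convolution helps; the diffusion term carries the contact
    from [t0] to all [t], by Harnack with [eta = 0]. *)
Lemma strong_comparison {D c : R} {b rho : nat -> R} {g : R -> R} {kappa g0 : R} {phi dphi psi dpsi : R -> R} (t0 : R) :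
  lattice D c b rho g kappa g0 -> front D c b rho g kappa phi dphi -> front D c b rho g kappa psi dpsi ->
  (forall t, psi t <= phi t) -> phi t0 <= psi t0 -> forall t, phi t = psi t.
Proof.
  intros HL HF HG Hle Ht0 t.
  pose proof (la_D HL) as HD. pose proof (la_nonneg HL) as Hb.
  pose proof (la_reaction HL) as HR.
  destruct (exists_nat_ge (Rabs (t - t0))) as [N HN].
  destruct (harnack c D (2 * D + 1) N (la_c HL) HD ltac:(lra)) as [C [HC H]].
  set (u := fun s => phi (t0 + s) - psi (t0 + s)).
  assert (Hu : forall s, 0 <= u s) by (intros s; specialize (Hle (t0 + s)); unfold u; lra).
  assert (Hin : forall s, D * u (s + 1) + D * u (s - 1) - (2 * D + 1) * u s <= c * (dphi (t0 + s) - dpsi (t0 + s))).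
  { intros s. rewrite Rmult_minus_distr_l, (fr_eq HF), (fr_eq HG).
    assert (Series (fun j => b j * g (psi (t0 + s - rho j))) <= Series (fun j => b j * g (phi (t0 + s - rho j)))).
    { apply Series_le; [|apply (front_ex_series HL HF)].
      intros j. pose proof (fr_pos HG (t0 + s - rho j)).
      split; [apply Rmult_le_pos; [apply Hb|apply (re_nonneg HR); lra]|].
      apply Rmult_le_compat_l; [apply Hb|]. apply (re_mono HR); [lra|apply Hle]. }
    unfold u. replace (t0 + (s + 1)) with (t0 + s + 1) by ring. replace (t0 + (s - 1)) with (t0 + s - 1) by ring. lra. }
  assert (Hend : u (t - t0) <= C * 0).
  { apply (H u (fun s => dphi (t0 + s) - dpsi (t0 + s)) 0).
    - lra.
    - intros s. apply (is_derive_minus (fun s => phi (t0 + s)) (fun s => psi (t0 + s))).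
      + replace (dphi (t0 + s)) with (1 * dphi (t0 + s)) by ring.
        apply (is_derive_comp phi (fun s => t0 + s)); [apply (fr_derive HF)|]. auto_derive; [exact I|ring].
      + replace (dpsi (t0 + s)) with (1 * dpsi (t0 + s)) by ring.
        apply (is_derive_comp psi (fun s => t0 + s)); [apply (fr_derive HG)|]. auto_derive; [exact I|ring].
    - intros s _. specialize (Hin s). assert (0 <= D * u (s - 1)) by (apply Rmult_le_pos; [lra|apply Hu]). lra.
    - intros s _. specialize (Hin s). assert (0 <= D * u (s + 1)) by (apply Rmult_le_pos; [lra|apply Hu]). lra.
    - intros s _. specialize (Hu s). lra.
    - unfold u. rewrite Rplus_0_r. lra.
    - exact HN. }
  unfold u in Hend. replace (t0 + (t - t0)) with t in Hend by ring. specialize (Hle t). lra.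
Qed.

Lemma front_lipschitz {D c : R} {b rho : nat -> R} {g : R -> R} {kappa g0 : R} {phi dphi : R -> R} :
  lattice D c b rho g kappa g0 -> front D c b rho g kappa phi dphi ->
  exists K, 0 < K /\ forall s t, Rabs (phi t - phi s) <= K * Rabs (t - s).
Proof.
  intros HL HF.
  pose proof (la_D HL) as HD. pose proof (la_c HL) as Hc.
  pose proof (la_nonneg HL) as Hb. pose proof (la_sum HL) as Hsum.
  pose proof (la_reaction HL) as HR. pose proof (re_kappa HR) as Hk.
  pose proof (fr_pos HF) as Hpos. pose proof (front_le_kappa HL HF) as Hle.
  pose proof (re_nonneg HR kappa ltac:(lra)) as Hgk.
  assert (Hca : 0 < Rabs c) by (apply Rabs_pos_lt; exact Hc).
  set (K := (2 * D * kappa + kappa + g kappa) / Rabs c).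
  assert (Hnum : 0 < 2 * D * kappa + kappa + g kappa) by (assert (0 < D * kappa) by (apply Rmult_lt_0_compat; lra); lra).
  exists K. split; [apply Rdiv_lt_0_compat; assumption|].
  intros s t. apply (derivative_bound_lipschitz phi dphi); [intros; apply (fr_derive HF)|].
  intros x _. apply (Rmult_le_reg_l (Rabs c)); [exact Hca|]. rewrite <- Rabs_mult, (fr_eq HF x).
  replace (Rabs c * K) with (2 * D * kappa + kappa + g kappa) by (unfold K; field; lra).
  assert (H0 : 0 <= Series (fun j => b j * g (phi (x - rho j)))).
  { apply Series_nonneg; [|apply (front_ex_series HL HF)].
    intros j. apply Rmult_le_pos; [apply Hb|apply (re_nonneg HR); left; apply Hpos]. }
  assert (H1 : Series (fun j => b j * g (phi (x - rho j))) <= g kappa).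
  { assert (Hs : is_series (fun j => g kappa * b j) (g kappa * 1)) by (apply (is_series_scal_l (g kappa) _ _ Hsum)).
    rewrite Rmult_1_r in Hs. rewrite <- (is_series_unique _ _ Hs). apply Series_le; [|eexists; exact Hs].
    intros j. split; [apply Rmult_le_pos; [apply Hb|apply (re_nonneg HR); left; apply Hpos]|].
    rewrite Rmult_comm. apply Rmult_le_compat_r; [apply Hb|]. apply (re_mono HR); [left; apply Hpos|apply Hle]. }
  pose proof (Hpos x). pose proof (Hpos (x + 1)). pose proof (Hpos (x - 1)).
  pose proof (Hle x). pose proof (Hle (x + 1)). pose proof (Hle (x - 1)).
  assert (D * (phi (x + 1) + phi (x - 1) - 2 * phi x) <= D * (2 * kappa)) by (apply Rmult_le_compat_l; lra).
  assert (D * (- (2 * kappa)) <= D * (phi (x + 1) + phi (x - 1) - 2 * phi x)) by (apply Rmult_le_compat_l; lra).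
  apply Rabs_le. lra.
Qed.

Lemma front_gap {D c : R} {b rho : nat -> R} {g : R -> R} {kappa : R} {phi dphi psi dpsi : R -> R} (t1 t2 : R) :
  front D c b rho g kappa phi dphi -> front D c b rho g kappa psi dpsi -> t1 <= t2 ->
  (forall t, psi t < phi t) -> exists m, 0 < m /\ forall t, t1 <= t <= t2 -> m <= phi t - psi t.
Proof.
  intros HF HG Ht Hlt.
  destruct (continuity_ab_min (fun t => phi t - psi t) t1 t2 Ht) as [x [Hx _]].
  - intros t _. apply continuity_pt_filterlim. apply (ex_derive_continuous (fun t => phi t - psi t)).
    exists (dphi t - dpsi t). apply (is_derive_minus phi psi); [apply (fr_derive HF)|apply (fr_derive HG)].
  - exists (phi x - psi x). split; [specialize (Hlt x); lra|exact Hx].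
Qed.

(** [s0] is the largest admissible shift. If the fronts stay strictly apart there and the asymptotic
    ratio at [-oo] is strict too, a slightly larger shift is still admissible, which is absurd. *)
Lemma sliding {D c : R} {b rho : nat -> R} {g : R -> R} {kappa g0 : R} {phi dphi psi dpsi : R -> R}
  {lam1 lam2 : R} {i1 i2 : nat} {x1 x2 : R} (r : R) :
  lattice D c b rho g kappa g0 -> front D c b rho g kappa phi dphi -> front D c b rho g kappa psi dpsi ->
  asymptotic_at_minus_infinity phi lam1 i1 x1 -> asymptotic_at_minus_infinity psi lam2 i2 x2 ->
  0 < lam2 -> (i2 <= 1)%nat -> 0 < x1 -> 0 < x2 -> 0 <= r -> weight_ratio r lam1 i1 lam2 i2 ->
  exists s0, (forall s t, s <= s0 -> psi (t + s) <= phi t) /\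
    ((forall t, phi t = psi (t + s0)) \/ x1 <= x2 * (r * exp (lam2 * s0))).
Proof.
  intros HL HF HG Hphi Hpsi Hlam Hi Hx1 Hx2 Hr Hrat.
  pose proof (la_reaction HL) as HR. pose proof (re_kappa HR) as Hk.
  pose proof (fr_pos HF) as Hpos.
  destruct (re_contract HR) as [q [e [Hq [He Hcon]]]].
  destruct (fr_plus HF e He) as [T0 HT0].
  set (T2 := T0 + 1).
  assert (HT2 : forall t, T2 <= t -> kappa - e <= phi t).
  { intros t Ht. specialize (HT0 t ltac:(unfold T2 in *; lra)). apply Rabs_def2 in HT0. lra. }
  (* Order propagates to the right of [T2] by itself, so a slide only has to be checked on a left
     half line and a compact interval. *)
  assert (Hright : forall s, (forall t, t <= T2 -> psi (t + s) <= phi t) -> forall t, psi (t + s) <= phi t).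
  { intros s Hs. apply (comparison_right q e T2 HL HF (front_shift s HG) Hq Hcon HT2 Hs). }
  assert (Hdom := fun S => asymptotic_domination phi psi lam1 lam2 i1 i2 x1 x2 r S Hphi Hpsi Hlam Hi Hx2 Hr Hrat).
  (* All smaller shifts are included, because without monotonicity of [psi] the order at one shift
     does not imply the order at smaller ones. *)
  set (P := fun s => forall s', s' <= s -> forall t, psi (t + s') <= phi t).
  assert (Hne : exists s, P s).
  { destruct (exp_ge_eventually lam2 (x2 * r / x1 + 1) Hlam) as [Y [HY0 HY]].
    specialize (HY Y (Rle_refl _)).
    destruct (Hdom (- Y)) as [e1 [T1 [He1 HT1]]].
    { replace (lam2 * - Y) with (- (lam2 * Y)) by ring. rewrite exp_Ropp.
      pose proof (exp_pos (lam2 * Y)).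
      apply (Rmult_lt_reg_r (exp (lam2 * Y))); [assumption|].
      replace (x2 * (r * / exp (lam2 * Y)) * exp (lam2 * Y)) with (x2 * r) by (field; lra).
      apply (Rmult_le_compat_l x1) in HY; [|lra]. replace (x1 * (x2 * r / x1 + 1)) with (x2 * r + x1) in HY by (field; lra). lra. }
    set (L := Rmin (- T1) T2). assert (HL1 : L <= - T1) by apply Rmin_l. assert (HL2 : L <= T2) by apply Rmin_r.
    assert (Hcpt : exists m, 0 < m /\ forall t, L <= t <= T2 -> m <= phi t).
    { destruct (continuity_ab_min phi L T2 HL2) as [x [Hx _]].
      - intros t _. apply continuity_pt_filterlim. apply (ex_derive_continuous phi). exists (dphi t). apply (fr_derive HF).
      - exists (phi x). split; [apply Hpos|exact Hx]. }
    destruct Hcpt as [m [Hm Hmin]].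
    destruct (fr_minus HG m Hm) as [T3 HT3].
    exists (Rmin (- Y) (T3 - T2 - 1)). intros s Hs.
    pose proof (Rmin_l (- Y) (T3 - T2 - 1)). pose proof (Rmin_r (- Y) (T3 - T2 - 1)).
    apply Hright. intros t Ht. destruct (Rle_lt_dec t L) as [H1|H1].
    - apply HT1; lra.
    - specialize (HT3 (t + s) ltac:(lra)). specialize (Hmin t ltac:(lra)). lra. }
  assert (Hbd : bound P).
  { destruct (fr_minus HF (kappa / 2) ltac:(lra)) as [T3 HT3].
    destruct (fr_plus HG (kappa / 2) ltac:(lra)) as [T4 HT4].
    exists (T4 - (T3 - 1) + 1). intros s Hs. apply Rnot_lt_le. intros Hlt.
    specialize (Hs s (Rle_refl _) (T3 - 1)). specialize (HT3 (T3 - 1) ltac:(lra)).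
    specialize (HT4 (T3 - 1 + s) ltac:(lra)). apply Rabs_def2 in HT4. lra. }
  destruct (completeness P Hbd Hne) as [s0 [Hs1 Hs2]].
  destruct (front_lipschitz HL HG) as [K [HK Hlip]].
  assert (Hbelow : forall s t, s < s0 -> psi (t + s) <= phi t).
  { intros s t Hs. destruct (classic (exists s', s < s' /\ P s')) as [[s' [Hs' HP]]|Hno].
    - apply HP; lra.
    - exfalso. assert (s0 <= s); [|lra]. apply Hs2. intros y Hy. apply Rnot_lt_le. intros Hlt. apply Hno. exists y; split; assumption. }
  assert (Hat : forall t, psi (t + s0) <= phi t).
  { intros t. apply Rle_plus_epsilon. intros d Hd.
    specialize (Hbelow (s0 - d / K) t). assert (0 < d / K) by (apply Rdiv_lt_0_compat; lra).
    specialize (Hbelow ltac:(lra)). specialize (Hlip (t + (s0 - d / K)) (t + s0)).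
    replace (t + s0 - (t + (s0 - d / K))) with (d / K) in Hlip by ring. rewrite (Rabs_pos_eq (d / K)) in Hlip by lra.
    replace (K * (d / K)) with d in Hlip by (field; lra). apply Rabs_le_between in Hlip. lra. }
  exists s0. split.
  { intros s t Hs. destruct Hs as [Hs| ->]; [apply Hbelow; exact Hs|apply Hat]. }
  destruct (classic (exists t, phi t <= psi (t + s0))) as [[t0 Ht0]|Hstrict].
  { left. apply (strong_comparison t0 HL HF (front_shift s0 HG) Hat Ht0). }
  right. apply Rnot_lt_le. intros Hlt.
  assert (Hpos2 : forall t, psi (t + s0) < phi t).
  { intros t. apply Rnot_le_lt. intros H. apply Hstrict. exists t; exact H. }
  destruct (Hdom s0 Hlt) as [e1 [T1 [He1 HT1]]].
  set (L := Rmin (- T1) T2). assert (HL1 : L <= - T1) by apply Rmin_l. assert (HL2 : L <= T2) by apply Rmin_r.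
  destruct (front_gap L T2 HF (front_shift s0 HG) HL2 Hpos2) as [m [Hm Hmin]].
  (* [e1] preserves the domination near [-oo]; a shift by at most [m / K] raises [psi] by at most
     the gap [m]. *)
  set (d := Rmin e1 (m / K)). assert (Hd : 0 < d) by (apply Rmin_glb_lt; [exact He1|apply Rdiv_lt_0_compat; lra]).
  assert (Hd1 : d <= e1) by apply Rmin_l. assert (Hd2 : d <= m / K) by apply Rmin_r.
  assert (s0 + d <= s0); [|lra]. apply Hs1. intros s Hs.
  destruct (Rle_lt_dec s s0) as [Hss|Hss].
  { intros t. destruct Hss as [Hss| ->]; [apply Hbelow; exact Hss|apply Hat]. }
  apply Hright. intros t Ht. destruct (Rle_lt_dec t L) as [H1|H1]; [apply HT1; lra|].
  specialize (Hmin t ltac:(lra)). specialize (Hlip (t + s0) (t + s)).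
  replace (t + s - (t + s0)) with (s - s0) in Hlip by ring. rewrite (Rabs_pos_eq (s - s0)) in Hlip by lra.
  assert (K * (s - s0) <= m).
  { replace m with (K * (m / K)) by (field; lra). apply Rmult_le_compat_l; lra. }
  apply Rabs_le_between in Hlip. lra.
Qed.

Lemma fronts_unique (D c : R) (b rho : nat -> R) (g : R -> R) (kappa g0 : R) (phi dphi psi dpsi : R -> R) :
  lattice D c b rho g kappa g0 -> front D c b rho g kappa phi dphi -> front D c b rho g kappa psi dpsi ->
  exists s0, forall t, phi t = psi (t + s0).
Proof.
  intros HL HF HG.
  destruct (front_asymptotics HL HF) as [l1 [i1 [x1 [Hl1 [Hi1 [Hx1 H1]]]]]].
  destruct (front_asymptotics HL HG) as [l2 [i2 [x2 [Hl2 [Hi2 [Hx2 H2]]]]]].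
  (* With [r = 0] the second alternative of [sliding] reads [x1 <= 0], so the fronts must
     coincide. *)
  assert (Hstrict : weight_ratio 0 l1 i1 l2 i2 -> exists s0, forall t, phi t = psi (t + s0)).
  { intros Hrat. destruct (sliding 0 HL HF HG H1 H2 Hl2 Hi2 Hx1 Hx2 (Rle_refl _) Hrat) as [s0 [_ [H|H]]].
    - exists s0; exact H.
    - exfalso. rewrite Rmult_0_l, Rmult_0_r in H. lra. }
  assert (Hstrict' : weight_ratio 0 l2 i2 l1 i1 -> exists s0, forall t, phi t = psi (t + s0)).
  { intros Hrat. destruct (sliding 0 HL HG HF H2 H1 Hl1 Hi1 Hx2 Hx1 (Rle_refl _) Hrat) as [s0 [_ [H|H]]].
    - exists (- s0). intros t. rewrite H. f_equal. ring.
    - exfalso. rewrite Rmult_0_l, Rmult_0_r in H. lra. }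
  destruct (Rtotal_order l1 l2) as [Hl|[Hl|Hl]].
  - apply Hstrict. apply weight_ratio_faster; assumption.
  - subst l2. destruct (lt_eq_lt_dec i1 i2) as [[Hi|Hi]|Hi].
    + apply Hstrict'. replace i1 with 0%nat by lia. replace i2 with 1%nat by lia. apply weight_ratio_simple_double.
    + subst i2. pose proof (weight_ratio_same l1 i1 Hi1) as Hrat.
      destruct (sliding 1 HL HF HG H1 H2 Hl1 Hi1 Hx1 Hx2 Rle_0_1 Hrat) as [s0 [Ha [H|H]]].
      { exists s0; exact H. }
      destruct (sliding 1 HL HG HF H2 H1 Hl1 Hi1 Hx2 Hx1 Rle_0_1 Hrat) as [s1 [Hb [H'|H']]].
      { exists (- s1). intros t. rewrite H'. f_equal. ring. }
      rewrite Rmult_1_l in H, H'.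
      (* Multiplying [x1 <= x2 exp (l1 s0)] and [x2 <= x1 exp (l1 s1)] gives [s0 + s1 >= 0]. Thus
         [- s0] is an admissible shift for the exchanged roles, and the two inequalities at matching
         shifts force equality. *)
      assert (Hs : - s0 <= s1).
      { assert (He : 1 <= exp (l1 * (s0 + s1))).
        { replace (l1 * (s0 + s1)) with (l1 * s0 + l1 * s1) by ring. rewrite exp_plus.
          pose proof (exp_pos (l1 * s0)). pose proof (exp_pos (l1 * s1)).
          apply (Rmult_le_compat_r (exp (l1 * s1))) in H; [|lra].
          apply (Rmult_le_reg_l x2); [exact Hx2|]. lra. }
        apply Rnot_lt_le. intros Hlt. assert (exp (l1 * (s0 + s1)) < exp 0).
        { apply exp_increasing. assert (0 < l1 * - (s0 + s1)) by (apply Rmult_lt_0_compat; lra). lra. }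
        rewrite exp_0 in *. lra. }
      exists s0. intros t. apply Rle_antisym; [|apply Ha; lra].
      specialize (Hb (- s0) (t + s0) Hs). replace (t + s0 + - s0) with t in Hb by ring. exact Hb.
    + apply Hstrict. replace i2 with 0%nat by lia. replace i1 with 1%nat by lia. apply weight_ratio_simple_double.
  - apply Hstrict'. apply weight_ratio_faster; assumption.
Qed.

Lemma front_of_traveling_front (D h : R) (beta : Z -> R) (g : R -> R) (kappa c g0 : R) (phi : R -> R) :
  (forall k, 0 <= beta k) -> reaction g kappa g0 -> traveling_front D h beta g kappa c phi ->
  exists dphi, front D c (fun j => beta (Zenum j)) (fun j => IZR (Zenum j) + c * h) g kappa phi dphi.
Proof.
  intros Hb HR [Hpos [[M HM] [Hminus [Hplus [dphi [Hd Heq]]]]]].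
  exists dphi. split.
  - exact Hpos.
  - exists M. intros t. eapply Rle_trans; [apply RRle_abs|apply HM].
  - intros q Hq. destruct (Hminus q Hq) as [T HT]. exists T. intros t Ht. eapply Rle_lt_trans; [apply RRle_abs|apply HT; exact Ht].
  - exact Hplus.
  - intros t. apply is_derive_Reals. apply Hd.
  - intros t. specialize (Heq t). apply Zsum_to_is_series in Heq.
    + rewrite (Series_ext _ (fun j => beta (Zenum j) * g (phi (t - IZR (Zenum j) - c * h)))).
      * rewrite (is_series_unique _ _ Heq). ring.
      * intros j. replace (t - (IZR (Zenum j) + c * h)) with (t - IZR (Zenum j) - c * h) by ring. reflexivity.
    + intros k. apply Rmult_le_pos; [apply Hb|]. apply (re_nonneg HR). left; apply Hpos.
Qed.

Theorem theorem3 (D h : R) (beta : Z -> R) (g : R -> R) (kappa c : R)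
    (phi psi : R -> R)
    (hD : 0 < D) (hh : 0 < h)
    (hbeta_nonneg : forall k, 0 <= beta k)
    (hbeta_sum : Zsum_to beta 1)
    (hgamma : gamma_cond beta)
    (hg : hyp_H_weak g kappa)
    (hc : c <> 0)
    (hphi : traveling_front D h beta g kappa c phi)
    (hpsi : traveling_front D h beta g kappa c psi) :
  exists s0 : R, forall s : R, phi s = psi (s + s0).
Proof.
  destruct (reaction_of_hyp g kappa hg) as [g0 HR].
  destruct (front_of_traveling_front D h beta g kappa c g0 phi hbeta_nonneg HR hphi) as [dphi HF].
  destruct (front_of_traveling_front D h beta g kappa c g0 psi hbeta_nonneg HR hpsi) as [dpsi HG].
  eapply (fronts_unique D c _ _ g kappa g0 phi dphi psi dpsi); [|exact HF|exact HG].
  split; try assumption.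
  - intros j. apply hbeta_nonneg.
  - apply Zsum_to_is_series; assumption.
  - intros z Hz Hfin. apply (gamma_cond_open beta (c * h) z hbeta_nonneg hbeta_sum hgamma Hz Hfin).
Qed.
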